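(* There exists $d_*>0$ such that for every $0<d\le d_*$ the map $$u_{n+1}=v_n,\qquad v_{n+1}=2v_n-u_n+\frac1d\left(\mu v_n-2v_n^3+v_n^5\right)$$ has a $1$-loop $\Gamma$ of heteroclinic connections between $(0,0)$ and $(U_+(\mu),U_+(\mu))$, $U_+(\mu)=\sqrt{1+\sqrt{1-\mu}}$, for which the following holds: the on-site symmetric homoclinic orbits with long plateau associated with $\Gamma$ all lie on a single connected bifurcation curve, and so do the off-site ones. Consequently, the corresponding steady-state solutions of $$\dot U_n=d(U_{n+1}+U_{n-1}-2U_n)-\mu U_n+2U_n^3-U_n^5,\qquad n\in\mathbb{Z},$$ snake.
   Context: Here $\mu\in(0,1)$ is the bifurcation parameter. With $(u_n,v_n)=(U_{n-1},U_n)$, bounded orbits of the map correspond to steady states of the lattice system. The map is reversible with respect to $\mathcal{R}(u,v)=(v,u)$. An orbit $w=\{w_n\}_{n\in\mathbb{Z}}\subset\mathbb{R}^2$ is symmetric if $\mathcal{R}$ maps the orbit onto itself; it is on-site if $\mathcal{R}w_n=w_n$ for some $n$, and off-site otherwise (then $\mathcal{R}w_{n-1}=w_n$ for some $n$). $1$-loop: Let $J\subset(0,1)$ be a compact interval, $S$ the left shift $[Sw]_n=w_{n+1}$ on $\ell^\infty(\mathbb{Z})$ (bounded $\mathbb{R}^2$-valued sequences), and $\Gamma$ a connected component of the set of pairs $(w,\mu)\in\ell^\infty\times J$ such that $w$ is an orbit of the map at $\mu$ with $w_n\to(0,0)$ as $n\to-\infty$ and $w_n\to(U_+(\mu),U_+(\mu))$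 as $n\to\infty$. Suppose the image of $\Gamma$ after identifying sequences that are shifts of each other is a closed loop, parametrized smoothly by $s\in[0,1]$; lift this to a smooth curve $(w(s),\mu(s))\in\Gamma$. It is a $1$-loop if $S^kw(1)=w(0)$ for some integer $k\neq0$. Long-plateau homoclinic orbits associated with $\Gamma$: symmetric orbits homoclinic to $(0,0)$ that, for sufficiently small $\delta>0$ and sufficiently large $N$, remain for $N+1$ consecutive indices in the $\delta$-neighbourhood of $(U_+(\mu),U_+(\mu))$, and whose part up to the midpoint of this plateau is, after a shift, uniformly $\delta$-close to an orbit $\bar w$ with $(\bar w,\bar\mu)\in\Gamma$ and $|\mu-\bar\mu|<\delta$. Bifurcation curves are curves in $\ell^\infty\times J$ of such orbits, normalized by a shift so that $\mathcal{R}w_n=w_{-n}$ (on-site) or $\mathcal{R}w_n=w_{-n-1}$ (off-site) for all $n$. Snaking: the localized steady states lie on a connected bifurcation curve (upon varying $\mu$) along which their plateau length, and hence their $\ell^2$-norm, goes to infinity. *)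

(* Defs.v *)
From HB Require Import structures.
From mathcomp Require Import all_boot all_order all_algebra.
From mathcomp Require Import all_classical all_reals all_analysis.

Set Implicit Arguments.
Unset Strict Implicit.
Unset Printing Implicit Defensive.

Import Order.TTheory GRing.Theory Num.Theory.
Import numFieldNormedType.Exports.

Local Open Scope classical_set_scope.
Local Open Scope ring_scope.

(** ** Sequences with a parameter, and smooth curves of them *)

(** Pairs (w, mu) of a bi-infinite sequence and a parameter. The topology on
    sequences is that of uniform convergence; on bounded sequences it is the
    norm topology of l^oo(Z). Boundedness is required separately, by the sets
    of orbits below. *)
Notation seqpar R V := ({uniform int -> V} * R)%type.

(** The shift S^k, with [S w]_n = w_(n+1), acting on the sequence only. *)
Definition shift_seq (R : realType) (V : normedModType R) (k : int)
    (p : seqpar R V) : seqpar R V :=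
  ((fun n => p.1 (n + k)), p.2).

Definition difference_quotient (R : realType) (V : normedModType R)
    (g : R -> seqpar R V) (s t : R) : seqpar R V :=
  ((fun n => (t - s)^-1 *: ((g t).1 n - (g s).1 n)),
   (t - s)^-1 * ((g t).2 - (g s).2)).

(** [g j] is the [j]-th derivative of the curve [g 0] on [A] (one-sided at
    boundary points of [A]), as a curve in l^oo x R, and the velocity [g 1]
    does not vanish. *)
Definition smooth_curve (R : realType) (V : normedModType R) (A : set R)
    (g : nat -> R -> seqpar R V) : Prop :=
  (forall j s, A s ->
     difference_quotient (g j) s @ within A s^' --> g j.+1 s) /\
  (forall s, A s -> g 1%N s <> ((fun=> 0), 0)).

(** An injectively parametrized smooth half-line that lies in [P] and
    covers [Q]. *)
Definition bifurcation_curve (R : realType) (V : normedModType R)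
    (P Q : set (seqpar R V)) (g : nat -> R -> seqpar R V) : Prop :=
  [/\ smooth_curve `[0, +oo[ g,
      {in `[0, +oo[ &, injective (g 0%N)},
      g 0%N @` `[0, +oo[ `<=` P &
      Q `<=` g 0%N @` `[0, +oo[].

(** ** The map, its reverser and its orbits *)

Section Map.
Variable R : realType.
Implicit Types (d mu : R) (z : R * R) (w : int -> R * R).

Definition map_F d mu z : R * R :=
  (z.2, 2 * z.2 - z.1 + d^-1 * (mu * z.2 - 2 * z.2 ^+ 3 + z.2 ^+ 5)).

Definition reverser z : R * R := (z.2, z.1).

Definition Uplus mu : R := Num.sqrt (1 + Num.sqrt (1 - mu)).

Definition plateau_state mu : R * R := (Uplus mu, Uplus mu).

Definition is_orbit d mu w : Prop := forall n, w (n + 1) = map_F d mu (w n).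

Definition tends_at_minus_infinity w z : Prop :=
  (fun n : nat => w (- n%:Z)) @ \oo --> z.

Definition tends_at_plus_infinity w z : Prop :=
  (fun n : nat => w n%:Z) @ \oo --> z.

Definition symmetric_orbit w : Prop := reverser @` range w = range w.

Definition on_site w : Prop := exists n, reverser (w n) = w n.

End Map.

(** ** Heteroclinic orbits and 1-loops *)

Section Loops.
Variable R : realType.
Implicit Types (d : R) (J : set R) (Gamma : set (seqpar R (R * R)%type)).

Definition heteroclinics d J : set (seqpar R (R * R)%type) :=
  [set p | [/\ J p.2, bounded_fun p.1, is_orbit d p.2 p.1,
      tends_at_minus_infinity p.1 (0, 0) &
      tends_at_plus_infinity p.1 (plateau_state p.2)]].

(** The loop, in the quotient by shifts, is the curve [g 0] on [0, 1] with its
    end points identified; the condition on all [g j] at the end points says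
    that the loop also closes up smoothly (case [j = 0]: S^k w(1) = w(0) and
    mu(1) = mu(0)). *)
Definition one_loop d J Gamma : Prop :=
  (exists2 p, heteroclinics d J p &
     Gamma = connected_component (heteroclinics d J) p) /\
  exists (g : nat -> R -> seqpar R (R * R)%type) (k : int),
    [/\ smooth_curve `[0, 1] g,
        g 0%N @` `[0, 1] `<=` Gamma,
        (forall p, Gamma p ->
           exists2 s : R, `[0, 1]%classic s &
             exists j : int, p = shift_seq j (g 0%N s)),
        (forall (s t : R) (j : int), `[0, 1[%classic s -> `[0, 1[%classic t ->
           g 0%N s = shift_seq j (g 0%N t) -> s = t) &
        k != 0 /\ forall j, shift_seq k (g j 1) = g j 0].

End Loops.

(** ** Symmetric homoclinic orbits with long plateau *)

Inductive site := OnSite | OffSite.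

(** The normalization is R w_n = w_(c - n) with c = 0, resp. c = -1. *)
Definition site_center (k : site) : int := if k is OnSite then 0 else -1.

Section Homoclinics.
Variable R : realType.
Implicit Types (d delta : R) (J : set R) (Gamma : set (seqpar R (R * R)%type)).

Definition site_type (k : site) (w : int -> R * R) : Prop :=
  if k is OnSite then on_site w else ~ on_site w.

Definition symmetric_homoclinics d J (k : site) : set (seqpar R (R * R)%type) :=
  [set p | [/\ J p.2, bounded_fun p.1, is_orbit d p.2 p.1,
      tends_at_minus_infinity p.1 (0, 0) /\
      tends_at_plus_infinity p.1 (0, 0) &
      [/\ symmetric_orbit p.1, site_type k p.1 &
          forall n, reverser (p.1 n) = p.1 (site_center k - n)]]].

(** The plateau consists of the (at least N + 1) indices a, ..., b; its
    midpoint (a + b) / 2 is the centre of symmetry of the orbit. *)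
Definition long_plateau d J Gamma (k : site) delta (N : nat) :
    set (seqpar R (R * R)%type) :=
  [set p | symmetric_homoclinics d J k p /\
    exists a b : int,
      [/\ a + b = site_center k, N%:Z <= b - a,
          forall n : int, a <= n <= b -> `|p.1 n - plateau_state p.2| < delta &
          exists (q : seqpar R (R * R)%type) (j : int),
            [/\ Gamma q, `|p.2 - q.2| < delta &
              forall n : int, n *+ 2 <= a + b -> `|p.1 n - q.1 (n + j)| < delta]]].

(** The orbits with plateau longer than some N' all lie on one curve, which
    consists of orbits with plateau longer than N, N being as large as one
    wishes. *)
Definition single_bifurcation_curve d J Gamma (k : site) : Prop :=
  exists2 delta0 : R, 0 < delta0 &
    forall delta : R, 0 < delta <= delta0 -> forall N : nat,
      exists2 N' : nat, (N <= N')%N &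
        exists g, bifurcation_curve (long_plateau d J Gamma k delta N)
                                    (long_plateau d J Gamma k delta N') g.

End Homoclinics.

(** ** Steady states of the lattice system *)

Section Lattice.
Variable R : realType.
Implicit Types (d mu delta : R) (J : set R) (U : int -> R).
Implicit Types (Gamma : set (seqpar R (R * R)%type)).

Definition lattice_field d mu U (n : int) : R :=
  d * (U (n + 1) + U (n - 1) - 2 * U n) - mu * U n + 2 * U n ^+ 3 - U n ^+ 5.

Definition steady_state d mu U : Prop := forall n, lattice_field d mu U n = 0.

Definition orbit_of U (n : int) : R * R := (U (n - 1), U n).

Definition l2_norm U : \bar R :=
  ((\esum_(n in [set: int]) ((U n) ^+ 2)%:E) `^ 2^-1)%E.

Definition localized_steady_states d J Gamma (k : site) delta (N : nat) :
    set (seqpar R R^o) :=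
  [set p | steady_state d p.2 p.1 /\
           long_plateau d J Gamma k delta N (orbit_of p.1, p.2)].

Definition snakes d J Gamma (k : site) : Prop :=
  exists2 delta0 : R, 0 < delta0 &
    forall delta : R, 0 < delta <= delta0 -> forall N : nat,
      exists2 N' : nat, (N <= N')%N &
        exists g,
          [/\ bifurcation_curve
                (localized_steady_states d J Gamma k delta N)
                (localized_steady_states d J Gamma k delta N') g,
              (forall M : nat, \forall t \near +oo,
                 localized_steady_states d J Gamma k delta M (g 0%N t)),
              (forall t : R, 0 <= t -> (l2_norm (g 0%N t).1 < +oo)%E) &
              l2_norm (g 0%N t).1 @[t --> +oo] --> (+oo)%E].

End Lattice.

(* Main.v *)
(** For small d a steady state that climbs from 0 to U_+ is close to a step function:
    one active site carries a value x in [3d, 34/25], the values left of it are O(d x)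
    and those right of it are within O(d) of the plateau p = U_+, except that p is tied
    to x through the equation at the active site. With p instead of mu and with x
    prescribed, the steady-state equations are diagonally dominated in suitable
    weights, so a front exists, is unique in a box and depends smoothly on x, all
    uniformly in the number of sites up to the centre of symmetry. While x grows from
    about 3d to 4/3, it joins the plateau and the left neighbour takes over the role
    of the active site: the same sequence is a front with active site one step to the
    left. Hence the heteroclinic fronts close up to a 1-loop after one shift, and the
    homoclinic ones form one long curve on which each turn lengthens the plateau.
    Conversely, every orbit close to the loop satisfies the box estimates, so by
    uniqueness it lies on the curve. *)

Require Import Defs.
From mathcomp Require Import all_boot all_order all_algebra.
From mathcomp Require Import all_classical all_reals all_analysis.
From mathcomp Require Import ring lra zify.
Set Implicit Arguments.
Unset Strict Implicit.
Unset Printing Implicit Defensive.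
Import Order.TTheory GRing.Theory Num.Theory.
Import numFieldNormedType.Exports.
Local Open Scope classical_set_scope.
Local Open Scope ring_scope.

(** The value x is prescribed because mu oscillates along the curves while x increases through a
    whole turn. The price is the row of the active site, x (well p - well x - 2 d) + d (sum of its
    neighbours) = 0, which now has to determine p: its coefficient in p is O(d) when x is, and it is
    small near the saddle-node mu = 1, where p^2 - 1 has only the order of the square root of d.
    Exact secant coefficients of the polynomial equations take the place of derivatives, so that a
    single dominance estimate yields contraction, uniqueness, Lipschitz and C^k dependence, and the
    closeness of homoclinic to heteroclinic fronts. The handover value 4/3 is a convenient choice:
    for mu near 32/81 the right neighbour of an active site at x near 27 d / 8 has this value. A
    sequence near the handover has two descriptions, so x is replaced by a phase that differs by
    exactly 1 between them; consecutive pieces then coincide on an overlap, and smoothness across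
    the junctions needs no matching of derivatives. *)

(** * Geometric estimates and zeros in a box *)

Lemma norm_mul_le (R : realType) (a b A B : R) :
  `|a| <= A -> `|b| <= B -> `|a * b| <= A * B.
Proof. by move=> hA hB; rewrite normrM; apply: ler_pM. Qed.

Lemma geometric_small (R : realType) (q C e : R) :
  0 <= q < 1 -> 0 < e -> exists n, C * q ^+ n <= e.
Proof.
move=> /andP[q0 q1] e0.
have q1' : `|q| < 1 by rewrite ger0_norm.
have := @cvg_geometric R C q q1'.
move/cvgrPdist_le => /(_ e e0) [n _ /(_ n (leqnn n))] /=.
rewrite sub0r normrN => h; exists n; exact: le_trans (ler_norm _) h.
Qed.

Lemma le_of_geometric (R : realType) (q C a b : R) :
  0 <= q < 1 -> (forall n : nat, a <= b + C * q ^+ n) -> a <= b.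
Proof.
move=> q01 h; apply/ler_addgt0Pr => e e0.
by have [n hn] := geometric_small C q01 e0; apply: le_trans (h n) _; rewrite lerD2l.
Qed.

(** The intervals of radius K q^n around [u n], with K = C / (1 - q), are nested; the limit is the
    supremum of their left ends, which also gives the rate. *)
Lemma cauchy_geometric (R : realType) (q C : R) (u : nat -> R) :
  0 <= q < 1 -> (forall n, `|u n.+1 - u n| <= C * q ^+ n) ->
  exists l, forall n, `|u n - l| <= C / (1 - q) * q ^+ n.
Proof.
move=> /andP[q0 q1] hu.
have q1p : 0 < 1 - q by lra.
pose K := C / (1 - q).
have CK : C = K * (1 - q) by rewrite /K divfK // gt_eqF.
have hlo n m : u n - K * q ^+ n <= u (n + m)%N - K * q ^+ (n + m).
  elim: m => [|m IH]; first by rewrite addn0.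
  apply: le_trans IH _; rewrite addnS.
  have := hu (n + m)%N; rewrite ler_norml => /andP[h _].
  by rewrite exprS; move: h; rewrite CK; set x := q ^+ _ => h; lra.
have hhi n m : u (n + m)%N + K * q ^+ (n + m) <= u n + K * q ^+ n.
  elim: m => [|m IH]; first by rewrite addn0.
  apply: le_trans IH; rewrite addnS.
  have := hu (n + m)%N; rewrite ler_norml => /andP[_ h].
  by rewrite exprS; move: h; rewrite CK; set x := q ^+ _ => h; lra.
have K0 : 0 <= K.
  have := le_trans (normr_ge0 _) (hu 0%N); rewrite expr0 mulr1 CK => h.
  by rewrite -(pmulr_lge0 _ q1p).
have hlohi n m : u n - K * q ^+ n <= u m + K * q ^+ m.
  apply: le_trans (hlo n m) _.
  rewrite [(n + m)%N]addnC; apply: le_trans (hhi m n).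
  have h : 0 <= K * q ^+ (m + n) by rewrite mulr_ge0 // exprn_ge0.
  lra.
pose S := [set u n - K * q ^+ n | n in setT].
have S0 : S !=set0 by exists (u 0%N - K * q ^+ 0%N), 0%N.
exists (sup S) => n.
have h1 : u n - K * q ^+ n <= sup S.
  apply: ub_le_sup; last by exists n.
  by exists (u 0%N + K * q ^+ 0%N) => _ [m _ <-].
have h2 : sup S <= u n + K * q ^+ n.
  by apply: (ge_sup S0) => _ [m _ <-]; exact: hlohi.
by rewrite ler_norml; apply/andP; split; rewrite -/K; lra.
Qed.

(** Iterating B -> A + q B from the a priori bound [B0] leads to the fixed point A / (1 - q),
    independently of [B0]. On an infinite index set the a priori bound excludes growing
    solutions. *)
Lemma self_improving (R : realType) (I : Type) (W : I -> R) (A q B0 : R) :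
  0 <= q < 1 -> 0 <= A -> (forall i, `|W i| <= B0) ->
  (forall B, 0 <= B -> (forall i, `|W i| <= B) -> forall i, `|W i| <= A + q * B) ->
  forall i, `|W i| <= A / (1 - q).
Proof.
move=> q01 A0 hB0 himp i.
have /andP[q0 q1] := q01.
have q1p : 0 < 1 - q by lra.
pose K := A / (1 - q).
have AK : A = K * (1 - q) by rewrite /K divfK // gt_eqF.
have K0 : 0 <= K by rewrite /K divr_ge0 // ltW.
have B00 : 0 <= B0 by apply: le_trans (hB0 i).
apply: (@le_of_geometric _ q B0 _ K q01) => n.
elim: n i => [|n IH] j; first by rewrite expr0 mulr1; apply: le_trans (hB0 j) _; lra.
have hB : 0 <= K + B0 * q ^+ n by rewrite addr_ge0 // mulr_ge0 // exprn_ge0.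
apply: le_trans (himp _ hB IH j) _.
rewrite exprS AK; set x := q ^+ n; lra.
Qed.

(* Damped iteration X - P X / C: an equation whose i-th row is dominated by its
   own unknown and whose residual points inwards on the faces of the box. *)
Lemma box_zero (R : realType) (I : Type) (P : (I -> R) -> I -> R)
    (lo hi w : I -> R) (q cm cM wm wM H : R) :
  let box X := forall i, lo i <= X i <= hi i in
  0 <= q < 1 -> 0 < cm -> cm <= cM -> 0 < wm -> (forall i, wm <= w i <= wM) ->
  (forall i, lo i <= hi i) -> (forall i, hi i - lo i <= H) ->
  (forall X X', box X -> box X' -> forall i, exists c0 r,
     [/\ P X' i - P X i = c0 * (X' i - X i) + r, cm <= c0 <= cM &
         forall B, 0 <= B -> (forall j, `|X' j - X j| <= B * w j) ->
           `|r| <= q * c0 * (B * w i)]) ->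
  (forall X, box X -> forall i, (X i = hi i -> 0 <= P X i) /\
                                (X i = lo i -> P X i <= 0)) ->
  exists2 X, box X & forall i, P X i = 0.
Proof.
move=> box q01 cm0 cmM wm0 hw lohi hH hP hin.
have /andP[q0 q1] := q01.
have cM0 : 0 < cM by lra.
pose M := 2 * cM.
have M0 : 0 < M by rewrite /M; lra.
pose T (X : I -> R) i := X i - P X i / M.
pose upd (X : I -> R) i a j := if `[< j = i >] then a else X j.
have updi X i a : upd X i a i = a by rewrite /upd asboolT.
(* Moving only the i-th unknown to a face changes its residual by at most (1 + q) cM <= M times the
   distance. On the face the residual points inwards, so a step of length 1 / M does not leave the
   box. *)
have face X i a : box X -> lo i <= a <= hi i ->
    exists2 c : R, 0 <= c <= M & exists e : R, `|e| <= c * `|a - X i| /\ P (upd X i a) i - P X i = e.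
  move=> bX ha.
  have bU : box (upd X i a).
    by move=> j; rewrite /upd; case: asboolP => [->|_]; [exact: ha|exact: bX].
  have [c0 [r [E /andP[c1 c2] hr]]] := hP _ _ bX bU i.
  have wi0 : 0 < w i by have /andP[? _] := hw i; lra.
  have := hr (`|a - X i| / w i).
  rewrite divr_ge0 ?normr_ge0 ?(ltW wi0) // => /(_ isT).
  rewrite divfK ?gt_eqF // => hr'.
  have {}hr' : `|r| <= q * c0 * `|a - X i|.
    apply: hr' => j; rewrite /upd; case: asboolP => [->|_].
      by rewrite divfK ?gt_eqF.
    have /andP[? _] := hw j.
    by rewrite subrr normr0 mulr_ge0 ?divr_ge0 ?normr_ge0 ?(ltW wi0) //; lra.
  exists M; first by lra.
  exists (c0 * (a - X i) + r); split; last by rewrite E updi.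
  apply: le_trans (ler_normD _ _) _.
  rewrite normrM (ger0_norm (_ : 0 <= c0)); last lra.
  apply: le_trans (_ : c0 * `|a - X i| + q * c0 * `|a - X i| <= _); first by lra.
  rewrite -mulrDl ler_wpM2r //.
  have : q * c0 <= 1 * c0 by rewrite ler_wpM2r //; lra.
  by rewrite /M; lra.
have Tbox X : box X -> box (T X).
  move=> bX i; have /andP[b1 b2] := bX i; apply/andP; split; rewrite /T.
    have [|c /andP[_ cle] [e [he E]]] := face X i (lo i) bX; first by rewrite lexx lohi.
    have bU : box (upd X i (lo i)).
      by move=> j; rewrite /upd; case: asboolP => [->|_]; [rewrite lexx lohi|exact: bX].
    have [_ hf] := hin _ bU i.
    have {}hf := hf (updi _ _ _).
    have : P X i / M <= X i - lo i; last by lra.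
    rewrite ler_pdivrMr //.
    have : `|e| <= M * (X i - lo i).
      apply: le_trans he _; rewrite distrC ger0_norm ?subr_ge0 //.
      by rewrite ler_wpM2r // subr_ge0.
    by rewrite ler_norml => /andP[? ?]; lra.
  have [|c /andP[_ cle] [e [he E]]] := face X i (hi i) bX; first by rewrite lexx lohi.
  have bU : box (upd X i (hi i)).
    by move=> j; rewrite /upd; case: asboolP => [->|_]; [rewrite lexx lohi|exact: bX].
  have [hf _] := hin _ bU i.
  have {}hf := hf (updi _ _ _).
  have : - (P X i / M) <= hi i - X i; last by lra.
  rewrite -mulNr ler_pdivrMr //.
  have : `|e| <= M * (hi i - X i).
    apply: le_trans he _; rewrite ger0_norm ?subr_ge0 //.
    by rewrite ler_wpM2r // subr_ge0.
  by rewrite ler_norml => /andP[? ?]; lra.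
(* Contraction factor of [T] in the sup norm weighted by [w]: a fraction c0 / M of the own
   difference is removed and at most q times as much is put back. *)
pose k := 1 - (1 - q) * cm / M.
have hcm : 0 < (1 - q) * cm / M by rewrite divr_gt0 // mulr_gt0 //; lra.
have hcm1 : (1 - q) * cm / M <= 1.
  rewrite ler_pdivrMr // mul1r.
  have : (1 - q) * cm <= 1 * cm by rewrite ler_wpM2r //; lra.
  by rewrite /M; lra.
have k01 : 0 <= k < 1 by rewrite /k; lra.
have /andP[k0 k1] := k01.
have Tcontr X X' B : box X -> box X' -> 0 <= B ->
    (forall j, `|X' j - X j| <= B * w j) ->
    forall i, `|T X' i - T X i| <= k * B * w i.
  move=> bX bX' B0 hB i.
  have [c0 [r [E /andP[c1 c2] hr]]] := hP _ _ bX bX' i.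
  have {}hr := hr B B0 hB.
  have wi0 : 0 < w i by have /andP[? _] := hw i; lra.
  have -> : T X' i - T X i = (1 - c0 / M) * (X' i - X i) - r / M.
    transitivity ((X' i - X i) - (P X' i - P X i) / M); first by rewrite /T; ring.
    by rewrite E; ring.
  apply: le_trans (ler_normB _ _) _.
  have c0M : 0 <= c0 / M <= 1.
    by rewrite divr_ge0 ?(ltW M0) //=; [rewrite ler_pdivrMr // mul1r /M; lra|lra].
  rewrite normrM (ger0_norm (_ : 0 <= 1 - c0 / M)); last lra.
  have h1 : (1 - c0 / M) * `|X' i - X i| <= (1 - c0 / M) * (B * w i).
    by rewrite ler_wpM2l //; lra.
  have h2 : `|r / M| <= q * (c0 / M) * (B * w i).
    rewrite normrM normfV (gtr0_norm M0) ler_pdivrMr //.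
    apply: le_trans hr _; rewrite le_eqVlt; apply/orP; left; apply/eqP.
    by field; rewrite gt_eqF.
  have h3 : (1 - q) * cm / M <= (1 - q) * (c0 / M).
    by rewrite -mulrA ler_wpM2l ?ler_wpM2r ?invr_ge0 ?(ltW M0) //; lra.
  have Bw : 0 <= B * w i by rewrite mulr_ge0 // ltW.
  apply: le_trans (lerD h1 h2) _; rewrite -mulrDl -mulrA ler_wpM2r // /k.
  by lra.
pose X n := iter n T lo.
have Xbox n : box (X n).
  by elim: n => [|n IH]; [move=> i; rewrite lexx lohi|exact: Tbox].
pose B0 := `|H| / wm.
have B00 : 0 <= B0 by rewrite divr_ge0 // ltW.
have Xstep n i : `|X n.+1 i - X n i| <= B0 * k ^+ n * w i.
  elim: n i => [|n IH] i.
    rewrite expr0 mulr1.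
    have /andP[h1 h2] := Xbox 1%N i; have /andP[h3 h4] := Xbox 0%N i.
    have /andP[h5 _] := hw i.
    apply: le_trans (_ : `|H| <= _).
      have := hH i; have := ler_norm H; rewrite ler_norml => ? ?; apply/andP; split; lra.
    by rewrite /B0 mulrAC ler_pdivlMr // ler_wpM2l.
  rewrite exprS.
  have := Tcontr _ _ _ (Xbox n) (Xbox n.+1) (mulr_ge0 B00 (exprn_ge0 n k0)) IH i.
  by rewrite mulrCA.
have Xlim i : exists l, forall n, `|X n i - l| <= B0 * w i / (1 - k) * k ^+ n.
  apply: cauchy_geometric => // n; apply: le_trans (Xstep n i) _.
  by rewrite mulrAC.
have [L hL] := choice Xlim.
have Lbox : box L.
  move=> i; apply/andP; split.
    apply: (@le_of_geometric _ k (B0 * w i / (1 - k))) => // n.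
    have /andP[h _] := Xbox n i; have := hL i n; rewrite ler_norml => /andP[? ?]; lra.
  apply: (@le_of_geometric _ k (B0 * w i / (1 - k))) => // n.
  have /andP[_ h] := Xbox n i; have := hL i n; rewrite ler_norml => /andP[? ?]; lra.
exists L => // i.
suff hT : T L i = L i.
  move: hT; rewrite /T => /eqP; rewrite subr_eq -subr_eq0 opprD addrA subrr sub0r oppr_eq0.
  by rewrite mulf_eq0 invr_eq0 (gt_eqF M0) orbF => /eqP.
apply/eqP; rewrite -subr_eq0 -normr_le0.
pose C := B0 / (1 - k).
have C0 : 0 <= C by rewrite divr_ge0 //; lra.
apply: (@le_of_geometric _ k (2 * C * w i)) => // n.
have hn j : `|L j - X n j| <= C * k ^+ n * w j.
  rewrite distrC; apply: le_trans (hL j n) _.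
  by rewrite (_ : B0 * w j / (1 - k) * k ^+ n = C * k ^+ n * w j) // /C; ring.
have h1 := Tcontr _ _ _ (Xbox n) Lbox (mulr_ge0 C0 (exprn_ge0 n k0)) hn i.
have h2 := hL i n.+1.
have E : B0 * w i / (1 - k) = C * w i by rewrite /C mulrAC.
rewrite E exprS in h2.
have -> : T L i - L i = (T L i - T (X n) i) + (X n.+1 i - L i).
  by rewrite /X /=; ring.
have h3 : 0 <= C * w i * k ^+ n.
  have /andP[? _] := hw i.
  by rewrite mulr_ge0 ?exprn_ge0 // mulr_ge0 //; lra.
have h4 : k * (C * w i * k ^+ n) <= C * w i * k ^+ n by rewrite ler_piMl // ltW.
apply: le_trans (ler_normD _ _) _; rewrite add0r.
apply: le_trans (lerD h1 h2) _.
have -> : k * (C * k ^+ n) * w i = k * (C * w i * k ^+ n) by ring.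
have -> : C * w i * (k * k ^+ n) = k * (C * w i * k ^+ n) by ring.
have -> : 2 * C * w i * k ^+ n = 2 * (C * w i * k ^+ n) by ring.
lra.
Qed.

(** * Uniformly smooth families *)

Definition ulip (R : realType) (J : Type) (D : set R) (f : J -> R -> R) : Prop :=
  exists2 C, 0 <= C &
    (forall j s, D s -> `|f j s| <= C) /\
    (forall j s t, D s -> D t -> `|f j t - f j s| <= C * `|t - s|).

Definition udiff (R : realType) (J : Type) (D : set R) (f f' : J -> R -> R) : Prop :=
  exists2 C, 0 <= C & forall j s t, D s -> D t ->
    `|f j t - f j s - (t - s) * f' j s| <= C * `|t - s| ^+ 2.

(* Uniformly C^k families: bounds and quadratic Taylor remainders are uniform in
   the index, so that the families are C^k as curves in l^oo. *)
Fixpoint uc (R : realType) (k : nat) (J : Type) (D : set R) (f : J -> R -> R) : Prop :=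
  if k is k'.+1 then ulip D f /\ exists2 f', udiff D f f' & uc k' D f'
  else ulip D f.

Section UC.
Variables (R : realType) (D : set R).

Lemma uc_ulip k (J : Type) (f : J -> R -> R) : uc k D f -> ulip D f.
Proof. by case: k => [//|k] []. Qed.

Lemma uc_pred k (J : Type) (f : J -> R -> R) : uc k.+1 D f -> uc k D f.
Proof.
elim: k J f => [|k IH] J f; first by case.
by move=> [fl [f' fd f'c]]; split=> //; exists f' => //; apply: IH.
Qed.

Lemma ulip_ext (J : Type) (E : set R) (f g : J -> R -> R) : E `<=` D ->
  (forall j s, E s -> f j s = g j s) -> ulip D f -> ulip E g.
Proof.
move=> ED fg [C C0 [h1 h2]]; exists C => //; split.
  by move=> j s Es; rewrite -fg //; apply: h1; apply: ED.
by move=> j s t Es Et; rewrite -!fg //; apply: h2; apply: ED.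
Qed.

Lemma udiff_ext (J : Type) (E : set R) (f g f' g' : J -> R -> R) : E `<=` D ->
  (forall j s, E s -> f j s = g j s) -> (forall j s, E s -> f' j s = g' j s) ->
  udiff D f f' -> udiff E g g'.
Proof.
move=> ED fg fg' [C C0 h]; exists C => // j s t Es Et.
by rewrite -!fg // -fg' //; apply: h; apply: ED.
Qed.

Lemma uc_ext k (J : Type) (E : set R) (f g : J -> R -> R) : E `<=` D ->
  (forall j s, E s -> f j s = g j s) -> uc k D f -> uc k E g.
Proof.
move=> ED; elim: k f g => [|k IH] f g fg; first exact: ulip_ext.
move=> [fl [f' fd f'c]]; split; first exact: ulip_ext fl.
exists f'; last exact: IH f'c.
exact: udiff_ext fd.
Qed.

Lemma uc_reindex k (J K : Type) (h : K -> J) (f : J -> R -> R) :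
  uc k D f -> uc k D (fun j => f (h j)).
Proof.
elim: k f => [|k IH] f; first by move=> [C C0 [h1 h2]]; exists C => //; split=> j; [exact: h1|exact: h2].
move=> [[C C0 [h1 h2]] [f' [C' C'0 h'] f'c]]; split.
  by exists C => //; split=> j; [exact: h1|exact: h2].
by exists (fun j => f' (h j)); [exists C' => // j; exact: h'|apply: IH].
Qed.

Lemma uc_if k (J : Type) (b : J -> bool) (f g : J -> R -> R) :
  uc k D f -> uc k D g -> uc k D (fun j => if b j then f j else g j).
Proof.
have mx (C C' x y : R) : 0 <= C -> 0 <= C' -> 0 <= y -> x <= C * y \/ x <= C' * y -> x <= (C + C') * y.
  move=> C0 C'0 y0; have := mulr_ge0 C0 y0; have := mulr_ge0 C'0 y0.
  by rewrite mulrDl => ? ? [?|?]; lra.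
have lip (f0 g0 : J -> R -> R) : ulip D f0 -> ulip D g0 -> ulip D (fun j => if b j then f0 j else g0 j).
  move=> [C C0 [h1 h2]] [C' C'0 [h1' h2']]; exists (C + C'); first exact: addr_ge0.
  split.
    move=> j s Ds; case: (b j); first by have := h1 j s Ds; lra.
    by have := h1' j s Ds; lra.
  move=> j s t Ds Dt; apply: mx => //.
  by case: (b j); [left; apply: h2|right; apply: h2'].
elim: k f g => [|k IH] f g; first exact: lip.
move=> [fl [f' [C C0 hf] f'c]] [gl [g' [C' C'0 hg] g'c]]; split; first exact: lip.
exists (fun j => if b j then f' j else g' j); last exact: IH.
exists (C + C'); first exact: addr_ge0.
move=> j s t Ds Dt; apply: mx => //.
by case: (b j); [left; apply: hf|right; apply: hg].
Qed.

Lemma uc_const k (J : Type) (a : J -> R) (M : R) : (forall j, `|a j| <= M) ->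
  uc k D (fun j _ => a j).
Proof.
move=> ha.
have lip (c : J -> R) (M' : R) : (forall j, `|c j| <= M') -> ulip D (fun j _ => c j).
  move=> hc; exists `|M'| => //; split.
    by move=> j s _; apply: le_trans (hc j) (ler_norm _).
  by move=> j s t _ _; rewrite subrr normr0 mulr_ge0.
elim: k a M ha => [|k IH] a M ha; first exact: lip ha.
split; first exact: lip ha.
exists (fun _ _ => 0); last by apply: (IH _ 0) => j; rewrite normr0.
by exists 0 => // j s t _ _; rewrite subrr mulr0 subr0 normr0 mul0r.
Qed.

Lemma uc_cst k (J : Type) (a : R) : uc k D (fun (_ : J) _ => a).
Proof. by apply: (@uc_const k J (fun=> a) `|a|). Qed.

Lemma uc_id k (J : Type) (M : R) : (forall s, D s -> `|s| <= M) ->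
  uc k D (fun (_ : J) s => s).
Proof.
move=> hM.
have lip : ulip D (fun (_ : J) s => s).
  exists (1 + `|M|); first by rewrite addr_ge0.
  split=> [_ s Ds|_ s t _ _].
    by have := hM s Ds; have := ler_norm M; lra.
  by rewrite ler_peMl // lerDl.
case: k => [//|k]; split=> //; exists (fun _ _ => 1); last exact: uc_cst.
by exists 0 => // _ s t _ _; rewrite mulr1 subrr normr0 mul0r.
Qed.

Lemma ulip_add (J : Type) (f g : J -> R -> R) :
  ulip D f -> ulip D g -> ulip D (fun j s => f j s + g j s).
Proof.
move=> [C C0 [h1 h2]] [C' C'0 [h1' h2']]; exists (C + C'); first exact: addr_ge0.
split=> [j s Ds|j s t Ds Dt].
  by apply: le_trans (ler_normD _ _) _; apply: lerD; [exact: h1|exact: h1'].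
rewrite opprD addrACA mulrDl; apply: le_trans (ler_normD _ _) _.
by apply: lerD; [exact: h2|exact: h2'].
Qed.

Lemma uc_add k (J : Type) (f g : J -> R -> R) :
  uc k D f -> uc k D g -> uc k D (fun j s => f j s + g j s).
Proof.
elim: k f g => [|k IH] f g; first exact: ulip_add.
move=> [fl [f' [C C0 hf] f'c]] [gl [g' [C' C'0 hg] g'c]]; split; first exact: ulip_add.
exists (fun j s => f' j s + g' j s); last exact: IH.
exists (C + C'); first exact: addr_ge0.
move=> j s t Ds Dt.
have -> : f j t + g j t - (f j s + g j s) - (t - s) * (f' j s + g' j s) =
  (f j t - f j s - (t - s) * f' j s) + (g j t - g j s - (t - s) * g' j s) by ring.
apply: le_trans (ler_normD _ _) _; rewrite [leRHS]mulrDl.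
by apply: lerD; [exact: hf|exact: hg].
Qed.

Lemma ulip_mul (J : Type) (f g : J -> R -> R) :
  ulip D f -> ulip D g -> ulip D (fun j s => f j s * g j s).
Proof.
move=> [C C0 [h1 h2]] [C' C'0 [h1' h2']].
have CC : 0 <= C * C' by exact: mulr_ge0.
exists (2 * (C * C')); first lra.
split=> [j s Ds|j s t Ds Dt].
  by have := norm_mul_le (h1 j s Ds) (h1' j s Ds); lra.
have -> : f j t * g j t - f j s * g j s =
  (f j t - f j s) * g j t + f j s * (g j t - g j s) by ring.
apply: le_trans (ler_normD _ _) _.
apply: le_trans (lerD (norm_mul_le (h2 j s t Ds Dt) (h1' j t Dt))
  (norm_mul_le (h1 j s Ds) (h2' j s t Ds Dt))) _.
by rewrite le_eqVlt; apply/orP; left; apply/eqP; ring.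
Qed.

Lemma uc_mul k (J : Type) (f g : J -> R -> R) :
  uc k D f -> uc k D g -> uc k D (fun j s => f j s * g j s).
Proof.
elim: k f g => [|k IH] f g; first exact: ulip_mul.
move=> fc gc; have fc' := uc_pred fc; have gc' := uc_pred gc.
case: fc => [fl [f' [C C0 hf] f'c]]; case: gc => [gl [g' [C' C'0 hg] g'c]].
split; first exact: ulip_mul.
exists (fun j s => f' j s * g j s + f j s * g' j s).
  have [Cf Cf0 [f1 f2]] := fl; have [Cg Cg0 [g1 g2]] := gl.
  exists (C * Cg + Cf * C' + Cf * Cg); first by rewrite !addr_ge0 ?mulr_ge0.
  move=> j s t Ds Dt.
  have -> : f j t * g j t - f j s * g j s - (t - s) * (f' j s * g j s + f j s * g' j s) =
    (f j t - f j s - (t - s) * f' j s) * g j s + f j s * (g j t - g j s - (t - s) * g' j s)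
    + (f j t - f j s) * (g j t - g j s) by ring.
  have h1 := norm_mul_le (hf j s t Ds Dt) (g1 j s Ds).
  have h2 := norm_mul_le (f1 j s Ds) (hg j s t Ds Dt).
  have h3 := norm_mul_le (f2 j s t Ds Dt) (g2 j s t Ds Dt).
  apply: le_trans (ler_normD _ _) _; apply: le_trans (lerD (ler_normD _ _) (lexx _)) _.
  apply: le_trans (lerD (lerD h1 h2) h3) _.
  by rewrite le_eqVlt; apply/orP; left; apply/eqP; ring.
by apply: uc_add; exact: IH.
Qed.

Lemma uc_opp k (J : Type) (f : J -> R -> R) : uc k D f -> uc k D (fun j s => - f j s).
Proof.
move=> fc; apply: (@uc_ext k J D (fun j s => (-1) * f j s)) => //.
  by move=> j s _; rewrite mulN1r.
by apply: uc_mul => //; exact: uc_cst.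
Qed.

Lemma uc_sub k (J : Type) (f g : J -> R -> R) :
  uc k D f -> uc k D g -> uc k D (fun j s => f j s - g j s).
Proof. by move=> fc gc; apply: uc_add => //; exact: uc_opp. Qed.

Lemma uc_exp k n (J : Type) (f : J -> R -> R) : uc k D f -> uc k D (fun j s => f j s ^+ n).
Proof.
move=> fc; elim: n => [|n IH]; first exact: uc_cst.
apply: (@uc_ext k J D (fun j s => f j s * f j s ^+ n)) => //; last exact: uc_mul.
by move=> j s _; rewrite exprS.
Qed.

Lemma uc_sum k (J : Type) m (f : 'I_m -> J -> R -> R) :
  (forall r, uc k D (f r)) -> uc k D (fun j s => \sum_(r < m) f r j s).
Proof.
elim: m f => [|m IH] f fc.
  apply: (@uc_ext k J D (fun _ _ => 0)) => //; last exact: uc_cst.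
  by move=> j s _; rewrite big_ord0.
apply: (@uc_ext k J D (fun j s => f ord0 j s + \sum_(r < m) f (lift ord0 r) j s)) => //.
  by move=> j s _; rewrite big_ord_recl.
by apply: uc_add => //; apply: IH.
Qed.

End UC.

(** * Weighted diagonally dominant systems on arbitrary index sets *)

Section Dominated.
Variables (R : realType) (I : Type) (m : nat) (sg : 'I_m -> I -> I).
Implicit Types (c w b V : I -> R) (a : 'I_m -> I -> R) (q cm wm wM : R).

Definition weight wm wM w := forall i, wm <= w i <= wM.

(** [sg r i] is the r-th neighbour of [i]. Every row has at most [m] off-diagonal entries, so
    infinite systems raise no question of summability. *)
Definition dominated q cm c a w := forall i,
  cm <= c i /\ \sum_(r < m) `|a r i| * w (sg r i) <= q * c i * w i.

Definition lrow c a V i := c i * V i + \sum_(r < m) a r i * V (sg r i).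

Lemma sum_le_dominated a w V B i : 0 <= B ->
  (forall j, `|V j| <= B * w j) ->
  `|\sum_(r < m) a r i * V (sg r i)| <= B * \sum_(r < m) `|a r i| * w (sg r i).
Proof.
move=> B0 hB; apply: le_trans (ler_norm_sum _ _ _) _.
rewrite mulr_sumr; apply: ler_sum => r _; rewrite normrM mulrCA.
by rewrite ler_wpM2l.
Qed.

(** Solving each row for its own unknown improves any bound B on V / w to e / (cm wm) + q B. *)
Lemma dominated_bound q cm wm wM c a w V K e :
  0 <= q < 1 -> 0 < cm -> 0 < wm -> weight wm wM w -> dominated q cm c a w ->
  (forall i, `|V i| <= K) -> 0 <= e -> (forall i, `|lrow c a V i| <= e) ->
  forall i, `|V i| <= e / (cm * wm) / (1 - q) * wM.
Proof.
move=> q01 cm0 wm0 hw dom hV e0 he i.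
have /andP[q0 q1] := q01.
have w0 j : 0 < w j by have /andP[h _] := hw j; apply: lt_le_trans h.
have wV j : `|V j / w j| * w j = `|V j|.
  by rewrite normrM normfV (gtr0_norm (w0 j)) divfK // gt_eqF.
have cw : 0 < cm * wm by exact: mulr_gt0.
have key : forall j, `|V j / w j| <= e / (cm * wm) / (1 - q).
  apply: (@self_improving _ _ _ _ q (`|K| / wm)) => //.
  - by rewrite divr_ge0 // ltW.
  - move=> j; rewrite normrM normfV (gtr0_norm (w0 j)).
    rewrite ler_pM ?invr_ge0 ?(ltW (w0 j)) //; first exact: le_trans (hV j) (ler_norm _).
    by rewrite lef_pV2 ?posrE //; have /andP[] := hw j.
  move=> B B0 hB j.
  have hB' l : `|V l| <= B * w l by rewrite -wV ler_wpM2r ?(ltW (w0 l)).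
  have [c1 c2] := dom j.
  have a00 : 0 < c j by lra.
  have h1 := sum_le_dominated a j B0 hB'.
  have h2 : c j * `|V j| <= e + q * B * (c j * w j).
    rewrite -(gtr0_norm a00) -normrM.
    have -> : c j * V j = lrow c a V j - \sum_(r < m) a r j * V (sg r j) by rewrite /lrow addrK.
    apply: le_trans (ler_normB _ _) _; apply: lerD; first exact: he.
    apply: le_trans h1 _; rewrite (gtr0_norm a00).
    apply: le_trans (ler_wpM2l B0 c2) _.
    by rewrite le_eqVlt; apply/orP; left; apply/eqP; ring.
  rewrite normrM normfV (gtr0_norm (w0 j)) ler_pdivrMr // mulrDl.
  rewrite -(ler_pM2l a00); apply: le_trans h2 _.
  rewrite mulrDr; apply: lerD; last by rewrite le_eqVlt; apply/orP; left; apply/eqP; ring.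
  have : cm * wm <= c j * w j by apply: ler_pM; [exact: ltW|exact: ltW| |have /andP[] := hw j].
  move=> h; rewrite (_ : c j * _ = e * (c j * w j / (cm * wm))); last by ring.
  by rewrite ler_peMr // ler_pdivlMr // mul1r.
rewrite -wV ler_pM ?(ltW (w0 i)) //; by have /andP[] := hw i.
Qed.

(** [box_zero] in the box |V i| <= M w i, with M so large that on each face the slack 1 - q of the
    dominance outweighs the source. *)
Lemma dominated_solve q cm cM wm wM c a w b e :
  0 <= q < 1 -> 0 < cm -> 0 < wm -> weight wm wM w -> dominated q cm c a w ->
  (forall i, c i <= cM) -> 0 <= e -> (forall i, `|b i| <= e) ->
  exists V, (forall i, `|V i| <= e / (cm * wm) / (1 - q) * wM) /\
            (forall i, lrow c a V i = b i).
Proof.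
move=> q01 cm0 wm0 hw dom ha0 e0 he.
have /andP[q0 q1] := q01.
have w0 j : 0 < w j by have /andP[h _] := hw j; apply: lt_le_trans h.
pose M := e / (cm * wm) / (1 - q).
have q1' : 0 < 1 - q by rewrite subr_gt0.
have M0 : 0 <= M by rewrite /M !divr_ge0 ?mulr_ge0 ?(ltW cm0) ?(ltW wm0) ?(ltW q1').
have EM : e = M * (1 - q) * cm * wm.
  by rewrite /M; field; rewrite !gt_eqF.
have wMM i : w i <= wM by have /andP[] := hw i.
have [j0|noI] := pselect (exists i : I, True); last first.
  by exists (fun=> 0); split=> i; exfalso; apply: noI; exists i.
have cmM : cm <= cM.
  by case: j0 => j0 _; have [h _] := dom j0; apply: le_trans h (ha0 j0).
have [||||V Vbox V0] := @box_zero R I (fun V i => lrow c a V i - b i)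
   (fun i => - (M * w i)) (fun i => M * w i) w q cm cM wm wM (2 * (M * wM)) q01 cm0 cmM wm0 hw.
- by move=> i; have := mulr_ge0 M0 (ltW (w0 i)); lra.
- by move=> i; have := ler_wpM2l M0 (wMM i); lra.
- move=> X X' _ _ i; exists (c i), (\sum_(r < m) a r i * (X' (sg r i) - X (sg r i))).
  have [c1 c2] := dom i; split.
  + rewrite /lrow; under [X in _ = _ + X]eq_bigr do rewrite mulrBr.
    by rewrite sumrB; ring.
  + by rewrite c1 ha0.
  + move=> B B0 hB; apply: le_trans (sum_le_dominated (V := fun j => X' j - X j) a i B0 hB) _.
    apply: le_trans (ler_wpM2l B0 c2) _.
    by rewrite le_eqVlt; apply/orP; left; apply/eqP; ring.
- move=> X bX i.
  have hX j : `|X j| <= M * w j by rewrite ler_norml.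
  have [c1 c2] := dom i.
  have h1 := sum_le_dominated a i M0 hX.
  have h2 := le_trans h1 (ler_wpM2l M0 c2).
  have h3 : e <= M * (1 - q) * (c i * w i).
    rewrite EM -mulrA; apply: ler_wpM2l; first by rewrite mulr_ge0 // ltW.
    by apply: ler_pM; [exact: ltW|exact: ltW|exact: c1|have /andP[] := hw i].
  have := he i; rewrite ler_norml => /andP[b1 b2].
  move: h2; rewrite ler_norml => /andP[s1 s2].
  by split=> E; rewrite /lrow E; move: h3 s1 s2; set s := \sum_(r < m) _; clear -b1 b2 => h3 s1 s2; lra.
exists V; split=> i; last by have := V0 i => /eqP; rewrite subr_eq0 => /eqP.
rewrite ler_norml -/M; have /andP[h1 h2] := Vbox i.
have := ler_wpM2l M0 (wMM i); move: h1 h2; clear; set x := M * w i; set y := M * wM => *.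
by apply/andP; split; lra.
Qed.

End Dominated.

Lemma uc_ord (R : realType) k (J : Type) (D : set R) m (f : 'I_m -> J -> R -> R) :
  (forall r, uc k D (f r)) -> uc k D (fun rj : 'I_m * J => f rj.1 rj.2).
Proof.
have sumC (C : 'I_m -> R) : (forall r, 0 <= C r) -> 0 <= \sum_r C r /\ forall r, C r <= \sum_r C r.
  move=> C0; split; first exact: sumr_ge0.
  by move=> r; rewrite (bigD1 r) //= lerDl sumr_ge0.
have lip (g : 'I_m -> J -> R -> R) : (forall r, ulip D (g r)) -> ulip D (fun rj : 'I_m * J => g rj.1 rj.2).
  move=> gl; have /choice[C hC] : forall r, exists C : R, 0 <= C /\
    ((forall j s, D s -> `|g r j s| <= C) /\
    (forall j s t, D s -> D t -> `|g r j t - g r j s| <= C * `|t - s|)).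
    by move=> r; have [C C0 h] := gl r; exists C.
  have [S0 SC] := sumC C (fun r => (hC r).1).
  exists (\sum_r C r) => //; split.
    move=> [r j] s Ds /=; have [_ [h _]] := hC r; exact: le_trans (h j s Ds) (SC r).
  move=> [r j] s t Ds Dt /=; have [_ [_ h]] := hC r; apply: le_trans (h j s t Ds Dt) _.
  by rewrite ler_wpM2r.
elim: k f => [|k IH] f fc; first exact: lip.
split; first by apply: lip => r; case: (fc r).
have /choice[f' hf'] : forall r, exists f', udiff D (f r) f' /\ uc k D f'.
  by move=> r; have [_ [f' h1 h2]] := fc r; exists f'.
exists (fun rj => f' rj.1 rj.2); last by apply: (IH f') => r; case: (hf' r).
have /choice[C hC] : forall r, exists C : R, 0 <= C /\ forall j s t, D s -> D t ->
    `|f r j t - f r j s - (t - s) * f' r j s| <= C * `|t - s| ^+ 2.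
  by move=> r; have [[C C0 h] _] := hf' r; exists C.
have [S0 SC] := sumC C (fun r => (hC r).1).
exists (\sum_r C r) => // -[r j] s t Ds Dt /=; have [_ h] := hC r.
by apply: le_trans (h j s t Ds Dt) _; rewrite ler_wpM2r.
Qed.

Section DominatedCurves.
Variables (R : realType) (I : Type) (m : nat) (sg : 'I_m -> I -> I) (D : set R).
Variables (q cm wm wM : R).
Hypotheses (q01 : 0 <= q < 1) (cm0 : 0 < cm) (wm0 : 0 < wm).

(** Bounds the inverse in the sup norm, uniformly over all dominated systems with these
    constants. *)
Let K0 : R := `|wM| / (cm * wm) / (1 - q).

Let K0_ge0 : 0 <= K0.
Proof.
have /andP[q0 q1] := q01.
by rewrite /K0 !divr_ge0 ?mulr_ge0 ?normr_ge0 ?(ltW cm0) ?(ltW wm0) // subr_ge0 ltW.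
Qed.

Lemma dominated_le (c w V : I -> R) (a : 'I_m -> I -> R) (K e : R) :
  weight wm wM w -> dominated sg q cm c a w -> (forall i, `|V i| <= K) -> 0 <= e ->
  (forall i, `|lrow sg c a V i| <= e) -> forall i, `|V i| <= K0 * e.
Proof.
move=> hw dom hV e0 he i; have /andP[q0 q1] := q01.
apply: le_trans (dominated_bound q01 cm0 wm0 hw dom hV e0 he i) _.
have h : 0 <= e / (cm * wm) / (1 - q).
  by rewrite !divr_ge0 ?mulr_ge0 ?(ltW cm0) ?(ltW wm0) // subr_ge0 ltW.
apply: le_trans (ler_wpM2l h (ler_norm _)) _.
by rewrite le_eqVlt; apply/orP; left; apply/eqP; rewrite /K0; ring.
Qed.

Lemma dominated_sol (c w b : I -> R) (a : 'I_m -> I -> R) (cM e : R) :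
  weight wm wM w -> dominated sg q cm c a w -> (forall i, c i <= cM) ->
  0 <= e -> (forall i, `|b i| <= e) ->
  exists V, (forall i, `|V i| <= K0 * e) /\ (forall i, lrow sg c a V i = b i).
Proof.
move=> hw dom hc e0 he.
have [V [V1 V2]] := dominated_solve q01 cm0 wm0 hw dom hc e0 he.
exists V; split=> // i; apply: (dominated_le hw dom V1 e0) => j.
by rewrite V2.
Qed.

Lemma row_le (c V : I -> R) (a : 'I_m -> I -> R) (e K : R) i :
  (forall i, `|c i| <= e) -> (forall r i, `|a r i| <= e) -> (forall i, `|V i| <= K) ->
  `|lrow sg c a V i| <= m.+1%:R * (e * K).
Proof.
move=> hc ha hV; apply: le_trans (ler_normD _ _) _.
rewrite -add1n natrD mulrDl mul1r; apply: lerD; first exact: norm_mul_le.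
apply: le_trans (ler_norm_sum _ _ _) _.
apply: le_trans (ler_sum (G := fun=> e * K) _ _) _; first by move=> r _; exact: norm_mul_le.
by rewrite sumr_const card_ord mulr_natl.
Qed.

Lemma row_subr (c c' V : I -> R) (a a' : 'I_m -> I -> R) i :
  lrow sg c a V i - lrow sg c' a' V i = lrow sg (fun i => c i - c' i) (fun r i => a r i - a' r i) V i.
Proof.
rewrite /lrow; under [in RHS]eq_bigr do rewrite mulrBl.
by rewrite sumrB; ring.
Qed.

Lemma row_lin (c V W : I -> R) (a : 'I_m -> I -> R) (h : R) i :
  lrow sg c a (fun i => V i - h * W i) i = lrow sg c a V i - h * lrow sg c a W i.
Proof.
rewrite /lrow; under [in LHS]eq_bigr do rewrite mulrBr mulrCA.
by rewrite sumrB -mulr_sumr; ring.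
Qed.

Section Linear.
Variables (c b V : I -> R -> R) (a : 'I_m * I -> R -> R) (K : R).
Let cs s i := c i s.
Let as_ s r i := a (r, i) s.
Let Vs s i := V i s.
Hypothesis K0' : 0 <= K.
Hypothesis dom : forall s, D s -> exists2 w, weight wm wM w & dominated sg q cm (cs s) (as_ s) w.
Hypothesis VK : forall i s, D s -> `|V i s| <= K.
Hypothesis rowV : forall s i, D s -> lrow sg (cs s) (as_ s) (Vs s) i = b i s.

Lemma ulip_linear : ulip D c -> ulip D a -> ulip D b -> ulip D V.
Proof.
move=> [Cc Cc0 [c1 c2]] [Ca Ca0 [a1 a2]] [Cb Cb0 [b1 b2]].
pose E := Cb + m.+1%:R * ((Cc + Ca) * K).
have E0 : 0 <= E by rewrite /E !(addr_ge0, mulr_ge0).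
exists (K + K0 * E); first by rewrite addr_ge0 // mulr_ge0.
have KE : 0 <= K0 * E by rewrite mulr_ge0.
split=> [i s Ds|i s t Ds Dt]; first by apply: le_trans (VK i Ds) _; rewrite lerDl.
have [w hw dm] := dom Ds.
have bd j : `|V j t - V j s| <= K + K.
  by apply: le_trans (ler_normB _ _) _; apply: lerD; exact: VK.
have Et0 : 0 <= E * `|t - s| by rewrite mulr_ge0.
apply: le_trans (dominated_le hw dm bd Et0 _ i) _; last first.
  by rewrite [leLHS]mulrA [leRHS]mulrDl lerDr mulr_ge0.
move=> j.
have -> : lrow sg (cs s) (as_ s) (fun i => V i t - V i s) j =
  (b j t - b j s) - lrow sg (fun i => cs t i - cs s i) (fun r i => as_ t r i - as_ s r i) (Vs t) j.
  rewrite -row_subr !rowV // -[b j s]rowV //.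
  have := row_lin (cs s) (Vs t) (Vs s) (as_ s) 1 j.
  rewrite (_ : (fun i => _) = (fun i => V i t - V i s)); last by apply/funext => l; rewrite mul1r.
  by move=> ->; ring.
apply: le_trans (ler_normB _ _) _; rewrite /E mulrDl; apply: lerD; first exact: b2.
rewrite -!mulrA [K * _]mulrC [(Cc + Ca) * _]mulrA; apply: row_le => [l|r l|l]; last exact: VK.
  by apply: le_trans (c2 l s t Ds Dt) _; rewrite ler_wpM2r // lerDl.
by apply: le_trans (a2 (r, l) s t Ds Dt) _; rewrite ler_wpM2r // lerDr.
Qed.
End Linear.

(** Formal differentiation gives a system with the same matrix and the source b' - (c' + a') V. By
    induction V is C^k, hence so are this source and its solution V'. The Taylor remainder of V
    solves the same system with a source of size |t - s|^2. *)
Lemma uc_linear k (c b V : I -> R -> R) (a : 'I_m * I -> R -> R) (K : R) :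
  0 <= K ->
  (forall s, D s -> exists2 w, weight wm wM w &
     dominated sg q cm (fun i => c i s) (fun r i => a (r, i) s) w) ->
  (forall i s, D s -> `|V i s| <= K) ->
  (forall s i, D s -> lrow sg (fun i => c i s) (fun r i => a (r, i) s) (fun i => V i s) i = b i s) ->
  uc k D c -> uc k D a -> uc k D b -> uc k D V.
Proof.
move=> K00 dom; elim: k b V K K00 => [|k IH] b V K K00 VK rowV cc ac bc.
  exact: (ulip_linear K00 dom VK rowV cc ac bc).
have Vl : ulip D V := ulip_linear K00 dom VK rowV (uc_ulip cc) (uc_ulip ac) (uc_ulip bc).
have Vk : uc k D V := IH b V K K00 VK rowV (uc_pred cc) (uc_pred ac) (uc_pred bc).
have ck := uc_pred cc; have ak := uc_pred ac.
have [cl [c' cd c'c]] := cc; have [al [a' ad a'c]] := ac; have [bl [b' bd b'c]] := bc.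
pose B i s := b' i s - lrow sg (fun i => c' i s) (fun r i => a' (r, i) s) (fun i => V i s) i.
have Bk : uc k D B.
  apply: uc_sub => //; apply: uc_add; first exact: uc_mul.
  apply: uc_sum => r; apply: uc_mul.
    exact: (uc_reindex (fun i => (r, i)) a'c).
  exact: (uc_reindex (sg r) Vk).
have [CB CB0 [B1 _]] := uc_ulip Bk.
have [Cc Cc0 [hc1 _]] := cl.
have /choice[W hW] : forall s, exists W : I -> R, D s -> (forall i, `|W i| <= K0 * CB) /\
    forall i, lrow sg (fun i => c i s) (fun r i => a (r, i) s) W i = B i s.
  move=> s; have [Ds|nDs] := pselect (D s); last by exists (fun=> 0) => /nDs.
  have [w hw dm] := dom s Ds.
  have [i|W [W1 W2]] := dominated_sol (b := fun i => B i s) hw dm (cM := Cc) _ CB0 (fun i => B1 i s Ds).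
    exact: le_trans (ler_norm _) (hc1 i s Ds).
  by exists W.
pose V' i s := W s i.
have V'k : uc k D V'.
  apply: (IH B V' (K0 * CB)) => //; first by rewrite mulr_ge0.
    by move=> i s Ds; have [h _] := hW s Ds; exact: h.
  by move=> s i Ds; have [_ h] := hW s Ds; exact: h.
split=> //; exists V' => //.
have [CV CV0 [V1 V2]] := Vl.
have [Dc Dc0 hc] := cd; have [Da Da0 ha] := ad; have [Db Db0 hb] := bd.
have [Ec Ec0 [c'1 _]] := uc_ulip c'c; have [Ea Ea0 [a'1 _]] := uc_ulip a'c.
pose E := Db + m.+1%:R * ((Dc + Da) * K) + m.+1%:R * ((Ec + Ea) * CV).
have E0 : 0 <= E by rewrite /E !(addr_ge0, mulr_ge0).
exists (K0 * E); first by rewrite mulr_ge0.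
move=> i s t Ds Dt; have [w hw dm] := dom s Ds; have [W1 W2] := hW s Ds.
have bdd j : `|V j t - V j s - (t - s) * V' j s| <= K + K + `|t - s| * (K0 * CB).
  apply: le_trans (ler_normB _ _) _; apply: lerD; last exact: (norm_mul_le (lexx _) (W1 j)).
  by apply: le_trans (ler_normB _ _) _; apply: lerD; exact: VK.
have Et0 : 0 <= E * `|t - s| ^+ 2 by rewrite mulr_ge0 // exprn_ge0.
rewrite -mulrA; apply: (dominated_le hw dm bdd Et0) => j.
have -> : lrow sg (fun i => c i s) (fun r i => a (r, i) s) (fun i => V i t - V i s - (t - s) * V' i s) j =
  (b j t - b j s - (t - s) * b' j s)
  - lrow sg (fun i => c i t - c i s - (t - s) * c' i s)
           (fun r i => a (r, i) t - a (r, i) s - (t - s) * a' (r, i) s) (fun i => V i t) j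
  - (t - s) * lrow sg (fun i => c' i s) (fun r i => a' (r, i) s) (fun i => V i t - V i s) j.
  rewrite row_lin W2 /B -[b j s]rowV // -[b j t]rowV //.
  rewrite /lrow /=; move: (t - s) => h.
  under [\sum_(r < m) a (r, j) s * (_ - _)]eq_bigr do rewrite mulrBr.
  under [\sum_(r < m) (_ - _ - _) * _]eq_bigr do rewrite !mulrBl -mulrA.
  under [\sum_(r < m) a' (r, j) s * (_ - _)]eq_bigr do rewrite mulrBr.
  by rewrite !sumrB -!mulr_sumr; ring.
apply: le_trans (ler_normB _ _) _; rewrite /E [leRHS]mulrDl; apply: lerD.
  apply: le_trans (ler_normB _ _) _; rewrite [leRHS]mulrDl; apply: lerD; first exact: hb.
  rewrite -!mulrA [K * _]mulrC [(Dc + Da) * _]mulrA; apply: row_le => [l|r l|l]; last exact: VK.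
    by apply: le_trans (hc l s t Ds Dt) _; rewrite ler_wpM2r ?exprn_ge0 // lerDl.
  by apply: le_trans (ha (r, l) s t Ds Dt) _; rewrite ler_wpM2r ?exprn_ge0 // lerDr.
rewrite expr2 mulrA [_ * `|t - s|]mulrC normrM; apply: ler_wpM2l => //.
rewrite -!mulrA; apply: row_le => [l|r l|l]; last exact: V2.
  by apply: le_trans (c'1 l s Ds) _; rewrite lerDl.
by apply: le_trans (a'1 (r, l) s Ds) _; rewrite lerDr.
Qed.

Section Nonlinear.
Variables (X : I -> R -> R) (b : I -> R) (cM M : R).
Variables (c : I -> (I -> R) -> (I -> R) -> R) (a : 'I_m * I -> (I -> R) -> (I -> R) -> R).
Let Xs s i := X i s.
Let cc t s i := c i (Xs t) (Xs s).
Let aa t s r i := a (r, i) (Xs t) (Xs s).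

(** [c] and [a] are secant coefficients of a nonlinear system with right-hand side s b solved by
    [X]; at equal arguments they form the Jacobian. Dominance of the secants makes X Lipschitz, the
    solution of the linearization is its derivative, and [uc_linear] bootstraps because the Jacobian
    is as smooth as X. Dominance is available for s <= t only, so backward increments use the
    secants with exchanged arguments. *)
Lemma uc_nonlinear k :
  (forall i s, D s -> `|X i s| <= M) -> (forall i, `|b i| <= 1) ->
  (forall s t, D s -> D t -> s <= t -> forall i, lrow sg (cc t s) (aa t s) (fun i => X i t - X i s) i = (t - s) * b i) ->
  (forall s t, D s -> D t -> s <= t -> exists2 w, weight wm wM w & dominated sg q cm (cc t s) (aa t s) w) ->
  (forall s i, D s -> cc s s i <= cM) ->
  (ulip D X -> exists2 C, 0 <= C & forall s t, D s -> D t ->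
    (forall i, `|cc t s i - cc s s i| <= C * `|t - s| /\
               `|cc s t i - cc s s i| <= C * `|t - s|) /\
    (forall r i, `|aa t s r i - aa s s r i| <= C * `|t - s| /\
                 `|aa s t r i - aa s s r i| <= C * `|t - s|)) ->
  (forall k, uc k D X -> uc k D (fun i s => cc s s i)) ->
  (forall k r, uc k D X -> uc k D (fun i s => aa s s r i)) ->
  uc k D X.
Proof.
move=> XM b1 eqn dom cb lipc ccl acl.
have Xl : ulip D X.
  have main i s t : D s -> D t -> s <= t -> `|X i t - X i s| <= K0 * `|t - s|.
    move=> Ds Dt st; have [w hw dm] := dom s t Ds Dt st.
    apply: (@dominated_le _ w (fun i => X i t - X i s) _ (M + M)) hw dm _ _ _ i => //.
      by move=> j; apply: le_trans (ler_normB _ _) _; apply: lerD; exact: XM.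
    by move=> j; rewrite eqn // normrM ler_piMr.
  exists (`|M| + K0); first by rewrite addr_ge0.
  split=> [i s Ds|i s t Ds Dt].
    by apply: le_trans (XM i s Ds) _; apply: le_trans (ler_norm _) _; rewrite lerDl.
  apply: le_trans (_ : K0 * `|t - s| <= _); last by rewrite ler_wpM2r // lerDr.
  have [st|/ltW ts] := leP s t; first exact: main.
  by rewrite distrC [in leRHS]distrC; exact: main.
have [C C0 hC] := lipc Xl.
have /choice[W hW] : forall s, exists W : I -> R, D s -> (forall i, `|W i| <= K0 * 1) /\
    forall i, lrow sg (cc s s) (aa s s) W i = b i.
  move=> s; have [Ds|nDs] := pselect (D s); last by exists (fun=> 0) => /nDs.
  have [w hw dm] := dom s s Ds Ds (lexx s).
  have [W [W1 W2]] := dominated_sol hw dm (fun i => cb s i Ds) ler01 b1.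
  by exists W.
pose V i s := W s i.
have XV : udiff D X V.
  pose E := m.+1%:R * (C * (K0 * 1)).
  have E0 : 0 <= E by apply: mulr_ge0 => //; apply: mulr_ge0 => //; rewrite mulr1.
  exists (K0 * E); first exact: mulr_ge0.
  move=> i s t Ds Dt; have [W1 W2] := hW s Ds.
  have Et0 : 0 <= E * `|t - s| ^+ 2 by rewrite mulr_ge0 // exprn_ge0.
  have bdd j : `|X j t - X j s - (t - s) * V j s| <= M + M + `|t - s| * (K0 * 1).
    apply: le_trans (ler_normB _ _) _; apply: lerD; last exact: (norm_mul_le (lexx _) (W1 j)).
    by apply: le_trans (ler_normB _ _) _; apply: lerD; exact: XM.
  have fin (c1 : I -> R) (a1 : 'I_m -> I -> R) j :
      lrow sg c1 a1 (fun i => X i t - X i s) j = (t - s) * b j ->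
      (forall i, `|c1 i - cc s s i| <= C * `|t - s|) ->
      (forall r i, `|a1 r i - aa s s r i| <= C * `|t - s|) ->
      `|lrow sg c1 a1 (fun i => X i t - X i s - (t - s) * V i s) j| <= E * `|t - s| ^+ 2.
    move=> e1 hc ha; rewrite row_lin e1 -W2 -mulrBr normrM [X in _ * X <= _]distrC row_subr.
    have -> : E * `|t - s| ^+ 2 = `|t - s| * (m.+1%:R * (C * `|t - s| * (K0 * 1))).
      by rewrite /E expr2; move: `|t - s| (K0 * 1) => x y; ring.
    by rewrite ler_wpM2l //; exact: row_le.
  have [hCc hCa] := hC s t Ds Dt.
  rewrite -mulrA; have [st|/ltW ts] := leP s t.
    have [w hw dm] := dom s t Ds Dt st.
    apply: (dominated_le hw dm bdd Et0) => j; apply: fin; first exact: eqn.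
      by move=> l; case: (hCc l).
    by move=> r l; case: (hCa r l).
  have [w hw dm] := dom t s Dt Ds ts.
  apply: (dominated_le hw dm bdd Et0) => j; apply: fin.
    have := eqn t s Dt Ds ts j.
    rewrite (_ : (fun i => X i s - X i t) = (fun i => 0 - 1 * (X i t - X i s))).
      rewrite (row_lin _ (fun=> 0)) {1}/lrow mulr0 big1 => [|r _]; last by rewrite mulr0.
      by move=> e; rewrite -[RHS]opprK -mulNr opprB -e; ring.
    by apply/funext => l; ring.
    by move=> l; case: (hCc l).
  by move=> r l; case: (hCa r l).
elim: k => [|k IH]; first exact: Xl.
split=> //; exists V => //.
apply: (@uc_linear k (fun i s => cc s s i) (fun i _ => b i) V (fun ri s => aa s s ri.1 ri.2) (K0 * 1)).
- by rewrite mulr1.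
- by move=> s Ds; exact: dom.
- by move=> i s Ds; have [h _] := hW s Ds; exact: h.
- by move=> s i Ds; have [_ h] := hW s Ds; exact: h.
- exact: ccl.
- by apply: (uc_ord (f := fun r i s => aa s s r i)) => r; exact: acl.
- exact: uc_const b1.
Qed.
End Nonlinear.
End DominatedCurves.

(** * Composition, reciprocals, inverse functions and iterated derivatives *)

Lemma ulip_comp (R : realType) (J K : Type) (D E : set R) (h : K -> R -> R) (X : J -> R -> R) :
  (forall j s, D s -> E (X j s)) -> ulip E h -> ulip D X ->
  ulip D (fun kj : K * J => fun s => h kj.1 (X kj.2 s)).
Proof.
move=> DE [C C0 [h1 h2]] [C' C'0 [X1 X2]]; exists (C + C * C'); first by rewrite addr_ge0 ?mulr_ge0.
have CC : 0 <= C * C' by rewrite mulr_ge0.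
split=> [[k j] s Ds|[k j] s t Ds Dt] /=.
  by apply: le_trans (h1 k _ (DE j s Ds)) _; rewrite lerDl.
apply: le_trans (h2 k _ _ (DE j s Ds) (DE j t Dt)) _.
apply: le_trans (ler_wpM2l C0 (X2 j s t Ds Dt)) _.
by rewrite mulrA ler_wpM2r // lerDr.
Qed.

Lemma uc_comp (R : realType) k (J K : Type) (D E : set R) (h : K -> R -> R) (X : J -> R -> R) :
  (forall j s, D s -> E (X j s)) -> uc k E h -> uc k D X ->
  uc k D (fun kj : K * J => fun s => h kj.1 (X kj.2 s)).
Proof.
move=> DE; elim: k h X DE => [|k IH] h X DE; first exact: ulip_comp.
move=> hc Xc; have Xk := uc_pred Xc.
have [hl [h' [Ch Ch0 hd] h'c]] := hc; have [Xl [X' [CX CX0 Xd] X'c]] := Xc.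
split; first exact: ulip_comp hl Xl.
have h'Xk := IH _ _ DE h'c Xk.
exists (fun kj s => h' kj.1 (X kj.2 s) * X' kj.2 s); last first.
  by apply: uc_mul => //; exact: (uc_reindex snd X'c).
have [C' C'0 [h'1 _]] := uc_ulip h'c; have [L L0 [_ X2]] := Xl.
exists (Ch * L ^+ 2 + C' * CX); first by rewrite addr_ge0 ?mulr_ge0 ?exprn_ge0.
move=> [k0 j] s t Ds Dt /=.
have Es := DE j s Ds; have Et := DE j t Dt.
have -> : h k0 (X j t) - h k0 (X j s) - (t - s) * (h' k0 (X j s) * X' j s) =
  (h k0 (X j t) - h k0 (X j s) - (X j t - X j s) * h' k0 (X j s)) +
  h' k0 (X j s) * (X j t - X j s - (t - s) * X' j s) by ring.
apply: le_trans (ler_normD _ _) _; rewrite [leRHS]mulrDl; apply: lerD.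
  apply: le_trans (hd k0 _ _ Es Et) _; rewrite -mulrA -exprMn ler_wpM2l //.
  by rewrite lerXn2r ?nnegrE ?mulr_ge0 //; exact: X2.
by rewrite -mulrA; apply: norm_mul_le; [exact: h'1|exact: Xd].
Qed.

(** The reciprocal solves the linear system f V = 1, which has no off-diagonal entries (m = 0). *)
Lemma uc_inv (R : realType) k (J : Type) (D : set R) (f : J -> R -> R) (c : R) :
  0 < c -> (forall j s, D s -> c <= f j s) -> uc k D f -> uc k D (fun j s => (f j s)^-1).
Proof.
move=> c0 hc fk.
apply: (@uc_linear R J 0 (fun _ j => j) D 0 c 1 1 _ c0 ltr01 k f (fun _ _ => 1) _ (fun _ _ => 0) c^-1) => //.
- by rewrite lexx ltr01.
- by rewrite invr_ge0 ltW.
- move=> s Ds; exists (fun=> 1) => j; first by rewrite lexx.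
  by split; [exact: hc|rewrite big_ord0 !mul0r].
- move=> j s Ds; have h := hc j s Ds; have h0 : 0 < f j s by apply: lt_le_trans h.
  by rewrite normfV (gtr0_norm h0) lef_pV2 ?posrE.
- move=> s j Ds; have h := hc j s Ds; have h0 : 0 < f j s by apply: lt_le_trans h.
  by rewrite /lrow big_ord0 addr0 divff // gt_eqF.
- exact: uc_cst.
- exact: uc_cst.
Qed.

Lemma udiff_le (R : realType) (a b c : R) (f f' : R -> R) x :
  a < b -> a <= x <= b -> 0 <= c ->
  udiff `[a, b]%classic (fun _ : unit => f) (fun _ : unit => f') ->
  (forall s t, a <= s -> s <= t -> t <= b -> c * (t - s) <= f t - f s) -> c <= f' x.
Proof.
move=> ab /andP[ax xb] c0 [C C0 hd] hc.
apply/ler_addgt0Pr => e e0.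
have key y : a <= y <= b -> y != x -> c <= f' x + C * `|y - x|.
  move=> /andP[ay yb] yx; have yx0 : 0 < `|y - x| by rewrite normr_gt0 subr_eq0.
  have := hd tt x y; rewrite /= !in_itv /= ax xb ay yb => /(_ isT isT).
  rewrite ler_norml; have [xy|xy] := leP x y.
    have h := hc x y ax xy yb.
    rewrite ger0_norm ?subr_ge0 // in yx0 * => /andP[_ h2].
    rewrite -(ler_pM2r yx0) mulrDl; move: h h2; rewrite expr2; clear => h h2; lra.
  have h := hc y x ay (ltW xy) xb.
  rewrite ltr0_norm ?subr_lt0 // in yx0 * => /andP[h2 _].
  rewrite -(ler_pM2r yx0) mulrDl; move: h h2; rewrite expr2; clear => h h2; lra.
pose d := e / (C + 1).
have C1 : 0 < C + 1 by lra.
have d0 : 0 < d by rewrite divr_gt0.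
have Cd : C * d <= e.
  have : d * (C + 1) = e by rewrite /d divfK // gt_eqF.
  by move=> <-; lra.
have [xb'|xb'] := ltP x b.
  have [h1|h1] := leP (x + d) b.
    have := key (x + d); rewrite (_ : a <= x + d <= b); last by lra.
    rewrite (_ : x + d != x); last by rewrite -subr_eq0 addrAC subrr add0r gt_eqF.
    rewrite addrAC subrr add0r (gtr0_norm d0) => /(_ isT isT) h; lra.
  have := key b; rewrite (_ : a <= b <= b); last by rewrite (ltW ab) lexx.
  rewrite gt_eqF // => /(_ isT isT); rewrite gtr0_norm ?subr_gt0 //.
  have : C * (b - x) <= C * d by rewrite ler_wpM2l //; lra.
  by move=> *; lra.
have {xb'}xE : x = b by apply/eqP; rewrite eq_le xb.
have [h1|h1] := leP a (x - d).
  have := key (x - d); rewrite (_ : a <= x - d <= b); last by lra.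
  rewrite (_ : x - d != x); last by rewrite -subr_eq0 addrAC subrr add0r oppr_eq0 gt_eqF.
  rewrite addrAC subrr add0r normrN (gtr0_norm d0) => /(_ isT isT) h; lra.
have := key a; rewrite lexx (ltW ab) xE lt_eqF // => /(_ isT isT).
rewrite ltr0_norm ?subr_lt0 // opprB.
have : C * (b - a) <= C * d by rewrite ler_wpM2l //; lra.
by move=> *; lra.
Qed.

(** The derivative of the inverse is 1 / f'(g), so g gains one order of smoothness at each step.
    Expansion at rate c keeps f' away from 0 up to the end points of [a, b]. *)
Lemma uc_inverse (R : realType) (D : set R) (a b c : R) (f g : R -> R) :
  a < b -> 0 < c ->
  (forall s t, a <= s -> s <= t -> t <= b -> c * (t - s) <= f t - f s) ->
  (forall s, D s -> a <= g s <= b /\ f (g s) = s) ->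
  (forall k, uc k `[a, b]%classic (fun _ : unit => f)) -> forall k, uc k D (fun _ : unit => g).
Proof.
move=> ab c0 hc hg fk.
have gD (u : unit) s : D s -> `[a, b]%classic (g s) by move=> /hg[h _]; rewrite /= in_itv.
have ci : 0 <= c^-1 by rewrite invr_ge0 ltW.
have glip s t : D s -> D t -> `|g t - g s| <= c^-1 * `|t - s|.
  move=> /hg[/andP[g1 g2] gs] /hg[/andP[g3 g4] gt].
  rewrite ler_pdivlMl // -[X in c * X]subr0 subr0.
  have [h|/ltW h] := leP (g s) (g t).
    have := hc _ _ g1 h g4; rewrite gt gs => h'.
    by rewrite ger0_norm ?subr_ge0 //; apply: le_trans h' (ler_norm _).
  have := hc _ _ g3 h g2; rewrite gt gs => h'.
  by rewrite distrC ger0_norm ?subr_ge0 //; apply: le_trans h' _; rewrite distrC ler_norm.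
have gl : ulip D (fun _ : unit => g).
  exists (`|a| + `|b| + c^-1); first by rewrite !addr_ge0.
  split=> [_ s /hg[/andP[g1 g2] _]|_ s t Ds Dt].
    have := ler_norm b; have := ler_norm (- a); rewrite normrN => h1 h2.
    have := normr_ge0 a; have := normr_ge0 b => h3 h4.
    by rewrite ler_norml; apply/andP; split; lra.
  apply: le_trans (glip s t Ds Dt) _; rewrite ler_wpM2r // lerDr.
  by rewrite addr_ge0.
elim=> [|k IH]; first exact: gl.
have [_ [f' fd f'c]] := fk k.+1.
have f'lo x : a <= x <= b -> c <= f' tt x.
  move=> hx; apply: (@udiff_le _ a b c f (f' tt)) hc => //; first exact: ltW.
  by have [C C0 h] := fd; exists C => // [] s t; exact: h.
have [C C0 fd'] := fd.
have f'gk : uc k D (fun (_ : unit) s => (f' tt (g s))^-1).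
  apply: (@uc_inv _ _ _ _ _ c) => //; first by move=> _ s /hg[h _]; exact: f'lo.
  by have := uc_comp gD f'c IH; move/(uc_reindex (fun u : unit => (tt, u))).
split=> //; exists (fun _ s => (f' tt (g s))^-1) => //.
exists (c^-1 * (C * c^-1 ^+ 2)); first by rewrite !mulr_ge0 ?exprn_ge0.
move=> [] s t Ds Dt; have [/andP[g1 g2] gs] := hg s Ds; have [/andP[g3 g4] gt] := hg t Dt.
have := fd' tt (g s) (g t); rewrite /= !in_itv /= g1 g2 g3 g4 gs gt => /(_ isT isT) h.
have lo := f'lo (g s); rewrite g1 g2 in lo; have {}lo := lo isT.
have p0 : 0 < f' tt (g s) by apply: lt_le_trans lo.
have -> : g t - g s - (t - s) * (f' tt (g s))^-1 =
   - ((f' tt (g s))^-1 * (t - s - (g t - g s) * f' tt (g s))) by field; rewrite gt_eqF.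
rewrite normrN -mulrA; apply: norm_mul_le.
  by rewrite normfV (gtr0_norm p0) lef_pV2 ?posrE.
apply: le_trans h _; rewrite -mulrA -exprMn ler_wpM2l //.
by rewrite lerXn2r ?nnegrE ?mulr_ge0 //; exact: glip.
Qed.

(** Identifies the derivatives that [uc] merely asserts to exist with [derive1], so that iterated
    derivatives of a curve become canonical. *)
Lemma udiff_derive1 (R : realType) (J : Type) (D : set R) (f f' : J -> R -> R) :
  open D -> udiff D f f' -> forall j s, D s -> derive1 (f j) s = f' j s.
Proof.
move=> oD [C C0 hd] j s Ds; rewrite /derive1; apply: cvg_lim => //.
apply/cvgrPdist_le => e e0.
have /(nbhs_ballP s D) [r /= r0 hr] : nbhs s D by exact: open_nbhs_nbhs.
have Ce : 0 < e / (C + 1) by rewrite divr_gt0 //; lra.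
near=> h.
have h0 : h != 0 by near: h; exact: nbhs_dnbhs_neq.
have hr' : `|h| < r by near: h; apply: dnbhs0_lt.
have he : `|h| <= e / (C + 1) by near: h; apply: dnbhs0_le.
have Dh : D (h + s).
  by apply: hr; rewrite /ball /= opprD addrCA subrr addr0 normrN.
have := hd j s (h + s) Ds Dh; rewrite addrK => hh.
rewrite distrC.
have -> : h^-1 *: (f j (h + s) - f j s) - f' j s = h^-1 * (f j (h + s) - f j s - h * f' j s).
  by rewrite /GRing.scale /=; field.
rewrite normrM normfV mulrC ler_pdivrMr ?normr_gt0 //.
apply: le_trans hh _; rewrite expr2 mulrA ler_wpM2r //.
apply: le_trans (ler_wpM2l C0 he) _; rewrite mulrA ler_pdivrMr; last lra.
by rewrite mulrC ler_wpM2l ?ltW //; lra.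
Unshelve. all: by end_near.
Qed.

Lemma uc_derive1 (R : realType) k (J : Type) (D : set R) (f : J -> R -> R) :
  open D -> uc k.+1 D f -> uc k D (fun j => derive1 (f j)) /\ udiff D f (fun j => derive1 (f j)).
Proof.
move=> oD [fl [f' fd f'c]]; have E := udiff_derive1 oD fd.
split; first by apply: uc_ext f'c => // j s Ds; rewrite E.
by apply: udiff_ext fd => // j s Ds; rewrite E.
Qed.

Lemma uc_derive1n (R : realType) k n (J : Type) (D : set R) (f : J -> R -> R) :
  open D -> uc (n + k) D f -> uc k D (fun j => derive1n n (f j)).
Proof.
move=> oD; elim: n f => [//|n IH] f; rewrite addSn => fc.
have [f'c _] := uc_derive1 oD fc.
by apply: uc_ext (IH _ f'c) => // j s _; rewrite derive1Sn.
Qed.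

(** * A smooth step function *)

Section SmoothStep.
Variable R : realType.
Implicit Types (t s : R) (l : seq (R * nat)).

(** t^(-n) exp(-1/t), extended by 0: the derivatives of exp(-1/t) are combinations of these
    functions. *)
Definition flat (n : nat) (t : R) : R := if 0 < t then t^-1 ^+ n * expR (- t^-1) else 0.

Lemma flat0 n t : t <= 0 -> flat n t = 0.
Proof. by rewrite /flat ltNge => ->. Qed.

Lemma flat_ge0 n t : 0 <= flat n t.
Proof.
rewrite /flat; case: ifP => // t0.
by rewrite mulr_ge0 ?expR_ge0 ?exprn_ge0 ?invr_ge0 ?ltW.
Qed.

Lemma flat_le n t : flat n t <= n.+1`!%:R.
Proof.
rewrite /flat; case: ifP => [t0|_]; last by rewrite ler0n.
have u0 : 0 < t^-1 by rewrite invr_gt0.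
rewrite expRN ler_pdivrMr ?expR_gt0 //.
case: n => [|n].
  by rewrite expr0 mul1r -expR0 ler_expR ltW.
have h := expR_ge1Dxn n (ltW u0).
have h2 : t^-1 ^+ n.+1 / n.+1`!%:R <= expR t^-1 by apply: le_trans h; rewrite lerDr.
rewrite ler_pdivrMr ?ltr0n ?fact_gt0 // mulrC in h2.
apply: le_trans h2 _; rewrite ler_wpM2r ?expR_ge0 // ler_nat.
by rewrite [n.+2`!]factS leq_pmull.
Qed.

Lemma flatE n t : flat n t = t * flat n.+1 t.
Proof.
rewrite /flat; case: ifP => [t0|]; last by rewrite mulr0.
by rewrite exprS !mulrA divff ?mul1r // gt_eqF.
Qed.

Definition flats l t := \sum_(p <- l) p.1 * flat p.2 t.
(** Term by term, (t^(-n) exp(-1/t))' = t^(-n-2) exp(-1/t) - n t^(-n-1) exp(-1/t). *)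
Definition flats_deriv l :=
  flatten [seq [:: (p.1, p.2.+2); (- (p.2%:R * p.1), p.2.+1)] | p <- l].

Lemma flats0 l t : t <= 0 -> flats l t = 0.
Proof. by move=> t0; rewrite /flats big1 // => p _; rewrite flat0 // mulr0. Qed.

Lemma flats_bounded l : exists2 C, 0 <= C & forall t, `|flats l t| <= C.
Proof.
exists (\sum_(p <- l) `|p.1| * p.2.+1`!%:R); first by apply: sumr_ge0 => p _; rewrite mulr_ge0.
move=> t; apply: le_trans (ler_norm_sum _ _ _) _; apply: ler_sum => p _.
by apply: norm_mul_le => //; rewrite ger0_norm ?flat_ge0 ?flat_le.
Qed.

(** A factor t can be split off within the class by [flatE]. This settles the Taylor estimates at 0
    and across it, where the formula for the derivative does not apply. *)
Lemma flats_linear l : exists2 C, 0 <= C & forall t, `|flats l t| <= C * `|t|.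
Proof.
have [C C0 hC] := flats_bounded [seq (p.1, p.2.+1) | p <- l].
exists C => // t; have -> : flats l t = t * flats [seq (p.1, p.2.+1) | p <- l] t.
  rewrite /flats big_map mulr_sumr; apply: eq_bigr => p _ /=.
  by rewrite flatE mulrCA.
by rewrite mulrC; apply: norm_mul_le.
Qed.

Lemma flats_quadratic l : exists2 C, 0 <= C & forall t, `|flats l t| <= C * `|t| ^+ 2.
Proof.
have [C C0 hC] := flats_linear [seq (p.1, p.2.+1) | p <- l].
exists C => // t; have -> : flats l t = t * flats [seq (p.1, p.2.+1) | p <- l] t.
  rewrite /flats big_map mulr_sumr; apply: eq_bigr => p _ /=.
  by rewrite flatE mulrCA.
by rewrite expr2 mulrA mulrC; apply: norm_mul_le.
Qed.

Lemma flat_derive n t : 0 < t ->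
  is_derive t 1 (flat n) (flat n.+2 t - n%:R * flat n.+1 t).
Proof.
move=> t0.
pose g (x : R) := x^-1 ^+ n * expR (- x^-1).
have t1 : t != 0 by rewrite gt_eqF.
have d1 : is_derive t 1 (fun x : R => x^-1) (- t ^- 2 *: 1).
  by apply: (@is_deriveV _ id) => //; exact: is_derive_id.
have d2 : is_derive t 1 (fun x : R => - x^-1) (- (- t ^- 2 *: 1)) by exact: is_deriveN.
have d3 : is_derive t 1 (expR \o (fun x : R => - x^-1)) (expR (- t^-1) * (- (- t ^- 2 *: 1))).
  exact: is_derive1_comp.
have d4 := is_deriveX n d1.
have d5 := is_deriveM d4 d3.
have gd : is_derive t 1 g (flat n.+2 t - n%:R * flat n.+1 t).
  have -> : g = ((fun x : R => x^-1) ^+ n) * (expR \o (fun x : R => - x^-1)).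
    apply/funext => x; rewrite /g /=; congr (_ * _).
    by elim: (n) => [|m IH]; [rewrite !expr0|rewrite !exprS IH].
  have pw m : ((fun x : R => x^-1) ^+ m) t = t^-1 ^+ m.
    by elim: m => [|m IH]; [rewrite !expr0|rewrite !exprS -IH].
  apply: is_derive_eq; rewrite /flat t0 /GRing.scale /= pw -exprVn.
  by case: (n) => [|m]; [rewrite !mul0r; ring|rewrite /= !exprS; ring].
apply: near_eq_is_derive gd => //.
near=> x; have x0 : 0 < x by near: x; exact: lt_nbhsr.
by rewrite /flat x0.
Unshelve. all: by end_near. Qed.

Lemma flats_derive l t : 0 < t -> is_derive t 1 (flats l) (flats (flats_deriv l) t).
Proof.
move=> t0; elim: l => [|[c n] l IH].
  have -> : flats [::] = cst 0 by apply/funext => x; rewrite /flats big_nil.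
  exact: is_derive_cst.
have -> : flats ((c, n) :: l) = c *: flat n + flats l.
  by apply/funext => x; rewrite /flats big_cons.
have d1 := is_deriveZ c (flat_derive n t0).
apply: is_derive_eq; rewrite {2}/flats /= !big_cons /= addrA -/(flats _ _).
by congr (_ + _); rewrite /GRing.scale /=; ring.
Qed.

Lemma flats_mvt l s t : 0 < s -> 0 < t -> exists x,
  [/\ 0 < x, `|x - s| <= `|t - s| & flats l t - flats l s = flats (flats_deriv l) x * (t - s)].
Proof.
move=> s0 t0.
have main a b : 0 < a -> a <= b -> exists x,
    [/\ a <= x, x <= b & flats l b - flats l a = flats (flats_deriv l) x * (b - a)].
  move=> a0 ab.
  have [||x] := @MVT_segment R (flats l) (flats (flats_deriv l)) a b ab.
  - by move=> x; rewrite in_itv => /andP[ax _]; apply: flats_derive; exact: lt_trans ax.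
  - apply: derivable_within_continuous => x; rewrite in_itv => /andP[ax _].
    by have [] := flats_derive l (lt_le_trans a0 ax).
  by rewrite in_itv => /andP[ax xb] E; exists x.
have [st|/ltW ts] := leP s t.
  have [x [sx xt E]] := main s t s0 st; exists x; split=> //; first exact: lt_le_trans sx.
  by rewrite !ger0_norm ?subr_ge0 //; lra.
have [x [tx xs E]] := main t s t0 ts; exists x; split; first exact: lt_le_trans tx.
  by rewrite !ler0_norm ?subr_le0 //; lra.
by rewrite -opprB E; ring.
Qed.

Lemma flats_udiff l : udiff setT (fun _ : unit => flats l) (fun _ => flats (flats_deriv l)).
Proof.
have [C C0 hC] := flats_bounded (flats_deriv (flats_deriv l)).
have [C1 C10 hC1] := flats_quadratic l.
have [C2 C20 hC2] := flats_linear (flats_deriv l).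
exists (C + C1 + C2); first by rewrite !addr_ge0.
move=> _ s t _ _.
have [s0|s0] := leP s 0.
  rewrite !(@flats0 _ s) // mulr0 !subr0.
  have [t0|t0] := leP t 0; first by rewrite flats0 // normr0 mulr_ge0 // ?exprn_ge0 // !addr_ge0.
  apply: le_trans (hC1 t) _; apply: ler_pM => //; first by lra.
  by rewrite lerXn2r ?nnegrE // !ger0_norm ?subr_ge0 //; lra.
have [t0|t0] := leP t 0.
  rewrite (@flats0 _ t) // sub0r -opprD normrN.
  apply: le_trans (ler_normD _ _) _; rewrite [leRHS]mulrDl.
  have sts : `|s| <= `|t - s| by rewrite (gtr0_norm s0) (ltr0_norm (_ : t - s < 0)); lra.
  apply: lerD.
    apply: le_trans (hC1 s) _.
    apply: le_trans (_ : C1 * `|t - s| ^+ 2 <= _); first by rewrite ler_wpM2l // lerXn2r ?nnegrE.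
    by rewrite ler_wpM2r ?exprn_ge0 // lerDr.
  rewrite expr2 mulrA [leRHS]mulrC; apply: norm_mul_le => //.
  by apply: le_trans (hC2 s) _; rewrite ler_wpM2l.
have [x [x0 xs ->]] := flats_mvt l s0 t0.
have [y [y0 ys E]] := flats_mvt (flats_deriv l) s0 x0.
rewrite (_ : _ - _ = (flats (flats_deriv l) x - flats (flats_deriv l) s) * (t - s)); last by ring.
rewrite E expr2 mulrA; apply: norm_mul_le => //.
apply: norm_mul_le => //; apply: le_trans (hC y) _; lra.
Qed.

Lemma flats_uc k l : uc k setT (fun _ : unit => flats l).
Proof.
have lip l' : ulip setT (fun _ : unit => flats l').
  have [C C0 hC] := flats_bounded l'.
  have [C1 C10 hC1] := flats_bounded (flats_deriv l').
  have [C2 C20 hC2] := flats_linear l'.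
  exists (C + C1 + C2); first by rewrite !addr_ge0.
  split=> [_ s _|_ s t _ _]; first by apply: le_trans (hC s) _; lra.
  have [s0|s0] := leP s 0.
    rewrite (@flats0 _ s) // subr0.
    have [t0|t0] := leP t 0; first by rewrite flats0 // normr0 mulr_ge0 // !addr_ge0.
    apply: le_trans (hC2 t) _; apply: ler_pM => //; first by lra.
    by rewrite !ger0_norm ?subr_ge0 //; lra.
  have [t0|t0] := leP t 0.
    rewrite (@flats0 _ t) // sub0r normrN.
    apply: le_trans (hC2 s) _; apply: ler_pM => //; first by lra.
    by rewrite (gtr0_norm s0) (ltr0_norm (_ : t - s < 0)); lra.
  have [x [x0 xs ->]] := flats_mvt l' s0 t0.
  by apply: norm_mul_le => //; apply: le_trans (hC1 x) _; lra.
elim: k l => [|k IH] l; first exact: lip.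
by split; [exact: lip|exists (fun _ => flats (flats_deriv l)); [exact: flats_udiff|exact: IH]].
Qed.

Lemma flat_uc k (M : R) : uc k `[- M, M]%classic (fun _ : unit => flat 0).
Proof.
apply: uc_ext (flats_uc k [:: (1, 0%N)]) => // _ s _.
by rewrite /flats big_seq1 mul1r.
Qed.

Lemma flat_homo s t : s <= t -> flat 0 s <= flat 0 t.
Proof.
move=> st; have [s0|s0] := leP s 0; first by rewrite flat0 // flat_ge0.
have t0 : 0 < t by apply: lt_le_trans st.
by rewrite /flat s0 t0 !expr0 !mul1r ler_expR lerN2 lef_pV2 ?posrE.
Qed.

Definition smooth_step t : R := flat 0 t / (flat 0 t + flat 0 (1 - t)).

Lemma smooth_step_den t : flat 0 2^-1 <= flat 0 t + flat 0 (1 - t).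
Proof.
have [t2|t2] := leP 2^-1 t.
  by apply: le_trans (flat_homo t2) _; rewrite lerDl flat_ge0.
by apply: le_trans (_ : flat 0 (1 - t) <= _); [apply: flat_homo; lra|rewrite lerDr flat_ge0].
Qed.

Lemma flat_half_gt0 : 0 < flat 0 2^-1.
Proof. by rewrite /flat invr_gt0 ltr0n /= expr0 mul1r expR_gt0. Qed.

Lemma smooth_step_den_gt0 t : 0 < flat 0 t + flat 0 (1 - t).
Proof. exact: lt_le_trans flat_half_gt0 (smooth_step_den t). Qed.

Lemma smooth_step0 t : t <= 0 -> smooth_step t = 0.
Proof. by move=> t0; rewrite /smooth_step flat0 // mul0r. Qed.

Lemma smooth_step1 t : 1 <= t -> smooth_step t = 1.
Proof.
move=> t1; rewrite /smooth_step [flat 0 (1 - t)]flat0 ?subr_le0 // addr0 divff //.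
have := smooth_step_den_gt0 t; rewrite [flat 0 (1 - t)]flat0 ?subr_le0 // addr0.
by move/gt_eqF ->.
Qed.

Lemma smooth_step_homo s t : s <= t -> smooth_step s <= smooth_step t.
Proof.
move=> st; rewrite /smooth_step ler_pdivrMr ?smooth_step_den_gt0 //.
rewrite mulrAC ler_pdivlMr ?smooth_step_den_gt0 // !mulrDr [flat 0 t * flat 0 s]mulrC.
rewrite lerD2l; apply: ler_pM; rewrite ?flat_ge0 // ?flat_homo //.
by rewrite lerD2l lerN2.
Qed.

Lemma smooth_step_ge0 t : 0 <= smooth_step t.
Proof. by rewrite divr_ge0 ?flat_ge0 // ltW ?smooth_step_den_gt0. Qed.

Lemma smooth_step_le1 t : smooth_step t <= 1.
Proof. by rewrite ler_pdivrMr ?smooth_step_den_gt0 // mul1r lerDl flat_ge0. Qed.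

Lemma smooth_step_uc k (M : R) : 0 <= M -> uc k `[- M, M]%classic (fun _ : unit => smooth_step).
Proof.
move=> M0; apply: uc_mul; first exact: flat_uc.
apply: (uc_inv flat_half_gt0); first by move=> _ s _; exact: smooth_step_den.
apply: uc_add; first exact: flat_uc.
have h := @uc_comp R k unit unit `[- M, M]%classic `[- (M + 1), M + 1]%classic
  (fun _ => flat 0) (fun _ s => 1 - s) _ (flat_uc k (M + 1)).
apply: (uc_reindex (fun u => (u, u)) (h _ _)).
  by move=> _ s /=; rewrite !in_itv /= => /andP[? ?]; apply/andP; split; lra.
apply: uc_sub; first exact: uc_cst.
by apply: (@uc_id _ _ _ _ M) => s /=; rewrite in_itv /= ler_norml.
Qed.
End SmoothStep.

(** * Fronts of the steady-state equation *)

(** Not sharp. The plateau rows need p^2 - 1 to exceed a large multiple of d, while next to the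
    saddle-node mu = 1 only (p^2 - 1)^2 >= d / 4 is known. *)
Definition dmax (R : realType) : R := 100^-1 ^+ 6.

(* (z^2 - 1)^2 = 1 - mu at the plateau value z = U_+(mu). *)
Definition well (R : realType) (z : R) : R := (z ^+ 2 - 1) ^+ 2.

Definition mu_of (R : realType) (p : R) : R := 2 * p ^+ 2 - p ^+ 4.

(** The equation of the active site with the sum of its neighbours relaxed to the interval
    [1/2, 3/2]. The range [3 d, 34/25] of x contains both handover values, about 27 d / 8 and
    4/3. *)
Definition core (R : realType) (d x p : R) : Prop :=
  [/\ 3 * d <= x <= 34 / 25, 1 < p &
      - (3 / 2) * d <= x * (well p - well x - 2 * d) <= - (1 / 2) * d].

Section Core.
Variables (R : realType) (d : R).

Lemma le_sqr (a b : R) : 0 <= b -> a ^+ 2 <= b ^+ 2 -> a <= b.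
Proof.
move=> b0 h; have [//|ba] := leP a b; exfalso.
have := lt_le_trans (_ : b ^+ 2 < a ^+ 2) h; rewrite ltxx => H; apply: (notF (H _)).
by rewrite ltrXn2r // nnegrE // (le_trans b0 (ltW ba)).
Qed.

Lemma dmax_mul : d <= dmax R -> 100 * (100 * (100 * (100 * (100 * (100 * d))))) <= 1.
Proof.
move=> d1; have e : (100 : R) ^+ 6 * dmax R = 1 by rewrite /dmax -exprMn divff ?expr1n.
have h : (100 : R) ^+ 6 * d <= 1 by rewrite -[leRHS]e ler_wpM2l // exprn_ge0.
by apply: le_trans h; rewrite !exprS expr0 mulr1 !mulrA.
Qed.

Lemma core_ratio x p : 0 < d -> core d x p -> exists r,
  [/\ r * x = d, 0 < r <= 1 / 3, 0 < x,
      well x + 2 * d - 3 / 2 * r <= (p ^+ 2 - 1) ^+ 2 &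
      (p ^+ 2 - 1) ^+ 2 <= well x + 2 * d - 1 / 2 * r].
Proof.
move=> d0 [/andP[x3 x1] p1 /andP[h1 h2]].
have x0 : 0 < x by lra.
exists (d / x); have rx : d / x * x = d by rewrite divfK // gt_eqF.
split=> //.
- by rewrite divr_gt0 //= ler_pdivrMr //; lra.
- rewrite -/(well p) -(ler_pM2r x0); move: h1 rx; set r := d / x => h1 rx.
  by move: h1; rewrite -rx; lra.
- rewrite -/(well p) -(ler_pM2r x0); move: h2 rx; set r := d / x => h2 rx.
  by move: h2; rewrite -rx; lra.
Qed.

Lemma well_lower (x a : R) : 0 <= x -> x <= a -> 1 - 2 * (a * a) <= well x.
Proof.
move=> x0 xa; have h : x * x <= a * a by apply: ler_pM.
by have := sqr_ge0 (x ^+ 2); rewrite /well; clear -h => h2; lra.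
Qed.

(** [lo] and [hi] enclose 1 - mu. The distance to the saddle-node mu = 1 is critical near x = 1,
    where [well x] vanishes and 2 d has to beat (3/2) d / x. The distance to mu = 0 comes from d / x
    for small x and from x^2 otherwise. *)
Lemma gap_facts (x r : R) : 0 < d -> d <= dmax R -> 3 * d <= x <= 34 / 25 ->
  r * x = d -> 0 < r <= 1 / 3 ->
  let lo := well x + 2 * d - 3 / 2 * r in
  let hi := well x + 2 * d - 1 / 2 * r in
  [/\ d / 4 <= lo, x <= 1 / 2 -> 4 / 9 <= lo,
      1000 * d <= 1 - hi & x ^+ 2 / 10 <= 1 - hi].
Proof.
move=> d0 /dmax_mul dm /andP[x3 x1] rx /andP[r0 r3] /=.
have x0 : 0 < x by lra.
have small : x <= 1 / 2 -> 4 / 9 <= well x + 2 * d - 3 / 2 * r.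
  move=> x2; have [xs|xs] := leP x (1 / 8).
    by have := well_lower (ltW x0) xs; clear -r3 d0 => h; lra.
  have h : r <= 8 * d by clear -rx xs r0 x0; nra.
  have h3 : x ^+ 2 <= 1 / 4 by clear -x2 x0; nra.
  have h4 : 9 / 16 <= well x by rewrite /well; move: h3; set X := x ^+ 2; clear => h3; nra.
  by clear -h h4 dm d0; lra.
have nud : d / 4 <= well x + 2 * d - 3 / 2 * r.
  have [/small h|xs] := leP x (1 / 2); first by clear -h dm d0; lra.
  have [x7|x7] := leP x (7 / 8).
    have h3 : x ^+ 2 <= 49 / 64 by clear -x7 x0; nra.
    have h4 : 1 / 20 <= well x by rewrite /well; move: h3; set X := x ^+ 2; clear => h3; nra.
    have h : r <= 2 * d by clear -rx xs r0 x0; nra.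
    by clear -h h4 dm d0; lra.
  have h4 : 0 <= well x by rewrite /well sqr_ge0.
  have h : r <= 8 / 7 * d by clear -rx x7 r0 x0; nra.
  by clear -h h4 d0; lra.
have x2 : 0 <= x ^+ 2 by exact: sqr_ge0.
have xx : x ^+ 4 <= 185 / 100 * x ^+ 2.
  have h : x ^+ 2 <= 185 / 100 by clear -x1 x0; nra.
  by rewrite -[x ^+ 4]/(x ^+ (2 * 2)) exprM; move: h x2; set X := x ^+ 2; clear => *; nra.
have mlo' : 15 / 100 * x ^+ 2 - 2 * d + r / 2 <= 1 - (well x + 2 * d - 1 / 2 * r).
  by rewrite /well; clear -xx; lra.
split=> //.
- have [xs|xs] := leP (30 * (100 * x)) 1.
    have h : 30 * (100 * d) <= r by clear -rx xs r0 x0; nra.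
    by clear -h mlo' d0 x2; lra.
  have h : 1 <= 30 * (100 * (30 * (100 * x ^+ 2))) by clear -xs x0; nra.
  by clear -h mlo' d0 dm r0; lra.
- have [xs|xs] := leP x (1 / 4).
    have h : 4 * d <= r by clear -rx xs r0 x0; nra.
    by clear -h mlo' x2; lra.
  have h : 1 / 16 <= x ^+ 2 by clear -xs; nra.
  by clear -h mlo' dm r0; lra.
Qed.

Lemma core_facts x p : 0 < d -> d <= dmax R -> core d x p ->
  [/\ 0 < x, 0 < p ^+ 2 - 1 < 1, 1 < p < 3 / 2, 100 * (100 * (10 * d)) <= p ^+ 2 - 1 &
  [/\ 2 * d <= x * (p ^+ 2 - 1), x <= 1 / 2 -> 2 / 3 <= p ^+ 2 - 1,
      1000 * d <= mu_of p, x ^+ 2 / 10 <= mu_of p & mu_of p < 1]] /\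
  d / 4 <= (p ^+ 2 - 1) ^+ 2.
Proof.
move=> d0 d1 cr; have [r [rx r13 x0 lo hi]] := core_ratio d0 cr.
have dm := dmax_mul d1; have [/andP[x3 x1] p1 _] := cr.
have hx : 3 * d <= x <= 34 / 25 by rewrite x3 x1.
have [nud' small' m1000' mx'] := gap_facts d0 d1 hx rx r13.
have nu0 : 0 < p ^+ 2 - 1 by clear -p1; nra.
have mE : mu_of p = 1 - (p ^+ 2 - 1) ^+ 2 by rewrite /mu_of; ring.
set nu := p ^+ 2 - 1 in nu0 lo hi mE *.
have small : x <= 1 / 2 -> 2 / 3 <= nu.
  move=> /small' h; apply: le_sqr; first exact: ltW.
  by clear -h lo; lra.
have nud : d / 4 <= nu ^+ 2 by exact: le_trans lo.
(* By squaring: 10^10 d^2 <= d / 100 since 10^12 d <= 1, whereas nu^2 >= d / 4. *)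
have dn : 100 * (100 * (10 * d)) <= nu.
  apply: le_sqr; first exact: ltW.
  have : d * (100 * (100 * (100 * (100 * (100 * (100 * d)))))) <= d * 1 by rewrite ler_wpM2l // ltW.
  rewrite mulr1 expr2; clear -nud d0 => h; lra.
have m1000 : 1000 * d <= mu_of p by rewrite mE; apply: le_trans m1000' _; rewrite lerD2l lerN2.
have mx : x ^+ 2 / 10 <= mu_of p by rewrite mE; apply: le_trans mx' _; rewrite lerD2l lerN2.
have nu1 : nu < 1 by rewrite ltNge; apply/negP => h; clear -h mE m1000 d0; nra.
have p32 : p < 3 / 2 by rewrite ltNge; apply/negP => h; move: nu1; rewrite /nu; clear -h; nra.
have xnu : 2 * d <= x * nu.
  have [xs|xs] := leP x (1 / 2); first by have := small xs; clear -x3 x0 => h; nra.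
  by clear -xs dn d0 nu0; nra.
split=> //; split=> //; first by rewrite nu0 nu1.
- by rewrite p1 p32.
- by split=> //; rewrite mE; clear -nu0; nra.
Qed.
End Core.

(** * Secant coefficients of the steady-state equations *)

Section Rows.
Variable R : realType.
Implicit Types (d x p e y : R).

(** With u = p - e and mu = [mu_of p], e times this is -mu u + 2 u^3 - u^5: the reaction term with
    its root at the plateau divided out. *)
Definition stiff p e : R := (p - e) * (2 * p - e) * (2 * p ^+ 2 - 2 - 2 * p * e + e ^+ 2).

(** Divided differences of [stiff], obtained by changing its three factors one after the other;
    [stiff_p] collects the change of p, [stiff_e] that of e. *)
Definition stiff_p p' e' p e : R :=
  (2 * p' - e') * (2 * p' ^+ 2 - 2 - 2 * p' * e' + e' ^+ 2)
  + 2 * (p - e) * (2 * p' ^+ 2 - 2 - 2 * p' * e' + e' ^+ 2)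
  + (p - e) * (2 * p - e) * (2 * (p + p') - 2 * e).

Definition stiff_e p' e' p e : R :=
  - ((2 * p' - e') * (2 * p' ^+ 2 - 2 - 2 * p' * e' + e' ^+ 2))
  - (p - e) * (2 * p' ^+ 2 - 2 - 2 * p' * e' + e' ^+ 2)
  + (p - e) * (2 * p - e) * (e + e' - 2 * p').

Lemma stiff_sub p' e' p e :
  stiff p' e' - stiff p e = stiff_p p' e' p e * (p' - p) + stiff_e p' e' p e * (e' - e).
Proof. by rewrite /stiff /stiff_p /stiff_e; ring. Qed.

Definition ydiag d p' y' y : R := mu_of p' + 2 * d - 2 * (y' ^+ 2 + y' * y + y ^+ 2)
  + (y' ^+ 4 + y' ^+ 3 * y + y' ^+ 2 * y ^+ 2 + y' * y ^+ 3 + y ^+ 4).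

(** Divided difference in p of x' well p, plus d from the right neighbour p - e. In [px], the
    coefficient of a change of x, it reappears because the unknown is p - x: a change of x also
    moves p. *)
Definition pdiag d x' p' p : R := x' * (p + p') * ((p ^+ 2 - 1) + (p' ^+ 2 - 1)) + d.

Definition px d x' p' x p : R := pdiag d x' p' p + well p - 2 * d
  - (x' ^+ 4 + x' ^+ 3 * x + x' ^+ 2 * x ^+ 2 + x' * x ^+ 3 + x ^+ 4
     - 2 * (x' ^+ 2 + x' * x + x ^+ 2) + 1).

Lemma stiff_bounds d p' e' : 1 < p' < 3 / 2 -> p' ^+ 2 - 1 < 1 -> 0 < d ->
  100 * (100 * (10 * d)) <= p' ^+ 2 - 1 -> `|e'| <= 12 * d ->
  [/\ 9 / 10 <= p' - e' <= 16 / 10, 19 / 10 <= 2 * p' - e' <= 31 / 10 &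
    19 / 10 * (p' ^+ 2 - 1) <= 2 * p' ^+ 2 - 2 - 2 * p' * e' + e' ^+ 2 <= 25 / 10].
Proof.
rewrite ler_norml => /andP[p1 p2] nu1 d0 hd /andP[e1 e2].
have pe : `|p' * e'| <= 3 / 2 * (12 * d).
  by apply: norm_mul_le; rewrite ler_norml; clear -p1 p2 e1 e2; apply/andP; split; lra.
move: pe; rewrite ler_norml => /andP[pe1 pe2].
have ee : e' ^+ 2 <= 1 / 10 by clear -e1 e2 hd nu1; nra.
have ee0 := sqr_ge0 e'.
by split; apply/andP; split; clear -p1 p2 e1 e2 pe1 pe2 hd nu1 d0 ee ee0; lra.
Qed.

Lemma stiff_row d p' e' p e : 1 < p' < 3 / 2 -> p' ^+ 2 - 1 < 1 ->
  1 < p < 3 / 2 -> p ^+ 2 - 1 < 1 -> 0 < d ->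
  100 * (100 * (10 * d)) <= p' ^+ 2 - 1 -> 100 * (100 * (10 * d)) <= p ^+ 2 - 1 ->
  `|e'| <= 12 * d -> `|e| <= 12 * d ->
  [/\ (p' ^+ 2 - 1) / 2 <= stiff p' e' + 2 * d + e * stiff_e p' e' p e <= 100,
      `|e * stiff_p p' e' p e| <= 1000 * (1 * d) & p' ^+ 2 - 1 <= stiff p' e'].
Proof.
move=> hp' nu1' hp nu1 d0 hd' hd he' he.
have [/andP[a1 a2] /andP[a3 a4] /andP[a5 a6]] := stiff_bounds hp' nu1' d0 hd' he'.
have [/andP[b1 b2] /andP[b3 b4] /andP[b5 b6]] := stiff_bounds hp nu1 d0 hd he.
have nu0' : 0 < p' ^+ 2 - 1 by clear -d0 hd'; lra.
move: hp' hp => /andP[p1' p2'] /andP[p1 p2].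
have /andP[e1' e2'] : - (12 * d) <= e' <= 12 * d by rewrite -ler_norml.
have /andP[e1 e2] : - (12 * d) <= e <= 12 * d by rewrite -ler_norml.
set k3' := 2 * p' ^+ 2 - 2 - 2 * p' * e' + e' ^+ 2 in a5 a6 *.
set k2' := 2 * p' - e' in a3 a4 *; set k1' := p' - e' in a1 a2 *.
set k2 := 2 * p - e in b3 b4 *; set k1 := p - e in b1 b2 *.
set nu' := p' ^+ 2 - 1 in nu0' nu1' hd' a5 *.
have N1 : `|k2' * k3'| <= 31 / 10 * (25 / 10).
  by apply: norm_mul_le; rewrite ger0_norm //; clear -a3 a5 nu0'; lra.
have N2 : `|k1 * k3'| <= 16 / 10 * (25 / 10).
  by apply: norm_mul_le; rewrite ger0_norm //; clear -b1 a5 nu0'; lra.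
have N3 : `|k1 * k2| <= 16 / 10 * (31 / 10).
  by apply: norm_mul_le; rewrite ger0_norm //; clear -b1 b3; lra.
have N4 : `|k1 * k2 * (2 * (p + p') - 2 * e)| <= 16 / 10 * (31 / 10) * 7.
  apply: norm_mul_le => //; rewrite ler_norml.
  by clear -p1 p2 p1' p2' e1 e2 hd' nu1' d0; apply/andP; split; lra.
have N5 : `|k1 * k2 * (e + e' - 2 * p')| <= 16 / 10 * (31 / 10) * 7.
  apply: norm_mul_le => //; rewrite ler_norml.
  by clear -p1 p2 p1' p2' e1 e2 e1' e2' hd' nu1' d0; apply/andP; split; lra.
have Sp : `|stiff_p p' e' p e| <= 75.
  rewrite /stiff_p -/k3' -/k2' -/k1 -/k2 -mulrA; move: N1 N2 N4; rewrite !ler_norml.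
  by clear => /andP[? ?] /andP[? ?] /andP[? ?]; apply/andP; split; lra.
have Se : `|stiff_e p' e' p e| <= 75.
  rewrite /stiff_e -/k3' -/k2' -/k1 -/k2; move: N1 N2 N5; rewrite !ler_norml.
  by clear => /andP[? ?] /andP[? ?] /andP[? ?]; apply/andP; split; lra.
have Kp := norm_mul_le he Sp; have := norm_mul_le he Se.
rewrite ler_norml => /andP[s1 s2].
have st : nu' <= stiff p' e'.
  rewrite /stiff -/k3' -/k2' -/k1'.
  have h1 : 1 <= k1' * k2' by clear -a1 a3; nra.
  by clear -h1 a5 nu0'; nra.
have st2 : stiff p' e' <= 16 / 10 * (31 / 10) * (25 / 10).
  rewrite /stiff -/k3' -/k2' -/k1'; apply: ler_pM => //; last apply: ler_pM => //.
  - by clear -a1 a3; nra.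
  - by clear -a5 nu0'; lra.
  - by clear -a1; lra.
  - by clear -a3; lra.
split=> //; first by apply/andP; split; clear -s1 s2 st st2 hd' nu1' d0; lra.
by apply: le_trans Kp _; clear -d0; lra.
Qed.

(** The own coefficient is comparable to mu, and since |y| <= x' / 32 the coupling to p is O(x').
    Hence the weight x' / mu on the zero side. *)
Lemma y_row d x' p' y' y p : 0 < x' -> x' <= 34 / 25 -> x' ^+ 2 / 10 <= mu_of p' ->
  mu_of p' < 1 -> 1000 * d <= mu_of p' -> 0 < d ->
  1 < p' < 3 / 2 -> 1 < p < 3 / 2 -> 0 < p' ^+ 2 - 1 < 1 -> 0 < p ^+ 2 - 1 < 1 ->
  `|y'| <= x' / 32 -> `|y| <= x' / 32 ->
  9 / 10 * mu_of p' <= ydiag d p' y' y <= 10 /\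
  `|y * (p + p') * ((p ^+ 2 - 1) + (p' ^+ 2 - 1))| <= 3 / 16 * x'.
Proof.
move=> x0 x1 mx m1 md d0 /andP[p1' p2'] /andP[p1 p2] /andP[n0' n1'] /andP[n0 n1] hy' hy.
split; last first.
  rewrite (_ : 3 / 16 * x' = x' / 32 * 3 * 2); last by field.
  apply: norm_mul_le; last by rewrite ger0_norm; clear -n0 n0' n1 n1'; lra.
  by apply: norm_mul_le => //; rewrite ger0_norm; clear -p1 p1' p2 p2'; lra.
have a2 := norm_mul_le hy' hy'; have b2 := norm_mul_le hy' hy; have c2 := norm_mul_le hy hy.
have q1 := norm_mul_le a2 a2; have q2 := norm_mul_le a2 b2; have q3 := norm_mul_le a2 c2.
have q4 := norm_mul_le b2 c2; have q5 := norm_mul_le c2 c2.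
have x2 : (x' / 32) * (x' / 32) <= mu_of p' / 100 by clear -mx; nra.
set X := (x' / 32) * (x' / 32) in a2 b2 c2 q1 q2 q3 q4 q5 x2.
have X0 : 0 <= X by rewrite /X mulr_ge0 // divr_ge0 // ltW.
have XX : X * X <= X / 100 by clear -x2 m1 X0; nra.
rewrite /ydiag; move: a2 b2 c2 q1 q2 q3 q4 q5; rewrite !ler_norml.
move=> /andP[? ?] /andP[? ?] /andP[? ?] /andP[? ?] /andP[? ?] /andP[? ?] /andP[? ?] /andP[? ?].
clear hy' hy p1' p2' p1 p2 n0' n1' n0 n1 x0 x1 mx.
by apply/andP; split; lra.
Qed.

(** The third bound lets the active row absorb a zero-side neighbour of weight x' / mu. For x' <=
    1/2 the plateau is far from the saddle-node; for larger x' it is mu that is bounded below. *)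
Lemma p_row d x' p' x p : 0 < d -> 0 < x -> x <= x' -> x' <= 34 / 25 ->
  1 < p' < 3 / 2 -> 1 < p < 3 / 2 -> 0 < p' ^+ 2 - 1 < 1 -> 0 < p ^+ 2 - 1 < 1 ->
  2 * d <= x' * (p' ^+ 2 - 1) -> (x' <= 1 / 2 -> 2 / 3 <= p' ^+ 2 - 1) ->
  1000 * d <= mu_of p' -> x' ^+ 2 / 10 <= mu_of p' -> 100 * (100 * (10 * d)) <= p' ^+ 2 - 1 ->
  [/\ d <= pdiag d x' p' p <= 20, d <= pdiag d x' p' p / 4,
      d * (x' / mu_of p') <= pdiag d x' p' p / 20 & `|px d x' p' x p| <= 100].
Proof.
move=> d0 x0 xx x1 /andP[p1' p2'] /andP[p1 p2] /andP[n0' n1'] /andP[n0 n1] dx small md mx dn.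
have x0' : 0 < x' by apply: lt_le_trans xx.
have E : 2 * (x' * (p' ^+ 2 - 1)) + d <= pdiag d x' p' p.
  rewrite /pdiag; set nu' := p' ^+ 2 - 1 in n0' n1' *; set nu := p ^+ 2 - 1 in n0 n1 *.
  have h : 2 * (x' * nu') <= (p + p') * (x' * nu').
    by rewrite ler_wpM2r ?mulr_ge0 ?(ltW n0') ?(ltW x0') //; clear -p1 p1'; lra.
  have h2 : 0 <= x' * (p + p') * nu.
    by rewrite !mulr_ge0 ?(ltW n0) ?(ltW x0') //; clear -p1 p1'; lra.
  by clear -h h2; lra.
have U : pdiag d x' p' p <= 34 / 25 * 3 * 2 + d.
  rewrite /pdiag lerD2r; apply: ler_pM.
  - by rewrite mulr_ge0 ?(ltW x0') //; clear -p1 p1'; lra.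
  - by clear -n0 n0'; lra.
  - by apply: ler_pM => //; clear -x0' p1 p1' p2 p2'; lra.
  - by clear -n1 n1'; lra.
have m0 : 0 < mu_of p' by clear -md d0; lra.
split.
- by apply/andP; split; clear -E U dx d0 dn n1'; lra.
- by clear -E dx d0; lra.
- rewrite mulrA ler_pdivrMr //.
  have h : d <= (p' ^+ 2 - 1) / 10 * mu_of p'.
    have [/small h|h] := leP x' (1 / 2); first by clear -h md m0 d0; nra.
    have hm : 1 / 40 <= mu_of p' by clear -h mx; nra.
    by clear -hm dn n0' d0; nra.
  have h2 : d * x' <= x' * (p' ^+ 2 - 1) / 10 * mu_of p'.
    by rewrite mulrC -!mulrA ler_wpM2l ?(ltW x0') // mulrA.
  apply: le_trans h2 _; rewrite ler_wpM2r ?(ltW m0) //; clear -E d0; lra.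
have S0 : 0 <= pdiag d x' p' p.
  by clear -E dx d0; lra.
rewrite /px.
have X1 : `|x| <= 34 / 25 by rewrite ger0_norm ?(ltW x0) //; apply: le_trans x1.
have X1' : `|x'| <= 34 / 25 by rewrite ger0_norm ?(ltW x0').
have a2 := norm_mul_le X1' X1'; have b2 := norm_mul_le X1' X1; have c2 := norm_mul_le X1 X1.
have q1 := norm_mul_le a2 a2; have q2 := norm_mul_le a2 b2; have q3 := norm_mul_le a2 c2.
have q4 := norm_mul_le b2 c2; have q5 := norm_mul_le c2 c2.
have w1 : well p <= 1 by rewrite /well; clear -n0 n1; nra.
have w0 : 0 <= well p by rewrite /well sqr_ge0.
move: a2 b2 c2 q1 q2 q3 q4 q5; rewrite !ler_norml.
move=> /andP[? ?] /andP[? ?] /andP[? ?] /andP[? ?] /andP[? ?] /andP[? ?] /andP[? ?] /andP[? ?].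
clear X1 X1' p1' p2' p1 p2 n0 x0 x1 mx dx md small x0' xx m0.
by apply/andP; split; lra.
Qed.
End Rows.

(* A front with active site 0: [X (false, n)] is the value at the site [-n] of
   the zero side and [X (true, n)] the distance to the plateau value
   [plat X] = U_+(mu) of the value at the site [n]. *)
Notation cell := (bool * nat)%type.

Definition plat (R : realType) (X : cell -> R) : R := X (true, 0%N) + X (false, 0%N).

Section System.
Variables (R : realType) (dn up : nat -> nat) (d : R).
Implicit Types (X : cell -> R) (i : cell) (x : R).

(* The steady-state equations, except for the row of the free parameter
   [X (false, 0)]; the plateau sites have neighbours [dn] and [up]. *)
Definition front_eq X i : R :=
  match i with
  | (false, 0%N) => X (false, 0%N)
  | (false, n.+1) => let y := X (false, n.+1) in
      y * (mu_of (plat X) + 2 * d - 2 * y ^+ 2 + y ^+ 4) - d * (X (false, n) + X (false, n.+2))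
  | (true, 0%N) => let x := X (false, 0%N) in
      x * (well (plat X) - well x - 2 * d) + d * (plat X - X (true, 1%N) + X (false, 1%N))
  | (true, n.+1) => let e := X (true, n.+1) in
      e * (stiff (plat X) e + 2 * d) - d * (X (true, dn n.+1) + X (true, up n.+1))
  end.

Definition fdiag i X' X : R :=
  match i with
  | (false, 0%N) => 1
  | (false, n.+1) => ydiag d (plat X') (X' (false, n.+1)) (X (false, n.+1))
  | (true, 0%N) => pdiag d (X' (false, 0%N)) (plat X') (plat X)
  | (true, n.+1) => stiff (plat X') (X' (true, n.+1)) + 2 * d
      + X (true, n.+1) * stiff_e (plat X') (X' (true, n.+1)) (plat X) (X (true, n.+1))
  end.

Definition foff (r : 'I_4) i X' X : R :=
  match i with
  | (false, 0%N) => 0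
  | (false, n.+1) => if (r < 2)%N then - d else
      - (X (false, n.+1) * (plat X + plat X') * ((plat X ^+ 2 - 1) + (plat X' ^+ 2 - 1)))
  | (true, 0%N) => if r == 0%N :> nat then - d else if r == 1%N :> nat then d
      else if r == 2%N :> nat then 0
      else px d (X' (false, 0%N)) (plat X') (X (false, 0%N)) (plat X)
  | (true, n.+1) => if (r < 2)%N then - d else
      X (true, n.+1) * stiff_p (plat X') (X' (true, n.+1)) (plat X) (X (true, n.+1))
  end.

(** Slots 0 and 1 are the lattice neighbours, slots 2 and 3 the two unknowns whose sum is the
    plateau value, to which the rows are coupled. *)
Definition fnb (r : 'I_4) i : cell :=
  if r == 2%N :> nat then (true, 0%N) else if r == 3%N :> nat then (false, 0%N) else
  match i with
  | (false, 0%N) => (false, 0%N)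
  | (false, n.+1) => (false, if r == 0%N :> nat then n else n.+2)
  | (true, 0%N) => (r == 0%N :> nat, 1%N)
  | (true, n.+1) => (true, if r == 0%N :> nat then dn n.+1 else up n.+1)
  end.

(** 12 d = d (6 + 6): plateau neighbours deviate by at most 6 (p^2 - 1) and the own coefficient is
    at least p^2 - 1. On the zero side neighbours are at most x and the own coefficient exceeds 64
    d, whence 2 d x / (64 d) = x / 32. *)
Definition in_box x X : Prop :=
  [/\ X (false, 0%N) = x, core d x (plat X),
      forall n, `|X (true, n.+1)| <= 12 * d & forall n, `|X (false, n.+1)| <= x / 32].

(** The prescribed value needs a weight well below d, because it enters the active row with a
    coefficient of order 1 while the diagonal there may be as small as d. *)
Definition fweight (om : R) i : R :=
  match i with
  | (true, _) => 1
  | (false, 0%N) => d / 1000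
  | (false, _.+1) => om
  end.

Lemma lrow4 (c V : cell -> R) (a : 'I_4 -> cell -> R) i :
  lrow fnb c a V i = c i * V i + (a 0 i * V (fnb 0 i) + (a 1 i * V (fnb 1 i) +
    (a 2 i * V (fnb 2 i) + a 3 i * V (fnb 3 i)))).
Proof.
rewrite /lrow !big_ord_recl big_ord0 addr0.
rewrite (_ : lift ord0 (lift ord0 (lift ord0 ord0)) = 3); last exact/val_inj.
rewrite (_ : lift ord0 (lift ord0 ord0) = 2); last exact/val_inj.
by rewrite (_ : lift ord0 ord0 = 1); last exact/val_inj.
Qed.

Lemma front_eq_sub X' X i : front_eq X' i - front_eq X i =
  lrow fnb (fun i => fdiag i X' X) (fun r i => foff r i X' X) (fun i => X' i - X i) i.
Proof.
rewrite lrow4 /foff /fnb /=.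
case: i => [[] [|n]] /=.
- rewrite eqxx (_ : ((1 %% 4)%N == 0%N) = false) //.
  by rewrite /px /pdiag /well /plat; ring.
- have := stiff_sub (plat X') (X' (true, n.+1)) (plat X) (X (true, n.+1)).
  move/eqP; rewrite subr_eq => /eqP ->; rewrite /plat; ring.
- by ring.
- by rewrite /ydiag /mu_of /plat; ring.
Qed.

(** The order x <= x' allows everything on the zero side to be measured by x'. The factor 5 is the
    room needed to use one weight throughout a box. *)
Lemma front_dominated om x' x X' X : 0 < d -> d <= dmax R -> x <= x' ->
  in_box x' X' -> in_box x X ->
  x' / mu_of (plat X') <= om <= 5 * (x' / mu_of (plat X')) ->
  weight (d / 1000) (5 / d) (fweight om) /\
  dominated fnb (3 / 4) d (fun i => fdiag i X' X) (fun r i => foff r i X' X) (fweight om) /\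
  forall i, fdiag i X' X <= 100.
Proof.
move=> d0 d1 xx [E0' cr' he' hy'] [E0 cr he hy] /andP[om1 om5].
have d0' := d0; have dm := dmax_mul d1.
have [[x0' n01' p1' dn' [dx' small' m1000' mx' m1']] _] := core_facts d0 d1 cr'.
have [[x0 n01 p1 dn_ _] _] := core_facts d0 d1 cr.
have [/andP[x3' x1'] _ _] := cr'.
have m0 : 0 < mu_of (plat X') by clear -m1000' d0'; lra.
set w := fweight om.
set o1 := x' / mu_of (plat X') in om1 om5.
have mo : mu_of (plat X') * o1 = x' by rewrite /o1 mulrC divfK // gt_eqF.
have o1lo : d / 1000 <= o1.
  rewrite /o1 ler_pdivlMr //; clear -m0 m1' d0' x3'; nra.
have o1hi : o1 <= 1 / d.
  by rewrite /o1 ler_pdivrMr // mul1r mulrC ler_pdivlMr //; clear -m1000' x1' d0' x0'; nra.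
have o10 : 0 < o1 by rewrite divr_gt0.
have omlo : d / 1000 <= om by exact: le_trans om1.
have omhi : om <= 5 / d by clear -om5 o1hi; lra.
have d1' : d <= 1 by clear -dm d0'; lra.
have onehi : 1 <= 5 / d by rewrite ler_pdivlMr // mul1r; clear -d1'; lra.
have om0 : 0 < om by apply: lt_le_trans om1.
have hw : weight (d / 1000) (5 / d) w.
  have h1 : d / 1000 <= 1 <= 5 / d by apply/andP; split; clear -d1' d0' onehi; lra.
  have h2 : d / 1000 <= d / 1000 <= 5 / d by apply/andP; split; clear -omlo omhi; lra.
  have h3 : d / 1000 <= om <= 5 / d by rewrite omlo omhi.
  by case=> [[] [|n]]; [exact: h1|exact: h1|exact: h2|exact: h3].
have wn n : w (false, n) <= om by case: n => [|n]; [exact: omlo|exact: lexx].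
have wpos i : 0 <= w i.
  have /andP[h _] := hw i; apply: le_trans h; clear -d0'; lra.
split=> //.
have /andP[n0' n1'] := n01'; have /andP[n0 n1] := n01.
have ep0 : 0 <= d / 1000 by clear -d0'; lra.
have de0 : 1 + d / 1000 <= 2 by clear -d1' d0'; lra.
have main i : d <= fdiag i X' X <= 100 /\
    \sum_(r < 4) `|foff r i X' X| * w (fnb r i) <= 3 / 4 * fdiag i X' X * w i.
  rewrite !big_ord_recl big_ord0 addr0 /foff /fnb /=.
  case: i => [[] [|n]] /=.
  - rewrite E0' E0.
    have [/andP[P1 P2] P3 P4 P5] := p_row d0 x0 xx x1' p1' p1 n01' n01 dx' small' m1000' mx' dn'.
    split; first by apply/andP; split=> //; clear -P2; lra.
    rewrite normrN (gtr0_norm d0) normr0 mul0r !mulr1 add0r.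
    have P6 : `|px d x' (plat X') x (plat X)| * (d / 1000) <= 100 * (d / 1000).
      by apply: ler_wpM2r; [exact: ep0|exact: P5].
    move: P1 P3 P4 P6; set S := pdiag _ _ _ _; set Q := `|_| * (d / 1000).
    have P7 : d * om <= 5 * (d * o1) by rewrite mulrCA; apply: ler_wpM2l; [exact: ltW|exact: om5].
    move: P7; rewrite /o1 -/o1 -/w; set A := d * om; set B := d * o1.
    by clear -d0'; move=> *; lra.
  - have [/andP[S1 S2] S3 _] := stiff_row p1' n1' p1 n1 d0 dn' dn_ (he' n) (he n).
    split; first by apply/andP; split=> //; clear -S1 dn' d0'; lra.
    rewrite normrN (gtr0_norm d0) !mulr1.
    set Q := `|_| in S3 *; have Q1 : Q * (1 + d / 1000) <= 1000 * (1 * d) * 2.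
      by apply: ler_pM; [exact: normr_ge0|clear -d0'; lra|exact: S3|exact: de0].
    move: S1 S3 Q1; set S := stiff _ _ + _ + _.
    by clear -dn' d0'; move=> *; lra.
  - rewrite normr0 !mul0r !addr0 mulr1; split; first by rewrite d1' ler1n.
    by clear -d0'; lra.
  - have hyx : `|X (false, n.+1)| <= x' / 32.
      by apply: le_trans (hy n) _; clear -xx; lra.
    have [/andP[Y1 Y2] Y3] := y_row x0' x1' mx' m1' m1000' d0 p1' p1 n01' n01 (hy' n) hyx.
    split.
      by apply/andP; split; [clear -Y1 m1000' d0'; lra|clear -Y2; lra].
    rewrite normrN (gtr0_norm d0) normrN mulr1.
    have W1 : d * w (false, n) <= d * om by rewrite ler_wpM2l ?(ltW d0).
    have W3 : d * om <= mu_of (plat X') * om / 1000.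
      by rewrite mulrAC; apply: ler_wpM2r; [exact: ltW|clear -m1000'; lra].
    have W5 : x' <= mu_of (plat X') * om.
      by rewrite -{1}mo; apply: ler_wpM2l; [exact: ltW|exact: om1].
    set D := ydiag _ _ _ _ in Y1 Y2 *.
    have W4 : 9 / 10 * (mu_of (plat X') * om) <= D * om.
      by rewrite mulrA; apply: ler_wpM2r; [exact: ltW|exact: Y1].
    set Q := `|_| in Y3 *.
    have Q1 : Q * (1 + d / 1000) <= 3 / 16 * x' * 2.
      by apply: ler_pM; [exact: normr_ge0|clear -d0'; lra|exact: Y3|exact: de0].
    move: W1 W3 W4 W5 Q1; set M := _ * om; set A := d * w _; set B := d * om; set C := D * om.
    rewrite -[3 / 4 * D * om]mulrA -/C; clear -x0'.
    by move=> *; lra.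
split=> [i|i]; have [/andP[h1 h2] h3] := main i; last exact: h2.
by split; [exact: h1|exact: h3].
Qed.
End System.

(** * Existence and uniqueness of fronts *)

Section Solve.
Variable R : realType.
Implicit Types (d x p : R) (X : cell -> R) (dn up : nat -> nat).

Lemma well_mono p p' : 1 <= p -> p <= p' -> well p <= well p'.
Proof.
move=> p1 pp; rewrite /well; have h : p ^+ 2 <= p' ^+ 2 by rewrite lerXn2r ?nnegrE //; lra.
have h1 : 1 <= p ^+ 2 by rewrite expr2; clear -p1; nra.
by rewrite lerXn2r ?nnegrE //; clear -h h1; lra.
Qed.

Lemma well_root (A : R) : 0 < A < 1 -> exists p, [/\ 1 < p, p ^+ 2 < 2 & well p = A].
Proof.
move=> /andP[A0 A1]; have s0 : 0 < Num.sqrt A by rewrite sqrtr_gt0.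
have sA : Num.sqrt A ^+ 2 = A by rewrite sqr_sqrtr // ltW.
have s1 : Num.sqrt A < 1.
  by rewrite ltNge; apply/negP => h; move: sA; rewrite expr2 => sA; clear -h sA A1; nra.
have pE : Num.sqrt (1 + Num.sqrt A) ^+ 2 = 1 + Num.sqrt A by rewrite sqr_sqrtr //; clear -s0; lra.
exists (Num.sqrt (1 + Num.sqrt A)); split.
- rewrite ltNge; apply/negP => h; have h0 := sqrtr_ge0 (1 + Num.sqrt A).
  move: pE h h0; set p := Num.sqrt (1 + _); rewrite expr2 => pE h h0.
  by clear -pE h h0 s0; nra.
- by rewrite pE; clear -s1; lra.
- by rewrite /well pE [1 + _]addrC addrK.
Qed.

(** For x > 1/2 the core inequality gives |x^2 - 1| <= 3 (p^2 - 1), its O(d) terms being absorbed by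
    d / 4 <= (p^2 - 1)^2. *)
Lemma core_dist d x p : 0 < d -> d <= dmax R -> core d x p -> `|p - x| <= 6 * (p ^+ 2 - 1).
Proof.
move=> d0 d1 cr; have [[x0 /andP[n0 n1] /andP[p1 p2] dn [_ small _ _ _]] nud] := core_facts d0 d1 cr.
have [r [rx /andP[r0 r3] _ lo _]] := core_ratio d0 cr.
have [/andP[_ x1] _ _] := cr.
rewrite ler_norml; have [xs|xs] := leP x (1 / 2).
  by have := small xs; clear -p1 p2 x0 xs => h; apply/andP; split; lra.
have r2 : r <= 2 * d by clear -rx xs r0; nra.
have w : (x ^+ 2 - 1) ^+ 2 <= (3 * (p ^+ 2 - 1)) ^+ 2.
  move: lo; rewrite /well; set A := (x ^+ 2 - 1) ^+ 2; rewrite exprMn; set B := (_ - 1) ^+ 2 in nud *.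
  by clear -r2 nud d0 => lo; lra.
have pn : p - 1 <= p ^+ 2 - 1 by clear -p1; nra.
have n3 : 0 <= 3 * (p ^+ 2 - 1) by clear -n0; lra.
have [h|h] := leP x 1.
  have := le_sqr n3 (_ : (1 - x ^+ 2) ^+ 2 <= _); rewrite -sqrrN opprB => /(_ w) k.
  by clear -k h x0 pn n0 p1; apply/andP; split; nra.
have := le_sqr n3 w => k.
by clear -k h x0 pn n0 p1; apply/andP; split; nra.
Qed.

Lemma in_box_e d x X n : 0 < d -> d <= dmax R -> in_box d x X ->
  `|X (true, n)| <= 6 * (plat X ^+ 2 - 1).
Proof.
move=> d0 d1 [y0 cr he _]; case: n => [|n].
  by have := core_dist d0 d1 cr; rewrite /plat -y0 addrK.
apply: le_trans (he n) _; have [[_ _ _ dn _] _] := core_facts d0 d1 cr.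
by clear -dn d0; lra.
Qed.

Lemma in_box_y d x X n : 0 < d -> d <= dmax R -> in_box d x X -> `|X (false, n)| <= x.
Proof.
move=> d0 d1 [y0 cr _ hy]; have [[x0 _ _ _ _] _] := core_facts d0 d1 cr.
case: n => [|n]; first by rewrite y0 gtr0_norm.
by apply: le_trans (hy n) _; clear -x0; lra.
Qed.

Lemma in_box_bound d x X i : 0 < d -> d <= dmax R -> in_box d x X -> `|X i| <= 6.
Proof.
move=> d0 d1 bX; have [_ cr _ _] := bX.
have [[_ /andP[_ n1] _ _ _] _] := core_facts d0 d1 cr; have [/andP[_ x1] _ _] := cr.
case: i => [[] n].
  by apply: le_trans (in_box_e n d0 d1 bX) _; clear -n1; lra.
by apply: le_trans (in_box_y n d0 d1 bX) _; clear -x1; lra.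
Qed.

Definition param (x : R) (i : cell) : R := if i is (false, 0%N) then x else 0.

Definition is_front dn up d x X := in_box d x X /\ forall i, front_eq dn up d X i = param x i.

Lemma stiff_lower d x X n : 0 < d -> d <= dmax R -> in_box d x X ->
  plat X ^+ 2 - 1 <= stiff (plat X) (X (true, n.+1)).
Proof.
move=> d0 d1 [_ cr he _].
have [[_ /andP[n0 n1] p1 dn _] _] := core_facts d0 d1 cr.
by have [_ _] := stiff_row p1 n1 p1 n1 d0 dn dn (he n) (he n).
Qed.

Lemma ycoef_lower d x X n : 0 < d -> d <= dmax R -> in_box d x X ->
  9 / 10 * mu_of (plat X) <=
  mu_of (plat X) + 2 * d - 2 * X (false, n.+1) ^+ 2 + X (false, n.+1) ^+ 4.
Proof.
move=> d0 d1 [_ cr _ hy].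
have [[x0 _ _ _ [_ _ _ mx _]] _] := core_facts d0 d1 cr.
have h := norm_mul_le (hy n) (hy n).
have h4 : 0 <= X (false, n.+1) ^+ 4 by rewrite -[_ ^+ 4]/(_ ^+ (2 * 2)) exprM sqr_ge0.
have h2 : X (false, n.+1) ^+ 2 <= x / 32 * (x / 32) by rewrite expr2; apply: le_trans (ler_norm _) h.
have x2 := sqr_ge0 x; by clear -h4 h2 mx d0 x2; lra.
Qed.

(** [box_zero], with p confined between the two values at which the core inequality becomes an
    equality. On every face the own term outweighs the largest contribution that the neighbours can
    make. *)
Lemma front_exists dn up d x : 0 < d -> d <= dmax R -> 3 * d <= x <= 34 / 25 ->
  exists X, is_front dn up d x X.
Proof.
move=> d0 d1 hx; have /andP[x3 x1] := hx.
have dm := dmax_mul d1.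
have x0 : 0 < x by clear -x3 d0; lra.
pose r := d / x; have rx : r * x = d by rewrite /r divfK // gt_eqF.
have r13 : 0 < r <= 1 / 3 by rewrite divr_gt0 //= ler_pdivrMr //; clear -x3; lra.
have /andP[r0 r3] := r13.
clearbody r.
have [gl gs gm gx] := gap_facts d0 d1 hx rx r13.
set lo2 := well x + 2 * d - 3 / 2 * r in gl gs; set hi2 := well x + 2 * d - 1 / 2 * r in gm gx.
have lohi2 : lo2 + r = hi2 by rewrite /lo2 /hi2; lra.
have e1 : x * (lo2 - well x - 2 * d) = - (3 / 2) * d by rewrite /lo2 -[in RHS]rx; ring.
have e2 : x * (hi2 - well x - 2 * d) = - (1 / 2) * d by rewrite /hi2 -[in RHS]rx; ring.
pose m := 1 - hi2.
have m0 : 0 < m by rewrite /m; clear -gm d0; lra.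
(* Over the box mu varies in [m, m + r], hence in [m, 5 m], which makes x / m an admissible
   zero-side weight for all its points. *)
have rm : r <= 4 * m.
  have [xs|xs] := leP (1 / 100) x.
    have : r <= 100 * d by clear -rx xs r0; nra.
    by rewrite /m; clear -gm d0 => h; lra.
  have h1 : 100 * d <= r by clear -rx xs r0; nra.
  have h3 : x ^+ 2 <= 1 by clear -x0 xs; nra.
  have h2 : well x <= 1.
    by rewrite /well; move: h3 (sqr_ge0 x); set X2 := x ^+ 2; clear => *; nra.
  by rewrite /m /hi2; clear -h1 h2 r0; lra.
have [|plo [plo1 plo2 plow]] := @well_root lo2.
  by move: gl m0; rewrite /m; clear -lohi2 d0 r0 => gl m0; apply/andP; split; lra.
have [|phi [phi1 phi2 phiw]] := @well_root hi2.
  by move: gl m0; rewrite /m; clear -lohi2 d0 r0 => gl m0; apply/andP; split; lra.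
have plohi : plo <= phi.
  rewrite leNgt; apply/negP => h.
  by have := well_mono (ltW phi1) (ltW h); rewrite plow phiw; clear -lohi2 r0 => h'; lra.
pose lo (i : cell) := match i with
  | (true, 0%N) => plo - x | (true, _) => - (12 * d) | (false, 0%N) => x | (false, _) => - (x / 32) end.
pose hi (i : cell) := match i with
  | (true, 0%N) => phi - x | (true, _) => 12 * d | (false, 0%N) => x | (false, _) => x / 32 end.
pose box X := forall i, lo i <= X i <= hi i.
have boxin X : box X -> in_box d x X.
  move=> bX; have y0 : X (false, 0%N) = x by apply/eqP; rewrite eq_sym eq_le; exact: (bX (false, 0%N)).
  have /andP[p1 p2] : plo <= plat X <= phi.
    by have /andP[] := bX (true, 0%N); rewrite /plat y0 /=; clear => ? ?; apply/andP; split; lra.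
  have P1 : 1 < plat X by apply: lt_le_trans p1.
  split=> //.
  - split=> //.
    have := well_mono (ltW plo1) p1; have := well_mono (ltW P1) p2; rewrite plow phiw => w2 w1.
    rewrite -e1 -e2; apply/andP; split; apply: ler_wpM2l; rewrite ?(ltW x0) //.
      by clear -w1; lra.
    by clear -w2; lra.
  - by move=> n; rewrite ler_norml; exact: (bX (true, n.+1)).
  - by move=> n; rewrite ler_norml; exact: (bX (false, n.+1)).
have mub X : in_box d x X -> m <= mu_of (plat X) <= m + r.
  move=> [_ cr _ _]; have [r' [rx' _ _ l h]] := core_ratio d0 cr.
  have E : r' = r by apply: (mulIf (lt0r_neq0 x0)); rewrite rx rx'.
  rewrite /m -lohi2 (_ : mu_of _ = 1 - (plat X ^+ 2 - 1) ^+ 2); last by rewrite /mu_of; ring.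
  by move: l h; rewrite E /lo2; set nu2 := (_ - 1) ^+ 2; clear => l h; apply/andP; split; lra.
have d1000 : 0 < d / 1000 by clear -d0; lra.
have d5 : d <= 100 by clear -dm d0; lra.
have q34 : 0 <= (3 / 4 : R) < 1 by apply/andP; split; clear; lra.
pose f X i := front_eq dn up d X i - param x i.
have om_ok X : in_box d x X -> x / mu_of (plat X) <= x / m <= 5 * (x / mu_of (plat X)).
  move=> bX; have /andP[m1 m2] := mub X bX; have mu0 := lt_le_trans m0 m1.
  rewrite ler_pM2l // lef_pV2 ?posrE // m1 /= mulrCA ler_pM2l //.
  rewrite ler_pdivlMr // mulrC ler_pdivrMr //; clear -m2 rm; lra.
have [X0 [bX0 _]] : exists X, in_box d x X /\ True.
  exists (fun i => lo i); split=> //; apply: boxin => i; rewrite lexx /=.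
  by case: i => [[] [|n]] /=; clear -plohi d0 x0; lra.
have [|||||X bX X0'] := @box_zero R cell f lo hi (fweight d (x / m)) (3 / 4) d 100 (d / 1000) (5 / d)
   (phi - plo + 24 * d + x) q34 d0 d5 d1000.
- by have [h _] := front_dominated dn up d0 d1 (lexx x) bX0 bX0 (om_ok _ bX0).
- by case=> [[] [|n]] /=; clear -plohi d0 x0; lra.
- by case=> [[] [|n]] /=; clear -plohi d0 x0; lra.
- move=> X X' /boxin bX /boxin bX' i.
  have [_ [dom hc]] := front_dominated dn up d0 d1 (lexx x) bX' bX (om_ok _ bX').
  exists (fdiag d i X' X), (\sum_(r < 4) foff d r i X' X * (X' (fnb dn up r i) - X (fnb dn up r i))).
  have [c1 c2] := dom i; split.
  + by rewrite /f opprB addrA subrK front_eq_sub.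
  + by rewrite c1 hc.
  + move=> B B0 hB.
    apply: le_trans (sum_le_dominated (V := fun j => X' j - X j) (fnb dn up) (fun r i => foff d r i X' X) i B0 hB) _.
    apply: le_trans (ler_wpM2l B0 c2) _.
    by rewrite le_eqVlt; apply/orP; left; apply/eqP; ring.
- move=> X /boxin bX i; have [y0 cr he hy] := bX.
  have [[_ /andP[n0 n1] /andP[p1 p2] dn_ [_ _ m1000 _ _]] _] := core_facts d0 d1 cr.
  case: i => [[] [|n]] /=; rewrite /f /= ?subr0.
  + have h1 := he 0%N; have h2 := hy 0%N; move: h1 h2; rewrite !ler_norml => /andP[el eh] /andP[y1 y2].
    have P2 : plat X <= 142 / 100 by clear -n1 p1; nra.
    split=> E.
      have -> : plat X = phi by rewrite /plat E y0 subrK.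
      rewrite y0 phiw e2.
      have : 1 / 2 <= phi - X (true, 1%N) + X (false, 1%N) by clear -phi1 eh y1 x1 dm d0; lra.
      by move/(ler_wpM2l (ltW d0)); clear => h; lra.
    have PE : plat X = plo by rewrite /plat E y0 subrK.
    rewrite PE y0 plow e1.
    have : plo - X (true, 1%N) + X (false, 1%N) <= 3 / 2 by rewrite -PE; clear -P2 el y2 x1 dm d0; lra.
    by move/(ler_wpM2l (ltW d0)); clear => h; lra.
  + have S := stiff_lower n d0 d1 bX.
    have := in_box_e (dn n.+1) d0 d1 bX; have := in_box_e (up n.+1) d0 d1 bX.
    rewrite !ler_norml => /andP[a1 a2] /andP[b1 b2].
    have S2 : 12 * d * (plat X ^+ 2 - 1) <= 12 * d * (stiff (plat X) (X (true, n.+1)) + 2 * d).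
      by apply: ler_wpM2l; [clear -d0; lra|clear -S d0; lra].
    have A1 := ler_wpM2l (ltW d0) a1; have A2 := ler_wpM2l (ltW d0) a2.
    have B1 := ler_wpM2l (ltW d0) b1; have B2 := ler_wpM2l (ltW d0) b2.
    by split=> {1}->; clear -S2 A1 A2 B1 B2; lra.
  + by split=> ->; rewrite subrr.
  + have S := ycoef_lower n d0 d1 bX.
    have := in_box_y n d0 d1 bX; have := in_box_y n.+2 d0 d1 bX.
    rewrite !ler_norml => /andP[a1 a2] /andP[b1 b2].
    set c := mu_of _ + _ - _ + _ in S *.
    have S2 : x / 32 * (64 * d) <= x / 32 * c.
      by apply: ler_wpM2l; [clear -x0; lra|clear -S m1000 d0; lra].
    have A1 := ler_wpM2l (ltW d0) a1; have A2 := ler_wpM2l (ltW d0) a2.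
    have B1 := ler_wpM2l (ltW d0) b1; have B2 := ler_wpM2l (ltW d0) b2.
    by split=> {1}->; clear -S2 A1 A2 B1 B2; lra.
exists X; split; first exact: boxin.
by move=> i; have := X0' i; rewrite /f => /eqP; rewrite subr_eq0 => /eqP.
Qed.

Lemma front_lip dn up d x x' X X' : 0 < d -> d <= dmax R -> x <= x' ->
  is_front dn up d x X -> is_front dn up d x' X' ->
  forall i, `|X' i - X i| <= `|5 / d| / (d * (d / 1000)) / (1 - 3 / 4) * (x' - x).
Proof.
move=> d0 d1 xx [bX eX] [bX' eX'].
have d1000 : 0 < d / 1000 by clear -d0; lra.
have q34 : 0 <= (3 / 4 : R) < 1 by apply/andP; split; clear; lra.
have [_ cr' _ _] := bX'; have [[x0 _ _ _ [_ _ m1 _ _]] _] := core_facts d0 d1 cr'.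
have om_ok : x' / mu_of (plat X') <= x' / mu_of (plat X') <= 5 * (x' / mu_of (plat X')).
  have : 0 < x' / mu_of (plat X') by rewrite divr_gt0 //; clear -m1 d0; lra.
  by clear => h; apply/andP; split; lra.
have [hw [dom _]] := front_dominated dn up d0 d1 xx bX' bX om_ok.
apply: (dominated_le q34 d0 d1000 hw dom (K := 12)).
- move=> i; have := in_box_bound i d0 d1 bX; have := in_box_bound i d0 d1 bX'.
  by move=> h1 h2; apply: le_trans (ler_normB _ _) _; clear -h1 h2; lra.
- by rewrite subr_ge0.
move=> i; rewrite -front_eq_sub eX eX'; case: i => [[] [|n]] /=; rewrite ?subrr ?normr0 ?subr_ge0 //.
by rewrite ger0_norm // subr_ge0.
Qed.

Lemma front_unique dn up d x X X' : 0 < d -> d <= dmax R ->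
  is_front dn up d x X -> is_front dn up d x X' -> X = X'.
Proof.
move=> d0 d1 fX fX'; apply/funext => i; apply/esym/eqP; rewrite -subr_eq0 -normr_le0.
by apply: le_trans (front_lip d0 d1 (lexx x) fX fX' i) _; rewrite subrr mulr0.
Qed.
End Solve.

(** * Smooth dependence of fronts on the active value *)

Ltac uc_step := lazymatch goal with
  | |- uc ?k ?D (fun j s => @?f j s + @?g j s) => apply: (@uc_add _ D k _ f g)
  | |- uc ?k ?D (fun j s => @?f j s * @?g j s) => apply: (@uc_mul _ D k _ f g)
  | |- uc ?k ?D (fun j s => - @?f j s) => apply: (@uc_opp _ D k _ f)
  | |- uc ?k ?D (fun j s => @?f j s ^+ ?n) => apply: (@uc_exp _ D k n _ f)
  | |- uc ?k ?D (fun j s => ?c) => apply: (@uc_cst _ D k _ c)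
  end.

Section FrontUC.
Variables (R : realType) (d : R) (D : set R).

(** The definitions by cases on cells have four branches; each can be treated as a polynomial family
    of its own. *)
Lemma uc_cell k (J : Type) (f : J * cell -> R -> R) :
  uc k D (fun j s => f (j, (true, 0%N)) s) ->
  uc k D (fun (jn : J * nat) s => f (jn.1, (true, jn.2.+1)) s) ->
  uc k D (fun j s => f (j, (false, 0%N)) s) ->
  uc k D (fun (jn : J * nat) s => f (jn.1, (false, jn.2.+1)) s) -> uc k D f.
Proof.
move=> h1 h2 h3 h4.
pose n1 (ji : J * cell) := (ji.1, ji.2.2.-1).
have g1 := uc_reindex (fun ji : J * cell => ji.1) h1.
have g2 := uc_reindex n1 h2.
have g3 := uc_reindex (fun ji : J * cell => ji.1) h3.
have g4 := uc_reindex n1 h4.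
have t1 := uc_if (fun ji : J * cell => ji.2.2 == 0%N) g1 g2.
have t2 := uc_if (fun ji : J * cell => ji.2.2 == 0%N) g3 g4.
apply: uc_ext (uc_if (fun ji : J * cell => ji.2.1) t1 t2) => // -[j [[] [|n]]] s _ //=.
Qed.

Section Closure.
Variables (k : nat) (J : Type) (F' F : J * cell -> R -> R).
Hypotheses (hF' : uc k D F') (hF : uc k D F).

Lemma fdiag_uc : uc k D (fun (ji : J * cell) s =>
  fdiag d ji.2 (fun l => F' (ji.1, l) s) (fun l => F (ji.1, l) s)).
Proof.
pose c0 (b : bool) (j : J) : J * cell := (j, (b, 0%N)).
pose c1 (b : bool) (jn : J * nat) : J * cell := (jn.1, (b, 0%N)).
pose c2 (b : bool) (jn : J * nat) : J * cell := (jn.1, (b, jn.2.+1)).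
apply: uc_cell; rewrite /= /ydiag /pdiag /stiff /stiff_e /mu_of /plat;
  repeat uc_step;
  first [exact: (uc_reindex (c0 true) hF) | exact: (uc_reindex (c0 false) hF)
    | exact: (uc_reindex (c0 true) hF') | exact: (uc_reindex (c0 false) hF')
    | exact: (uc_reindex (c1 true) hF) | exact: (uc_reindex (c1 false) hF)
    | exact: (uc_reindex (c1 true) hF') | exact: (uc_reindex (c1 false) hF')
    | exact: (uc_reindex (c2 true) hF) | exact: (uc_reindex (c2 false) hF)
    | exact: (uc_reindex (c2 true) hF') | exact: (uc_reindex (c2 false) hF') ].
Qed.

Lemma foff_uc r : uc k D (fun (ji : J * cell) s =>
  foff d r ji.2 (fun l => F' (ji.1, l) s) (fun l => F (ji.1, l) s)).
Proof.
pose c0 (b : bool) (j : J) : J * cell := (j, (b, 0%N)).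
pose c1 (b : bool) (jn : J * nat) : J * cell := (jn.1, (b, 0%N)).
pose c2 (b : bool) (jn : J * nat) : J * cell := (jn.1, (b, jn.2.+1)).
apply: uc_cell; case: r => -[|[|[|[|//]]]] hr;
  rewrite /= /px /pdiag /well /stiff_p /plat /=;
  repeat uc_step;
  first [exact: (uc_reindex (c0 true) hF) | exact: (uc_reindex (c0 false) hF)
    | exact: (uc_reindex (c0 true) hF') | exact: (uc_reindex (c0 false) hF')
    | exact: (uc_reindex (c1 true) hF) | exact: (uc_reindex (c1 false) hF)
    | exact: (uc_reindex (c1 true) hF') | exact: (uc_reindex (c1 false) hF')
    | exact: (uc_reindex (c2 true) hF) | exact: (uc_reindex (c2 false) hF)
    | exact: (uc_reindex (c2 true) hF') | exact: (uc_reindex (c2 false) hF') ].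
Qed.
End Closure.
End FrontUC.

Definition xdom (R : realType) (d : R) : set R := `[3 * d, 34 / 25]%classic.

Lemma xdomP (R : realType) (d x : R) : xdom d x <-> 3 * d <= x <= 34 / 25.
Proof. by rewrite /xdom /= in_itv. Qed.

(** [T] indexes the neighbour structures, so all constants are uniform in the distance to the centre
    of symmetry. *)
Lemma front_uc (R : realType) (d : R) (T : Type) (dn up : T -> nat -> nat) (X : T -> R -> cell -> R) :
  0 < d -> d <= dmax R -> (forall t x, xdom d x -> is_front (dn t) (up t) d x (X t x)) ->
  forall k, uc k (xdom d) (fun (ti : T * cell) x => X ti.1 x ti.2).
Proof.
move=> d0 d1 hX k.
pose Y (ti : T * cell) x := X ti.1 x ti.2.
pose sg (r : 'I_4) (ti : T * cell) : T * cell := (ti.1, fnb (dn ti.1) (up ti.1) r ti.2).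
pose c (ti : T * cell) (G' G : T * cell -> R) :=
  fdiag d ti.2 (fun l => G' (ti.1, l)) (fun l => G (ti.1, l)).
pose a (rti : 'I_4 * (T * cell)) (G' G : T * cell -> R) :=
  foff d rti.1 rti.2.2 (fun l => G' (rti.2.1, l)) (fun l => G (rti.2.1, l)).
have d1000 : 0 < d / 1000 by clear -d0; lra.
have q34 : 0 <= (3 / 4 : R) < 1 by apply/andP; split; clear; lra.
have Yb i s : xdom d s -> `|Y i s| <= 6.
  by move=> Ds; have [bX _] := hX i.1 s Ds; exact: in_box_bound d0 d1 bX.
have omok t x : xdom d x -> let o := x / mu_of (plat (X t x)) in o <= o <= 5 * o.
  move=> Ds; have [[_ cr _ _] _] := hX t x Ds.
  have [[x0 _ _ _ [_ _ m1 _ _]] _] := core_facts d0 d1 cr.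
  have : 0 < x / mu_of (plat (X t x)) by rewrite divr_gt0 //; clear -m1 d0; lra.
  by move=> /= h; clear -h; apply/andP; split; lra.
have dom4 s t' t : xdom d s -> xdom d t' -> s <= t' ->
  let om := t' / mu_of (plat (X t t')) in
  weight (d / 1000) (5 / d) (fweight d om) /\
  dominated (fnb (dn t) (up t)) (3 / 4) d (fun i => fdiag d i (X t t') (X t s))
    (fun r i => foff d r i (X t t') (X t s)) (fweight d om) /\
  forall i, fdiag d i (X t t') (X t s) <= 100.
  move=> Ds Dt st om; have [b1 _] := hX t s Ds; have [b2 _] := hX t t' Dt.
  exact: front_dominated d0 d1 st b2 b1 (omok t t' Dt).
apply: (@uc_nonlinear R (T * cell) 4 sg (xdom d) (3 / 4) d (d / 1000) (5 / d) q34 d0 d1000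
   Y (fun ti => if ti.2 is (false, 0%N) then 1 else 0) 100 6 c a k) => //.
- by move=> [t [[] [|n]]] /=; rewrite ?normr0 ?normr1.
- move=> s t Ds Dt st [u i]; have [_ e1] := hX u s Ds; have [_ e2] := hX u t Dt.
  have := front_eq_sub (dn u) (up u) d (X u t) (X u s) i; rewrite e1 e2.
  rewrite /lrow /= => <-; case: i => [[] [|n]] /=; rewrite ?subrr ?mulr0 ?mulr1 //.
- move=> s t Ds Dt st.
  exists (fun ti => fweight d (t / mu_of (plat (X ti.1 t))) ti.2).
    by move=> [u i]; have [h _] := dom4 s t u Ds Dt st; exact: h.
  by move=> [u i]; have [_ [h _]] := dom4 s t u Ds Dt st; exact: h.
- by move=> s [u i] Ds; have [_ [_ h]] := dom4 s s u Ds Ds (lexx s); exact: h.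
- move=> Yl.
  pose J : Type := T * {x : R | xdom d x}.
  pose mv (ji : J * cell) x := Y (ji.1.1, ji.2) x.
  pose fx (ji : J * cell) (x : R) := Y (ji.1.1, ji.2) (sval ji.1.2).
  have mvl : uc 0 (xdom d) mv by exact: (uc_reindex (k := 0) (fun ji : J * cell => (ji.1.1, ji.2)) Yl).
  have fxl : uc 0 (xdom d) fx.
    by apply: (@uc_const _ _ 0 _ _ 6) => -[[t [x Dx]] i]; exact: Yb.
  have [C1 C10 [_ h1]] := fdiag_uc d mvl fxl; have [C2 C20 [_ h2]] := fdiag_uc d fxl mvl.
  have [C3 C30 [_ h3]] := uc_ord (fun r => foff_uc d mvl fxl r).
  have [C4 C40 [_ h4]] := uc_ord (fun r => foff_uc d fxl mvl r).
  exists (C1 + C2 + C3 + C4); first by rewrite !addr_ge0.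
  move=> s t Ds Dt; split=> [[u i]|r [u i]].
    have k1 := h1 ((u, exist _ s Ds), i) s t Ds Dt; have k2 := h2 ((u, exist _ s Ds), i) s t Ds Dt.
    split; [apply: le_trans k1 _|apply: le_trans k2 _]; apply: ler_wpM2r => //;
      clear -C10 C20 C30 C40; lra.
  have k3 := h3 (r, ((u, exist _ s Ds), i)) s t Ds Dt; have k4 := h4 (r, ((u, exist _ s Ds), i)) s t Ds Dt.
  split; [apply: le_trans k3 _|apply: le_trans k4 _]; apply: ler_wpM2r => //;
    clear -C10 C20 C30 C40; lra.
- by move=> k' Yk; exact: (fdiag_uc d Yk Yk).
- by move=> k' r Yk; exact: (foff_uc d Yk Yk r).
Qed.

(** * Decay and positivity of fronts *)

(** A bound B on the values beyond n0 improves to |W n0| / 4 + B / 4, whose fixed point is |W n0| /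
    3. *)
Lemma decay_abs (R : realType) (W : nat -> R) (dn up : nat -> nat) (n0 : nat) (B0 : R) :
  (forall k, `|W k| <= B0) ->
  (forall k, (n0 < k)%N -> (n0 <= dn k)%N /\ (n0 <= up k)%N) ->
  (forall k, (n0 < k)%N -> `|W k| <= 1 / 8 * (`|W (dn k)| + `|W (up k)|)) ->
  forall k, (n0 < k)%N -> `|W k| <= `|W n0| / 3.
Proof.
move=> hB nb h k k0.
pose V k := if (n0 < k)%N then W k else 0.
have q01 : 0 <= (1 / 4 : R) < 1 by apply/andP; split; lra.
have A0 : 0 <= `|W n0| / 4 by rewrite divr_ge0.
have hV j : `|V j| <= B0.
  rewrite /V; case: ifP => // _; rewrite normr0; exact: le_trans (normr_ge0 _) (hB 0%N).
have := @self_improving R nat V _ _ B0 q01 A0 hV _ k.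
rewrite /V k0 => key; rewrite (_ : `|W n0| / 3 = `|W n0| / 4 / (1 - 1 / 4)); last by field.
apply: key.
move=> B Bge hVB j; case: ifP => j0; last first.
  by rewrite normr0; clear -A0 Bge; lra.
have low i : (n0 <= i)%N -> `|W i| <= `|W n0| + B.
  rewrite leq_eqVlt => /orP[/eqP <-|ni]; first by rewrite lerDl.
  have := hVB i; rewrite /V ni => h1; apply: le_trans h1 _.
  by rewrite lerDr.
have [n1 n2] := nb j j0; have h1 := low _ n1; have h2 := low _ n2; have h3 := h j j0.
by clear -h1 h2 h3; lra.
Qed.

(** The negative part of W obeys [decay_abs] and vanishes at 0, hence everywhere. *)
Lemma decay_ge0 (R : realType) (W : nat -> R) (dn up : nat -> nat) (B0 : R) :
  (forall k, `|W k| <= B0) -> 0 <= W 0%N ->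
  (forall k, exists2 c, 8 <= c & c * W k.+1 = W (dn k.+1) + W (up k.+1)) ->
  forall k, 0 <= W k.
Proof.
move=> hB W0 h [//|k].
pose V j := Num.max 0 (- W j).
have V0 j : 0 <= V j by rewrite le_max lexx.
have VW j : - W j <= V j by rewrite le_max lexx orbT.
have VB j : `|V j| <= B0.
  rewrite ger0_norm // ge_max (le_trans (normr_ge0 _) (hB j)) /=.
  by apply: le_trans (hB j); rewrite -normrN ler_norm.
have := @decay_abs R V dn up 0%N B0 VB _ _ k.+1 isT.
have -> : V 0%N = 0 by rewrite /V; apply/max_idPl; rewrite oppr_le0.
rewrite normr0 mul0r => key.
have : `|V k.+1| <= 0.
  apply: key => // j; case: j => // j _.
  have [c c8 hc] := h j.
  rewrite !ger0_norm // {1}/V ge_max; apply/andP; split.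
    by rewrite mulr_ge0 ?addr_ge0.
  have [Wj|Wj] := leP 0 (W j.+1).
    by apply: le_trans (_ : 0 <= _); [rewrite oppr_le0|rewrite mulr_ge0 ?addr_ge0].
  have h1 : c * W j.+1 <= 8 * W j.+1 by rewrite ler_nM2r.
  have h2 := VW (dn j.+1); have h3 := VW (up j.+1).
  by rewrite hc in h1; clear -h1 h2 h3; lra.
rewrite ger0_norm // => h0; have := VW k.+1; clear -h0 => h1; lra.
Qed.

(** [None]: a plateau without end. [Some (k, L)]: a plateau whose sites beyond index L are mirror
    images. *)
Definition cfg := option (site * nat).

(** Indices above L are dummies that satisfy the equation of site L; they keep one index type for
    all plateau lengths. *)
Definition dnb (c : cfg) (n : nat) : nat :=
  if c is Some (_, L) then (minn n L).-1 else n.-1.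

(** Since w_n = (U_(n-1), U_n), an on-site orbit has two equal central values of U, so site L is its
    own right neighbour; for an off-site orbit U is symmetric about site L. *)
Definition upb (c : cfg) (n : nat) : nat :=
  match c with
  | None => n.+1
  | Some (k, L) => if (n < L)%N then n.+1 else if k is OnSite then L else L.-1
  end.

(** Indices n such that no index beyond n has a neighbour below n, as decay starting from n
    requires. *)
Definition reach (c : cfg) (n : nat) : bool := if c is Some (_, L) then (n < L)%N else true.

Lemma reach_nb c n0 k : reach c n0 -> (n0 < k)%N -> (n0 <= dnb c k)%N /\ (n0 <= upb c k)%N.
Proof.
case: c => [[s L]|] /=; last by move=> _; lia.
by case: s => h1 h2; case: ifP => h3; split; lia.
Qed.

Lemma dnb_lt c k : (0 < k)%N -> (dnb c k < k)%N.
Proof. by case: c => [[s L]|] /=; lia. Qed.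

Definition front (R : realType) (d : R) (c : cfg) (x : R) (X : cell -> R) : Prop :=
  [/\ 0 < d, d <= dmax R & is_front (dnb c) (upb c) d x X].

Section FrontProps.
Variable R : realType.
Implicit Types (d x : R) (c : cfg) (X : cell -> R).


Lemma front_e_ratio d c x X (F : front d c x X) k : exists2 a, 8 <= a &
  a * X (true, k.+1) = X (true, dnb c k.+1) + X (true, upb c k.+1).
Proof.
have [d0 d1 fX] := F.
have [bX eX]   := fX; have S := stiff_lower k d0 d1 bX.
have [_ cr _ _] := bX; have [[_ _ _ dn_ _] _] := core_facts d0 d1 cr.
exists ((stiff (plat X) (X (true, k.+1)) + 2 * d) / d).
  by rewrite ler_pdivlMr //; clear -S dn_ d0; lra.
have /eqP := eX (true, k.+1); rewrite /= subr_eq0 => /eqP E.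
by apply: (mulfI (lt0r_neq0 d0)); rewrite -E [_ / d]mulrC !mulrA divff ?lt0r_neq0 // mul1r mulrC.
Qed.

Lemma front_y_ratio d c x X (F : front d c x X) k : exists2 a, 900 <= a &
  a * X (false, k.+1) = X (false, k) + X (false, k.+2).
Proof.
have [d0 d1 fX] := F.
have [bX eX]   := fX; have S := ycoef_lower k d0 d1 bX.
have [_ cr _ _] := bX; have [[_ _ _ _ [_ _ m1 _ _]] _] := core_facts d0 d1 cr.
exists ((mu_of (plat X) + 2 * d - 2 * X (false, k.+1) ^+ 2 + X (false, k.+1) ^+ 4) / d).
  by rewrite ler_pdivlMr //; clear -S m1 d0; lra.
have /eqP := eX (false, k.+1); rewrite /= subr_eq0 => /eqP E.
by apply: (mulfI (lt0r_neq0 d0)); rewrite -E [_ / d]mulrC !mulrA divff ?lt0r_neq0 // mul1r mulrC.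
Qed.

Lemma front_e_decay d c x X (F : front d c x X) n k : reach c n -> (n < k)%N ->
  `|X (true, k)| <= `|X (true, n)| / 3.
Proof.
have [d0 d1 fX] := F.
move=> rn; have [bX _] := fX.
apply: (@decay_abs R (fun k => X (true, k)) (dnb c) (upb c) n 6).
- by move=> j; exact: in_box_bound d0 d1 bX.
- by move=> j; exact: reach_nb.
- move=> [//|j] _; have [a a8 E] := front_e_ratio F j.
  have : `|a * X (true, j.+1)| <= `|X (true, dnb c j.+1)| + `|X (true, upb c j.+1)|.
    by rewrite E ler_normD.
  rewrite normrM ger0_norm; last by clear -a8; lra.
  have : 8 * `|X (true, j.+1)| <= a * `|X (true, j.+1)| by rewrite ler_wpM2r.
  by clear => *; lra.
Qed.

Lemma front_y_decay d c x X (F : front d c x X) n k : (n < k)%N ->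
  `|X (false, k)| <= `|X (false, n)| / 3.
Proof.
have [d0 d1 fX] := F.
have [bX _] := fX.
apply: (@decay_abs R (fun k => X (false, k)) (fun k => k.-1) S n 6).
- by move=> j; exact: in_box_bound d0 d1 bX.
- by move=> j; lia.
- move=> [//|j] _; have [a a8 E] := front_y_ratio F j.
  have : `|a * X (false, j.+1)| <= `|X (false, j)| + `|X (false, j.+2)|.
    by rewrite E ler_normD.
  rewrite normrM ger0_norm; last by clear -a8; lra.
  have : 8 * `|X (false, j.+1)| <= a * `|X (false, j.+1)|.
    by rewrite ler_wpM2r //; clear -a8; lra.
  by clear => *; lra.
Qed.

Definition nbsum X : R := plat X - X (true, 1%N) + X (false, 1%N).

Lemma front_center d c x X (F : front d c x X) : x * (well (plat X) - well x - 2 * d) = - (d * nbsum X).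
Proof.
have [d0 d1 fX] := F.
have [[y0 _ _ _] eX] := fX; have := eX (true, 0%N); rewrite /= y0 -/(nbsum X).
by move/eqP; rewrite addr_eq0 => /eqP.
Qed.

Lemma front_nbsum d c x X (F : front d c x X) : 9 / 10 <= nbsum X <= 147 / 100 /\ plat X ^+ 2 < 2.
Proof.
have [d0 d1 fX] := F.
have dm := dmax_mul d1; have [[y0 cr he hy] _] := fX.
have [[_ /andP[_ n1] /andP[p1 _] _ _] _] := core_facts d0 d1 cr; have [/andP[_ x1] _ _] := cr.
have := he 0%N; have := hy 0%N; rewrite !ler_norml => /andP[a1 a2] /andP[b1 b2].
have n2 : plat X ^+ 2 < 2 by clear -n1; lra.
have p2 : plat X <= 1415 / 1000 by clear -n2 p1; nra.
by split=> //; rewrite /nbsum; clear -p1 p2 a1 a2 b1 b2 x1 d0 dm; apply/andP; split; lra.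
Qed.

(** If x were at least p > 1, then x (well p - well x - 2 d) <= -2 d x <= -2 d, yet it equals -d
    times a neighbour sum below 3/2. *)
Lemma front_e0_gt0 d c x X (F : front d c x X) : 0 < X (true, 0%N).
Proof.
have [d0 d1 fX] := F.
have [/andP[c1 c2] _] := front_nbsum F; have E := front_center F.
have [[y0 cr _ _] _] := fX; have [[x0 _ /andP[p1 _] _ _] _] := core_facts d0 d1 cr.
have -> : X (true, 0%N) = plat X - x by rewrite /plat y0 addrK.
rewrite subr_gt0 ltNge; apply/negP => h.
have w := well_mono (ltW p1) h; have x1 := lt_le_trans p1 h.
have h1 : x * (well (plat X) - well x - 2 * d) <= x * (- 2 * d).
  by rewrite ler_wpM2l ?(ltW x0) //; clear -w; lra.
have h2 : d * nbsum X <= d * (147 / 100) by rewrite ler_wpM2l // ltW.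
have h3 : d * 1 <= d * x by rewrite ler_wpM2l // ltW.
by rewrite E in h1; clear -h1 h2 h3 d0; lra.
Qed.

Lemma front_e_gt0 d c x X (F : front d c x X) n : 0 < X (true, n).
Proof.
have [d0 d1 fX] := F.
have [bX _] := fX.
have ge k : 0 <= X (true, k).
  apply: (@decay_ge0 R (fun k => X (true, k)) (dnb c) (upb c) 6).
  - by move=> j; exact: in_box_bound d0 d1 bX.
  - exact: ltW (front_e0_gt0 F).
  - exact: front_e_ratio F.
elim/ltn_ind: n => -[_|n IH]; first exact: front_e0_gt0 F.
have [a a8 E] := front_e_ratio F n.
have : 0 < a * X (true, n.+1).
  by rewrite E; apply: ltr_pwDl; [apply: IH; exact: dnb_lt|exact: ge].
by rewrite pmulr_rgt0 //; clear -a8; lra.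
Qed.

Lemma front_y_gt0 d c x X (F : front d c x X) n : 0 < X (false, n).
Proof.
have [d0 d1 fX] := F.
have [bX _] := fX; have [y0 cr _ _] := bX; have [[x0 _ _ _ _] _] := core_facts d0 d1 cr.
have ge k : 0 <= X (false, k).
  apply: (@decay_ge0 R (fun k => X (false, k)) (fun k => k.-1) S 6).
  - by move=> j; exact: in_box_bound d0 d1 bX.
  - by rewrite y0 ltW.
  - by move=> j; have [a a8 E] := front_y_ratio F j; exists a => //; clear -a8; lra.
elim: n => [|n IH]; first by rewrite y0.
have [a a8 E] := front_y_ratio F n.
have : 0 < a * X (false, n.+1) by rewrite E; apply: ltr_pwDl.
by rewrite pmulr_rgt0 //; clear -a8; lra.
Qed.

Lemma front_e_lt d c x X (F : front d c x X) n k : reach c n -> (n < k)%N -> X (true, k) <= X (true, n) / 3.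
Proof.
have [d0 d1 fX] := F.
move=> rn nk; have := front_e_decay F rn nk.
by rewrite !gtr0_norm // (front_e_gt0 F).
Qed.

Lemma front_y_lt d c x X (F : front d c x X) n k : (n < k)%N -> X (false, k) <= X (false, n) / 3.
Proof.
by move=> nk; have := front_y_decay F nk; rewrite !gtr0_norm // (front_y_gt0 F).
Qed.

Lemma front_e_geom d c x X (F : front d c x X) n :
  (forall m, (m < n)%N -> reach c m) -> X (true, n) <= 6 * 3^-1 ^+ n.
Proof.
have [d0 d1 [bX _]] := F.
elim: n => [_|n IH hr].
  by have := in_box_bound (true, 0%N) d0 d1 bX; rewrite expr0 mulr1; apply: le_trans; exact: ler_norm.
have := IH (fun m mn => hr m (ltnW mn)); have := front_e_lt F (hr n (ltnSn n)) (ltnSn n).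
by rewrite exprS; set z := _ ^+ n; clear => *; lra.
Qed.
End FrontProps.

(** * Monotonicity and junctions of fronts *)

Section FrontCurve.
Variable R : realType.
Implicit Types (d x : R) (c : cfg) (X : cell -> R).

Lemma well_le1 x : 0 <= x -> x <= 1 -> well x <= 1.
Proof.
move=> x0 x1; have : x ^+ 2 <= 1 by clear -x0 x1; nra.
by rewrite /well; move: (sqr_ge0 x); set Y := x ^+ 2; clear => *; nra.
Qed.

Definition next_site X : R := plat X - X (true, 1%N).

Lemma front_core d c x X : front d c x X -> core d x (plat X).
Proof. by move=> [_ _ [[]]]. Qed.

Lemma front_x d c x X : front d c x X -> X (false, 0%N) = x.
Proof. by move=> [_ _ [[]]]. Qed.

Lemma front_he d c x X : front d c x X -> forall n, `|X (true, n.+1)| <= 12 * d.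
Proof. by move=> [_ _ [[]]]. Qed.

Lemma front_hy d c x X : front d c x X -> forall n, `|X (false, n.+1)| <= x / 32.
Proof. by move=> [_ _ [[]]]. Qed.

Lemma front_row d c x X x' X' i : front d c x X -> front d c x' X' ->
  fdiag d i X' X * (X' i - X i) = param x' i - param x i -
    \sum_(r < 4) foff d r i X' X * (X' (fnb (dnb c) (upb c) r i) - X (fnb (dnb c) (upb c) r i)).
Proof.
move=> [_ _ [_ eX]] [_ _ [_ eX']].
have := front_eq_sub (dnb c) (upb c) d X' X i; rewrite eX eX' /lrow => ->.
by rewrite addrK.
Qed.

(** For x = O(d) the active row reads roughly 1 - well p = d p / x, so p responds to x at a rate of
    order 1 / d. The remaining unknowns change by at most 1/50 of |P| + h, and the next site follows
    p. *)
Lemma next_site_incr d c x x' X X' : 3 * d <= x -> x <= x' -> x' <= 5 * d ->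
  front d c x X -> front d c x' X' -> x' - x <= next_site X' - next_site X.
Proof.
move=> x3 xx x5 F F'; have [d0 d1 [bX eX]] := F; have [_ _ [bX' eX']] := F'.
have dm := dmax_mul d1.
have cr := front_core F; have cr' := front_core F'.
have [[x0 n01 p1 dn [_ small m1000 _ _]] _] := core_facts d0 d1 cr.
have [[x0' n01' p1' dn' [dx' small' m1000' mx' m1']] _] := core_facts d0 d1 cr'.
have [/andP[_ xhi'] _ _] := cr'.
have /andP[n0 n1] := n01; have /andP[n0' n1'] := n01'.
pose h := x' - x; pose P := plat X' - plat X.
have h0 : 0 <= h by rewrite subr_ge0.
have xE := front_x F; have xE' := front_x F'.
have dE0 : X' (true, 0%N) - X (true, 0%N) = P - h.
  by rewrite /P /h /plat xE xE'; ring.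
pose A := `|P| + h.
have A0 : 0 <= A by rewrite addr_ge0.
have bnd i : `|X' i - X i| <= 12.
  have a := in_box_bound i d0 d1 bX; have b := in_box_bound i d0 d1 bX'.
  by apply: le_trans (ler_normB _ _) _; clear -a b; lra.
have q12 : 0 <= (1 / 2 : R) < 1 by apply/andP; split; clear; lra.
have nu23 : 2 / 3 <= plat X' ^+ 2 - 1 by apply: small'; clear -x5 dm d0; lra.
have he n : `|X' (true, n.+1) - X (true, n.+1)| <= A / 50.
  have := @self_improving R nat (fun n => X' (true, n.+1) - X (true, n.+1)) (A / 100) (1 / 2) 12 q12 _ _ _ n.
  rewrite (_ : A / 100 / (1 - 1 / 2) = A / 50); last by field.
  apply=> [|j|B B0 hB j]; [by clear -A0; lra|exact: bnd|].
  have low k : `|X' (true, k) - X (true, k)| <= A + B.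
    case: k => [|k]; last by apply: le_trans (hB k) _; clear -A0; lra.
    by rewrite dE0; apply: le_trans (ler_normB _ _) _; rewrite (ger0_norm h0) /A; clear -B0; lra.
  have := front_row (true, j.+1) F F'.
  rewrite !big_ord_recl big_ord0 addr0 /foff /fnb /= !sub0r.
  have [/andP[S1 _] S3 _] := stiff_row p1' n1' p1 n1 d0 dn' dn (front_he F' j) (front_he F j).
  set D := _ + _ * stiff_e _ _ _ _ in S1 *; set a := _ * stiff_p _ _ _ _ in S3 *.
  move=> E; have {}E : D * (X' (true, j.+1) - X (true, j.+1)) =
      d * ((X' (true, dnb c j.+1) - X (true, dnb c j.+1)) + (X' (true, upb c j.+1) - X (true, upb c j.+1))) - a * P.
    by rewrite E /P /plat; ring.
  have e1 : `|D * (X' (true, j.+1) - X (true, j.+1))| <= d * (2 * (A + B)) + 1000 * (1 * d) * `|P|.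
    rewrite E; apply: le_trans (ler_normB _ _) _; apply: lerD; last exact: norm_mul_le.
    apply: norm_mul_le; first by rewrite gtr0_norm.
    by apply: le_trans (ler_normD _ _) _; apply: le_trans (lerD (low _) (low _)) _; clear; lra.
  have D3 : 1 / 3 <= D by clear -S1 nu23; lra.
  have D0 : 0 <= D by clear -D3; lra.
  rewrite normrM (ger0_norm D0) in e1.
  set z := `|X' _ - X _| in e1 *.
  have z1 : 1 / 3 * z <= D * z by rewrite ler_wpM2r // /z.
  have P1 : `|P| <= A by rewrite /A lerDl.
  have e2 : d * (A + B) <= 1 / 1000 * (A + B).
    by apply: ler_wpM2r; [exact: addr_ge0|clear -dm d0; lra].
  have e3 : 1000 * (1 * d) * `|P| <= 1 / 1000 * A.
    by apply: ler_pM; [clear -d0; lra|exact: normr_ge0|clear -dm d0; lra|exact: P1].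
  by clear -e1 z1 e2 e3 A0 B0; lra.
have hy n : `|X' (false, n.+1) - X (false, n.+1)| <= A / 50.
  have := @self_improving R nat (fun n => X' (false, n.+1) - X (false, n.+1)) (A / 100) (1 / 2) 12 q12 _ _ _ n.
  rewrite (_ : A / 100 / (1 - 1 / 2) = A / 50); last by field.
  apply=> [|j|B B0 hB j]; [by clear -A0; lra|exact: bnd|].
  have low k : `|X' (false, k) - X (false, k)| <= A + B.
    case: k => [|k]; last by apply: le_trans (hB k) _; clear -A0; lra.
    by rewrite xE xE' (ger0_norm h0) /A; have := normr_ge0 P; clear -B0 => ?; lra.
  have := front_row (false, j.+1) F F'.
  rewrite !big_ord_recl big_ord0 addr0 /foff /fnb /= !sub0r.
  have hyx : `|X (false, j.+1)| <= x' / 32.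
    by apply: le_trans (front_hy F j) _; clear -xx; lra.
  have [/andP[S1 _] S3] := y_row x0' xhi' mx' m1' m1000' d0 p1' p1 n01' n01 (front_hy F' j) hyx.
  set D := ydiag _ _ _ _ in S1 *; set a := _ * _ * _ in S3 *.
  move=> E; have {}E : D * (X' (false, j.+1) - X (false, j.+1)) =
      d * ((X' (false, j) - X (false, j)) + (X' (false, j.+2) - X (false, j.+2))) + a * P.
    by rewrite E /P /plat; ring.
  have e1 : `|D * (X' (false, j.+1) - X (false, j.+1))| <= d * (2 * (A + B)) + 3 / 16 * x' * `|P|.
    rewrite E; apply: le_trans (ler_normD _ _) _; apply: lerD; last exact: norm_mul_le.
    apply: norm_mul_le; first by rewrite gtr0_norm.
    by apply: le_trans (ler_normD _ _) _; apply: le_trans (lerD (low _) (low _)) _; clear; lra.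
  have D3 : 900 * d <= D by clear -S1 m1000'; lra.
  have D0 : 0 <= D by clear -D3 d0; lra.
  rewrite normrM (ger0_norm D0) in e1.
  set z := `|X' _ - X _| in e1 *.
  have z1 : 900 * d * z <= D * z by rewrite ler_wpM2r // /z.
  have P1 : `|P| <= A by rewrite /A lerDl.
  have e3 : 3 / 16 * x' * `|P| <= d * A.
    by apply: ler_pM; [clear -x0'; lra|exact: normr_ge0|clear -x5 x0'; lra|exact: P1].
  have : d * (900 * z) <= d * (2 * (A + B) + A) by clear -e1 z1 e3; lra.
  by rewrite ler_pM2l // => e4; clear -e4 A0 B0; lra.
have := front_row (true, 0%N) F F'.
rewrite !big_ord_recl big_ord0 addr0 /foff /fnb /= xE xE' dE0 -/h.
have [/andP[S1 S2] _ _ _] := p_row d0 x0 xx xhi' p1' p1 n01' n01 dx' small' m1000' mx' dn'.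
have S31 : pdiag d x' (plat X') (plat X) <= 31 * d.
  rewrite /pdiag; have : x' * (plat X + plat X') * ((plat X ^+ 2 - 1) + (plat X' ^+ 2 - 1)) <= 5 * d * 3 * 2.
    move: p1 p1' => /andP[q1 q2] /andP[q1' q2'].
    apply: ler_pM; [by apply: mulr_ge0; [exact: ltW|clear -q1 q1'; lra]|by clear -n0 n0'; lra| |by clear -n1 n1'; lra].
    by apply: ler_pM; [exact: ltW|clear -q1 q1'; lra|exact: x5|clear -q2 q2'; lra].
  by clear => h; lra.
(* The main term is -r / 2 <= -1/10, as r = d / x >= 1/5 for x <= 5 d. *)
have Q : px d x' (plat X') x (plat X) - pdiag d x' (plat X') (plat X) <= - (9 / 100).
  have [r [rx _ _ _ hi]] := core_ratio d0 cr.
  have r5 : 1 / 5 <= r by clear -rx x5 xx x0 d0; nra.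
  have wx : well x <= 1 by apply: well_le1; [exact: ltW|clear -xx x5 dm d0; lra].
  have sm (u v : R) : 0 <= u -> 0 <= v -> u <= 5 * d -> v <= 5 * d -> 0 <= u * v <= 1 / 1000.
    move=> u0 v0 u5 v5; apply/andP; split; first exact: mulr_ge0.
    by clear -u0 v0 u5 v5 dm d0; nra.
  have /andP[xx2 xx2'] := sm x' x' (ltW x0') (ltW x0') x5 x5.
  have x5' : x <= 5 * d by exact: le_trans x5.
  have /andP[xy2 xy2'] := sm x' x (ltW x0') (ltW x0) x5 x5'.
  have /andP[yy2 yy2'] := sm x x (ltW x0) (ltW x0) x5' x5'.
  have q4 : 0 <= x' ^+ 4 + x' ^+ 3 * x + x' ^+ 2 * x ^+ 2 + x' * x ^+ 3 + x ^+ 4.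
    by rewrite !addr_ge0 // ?mulr_ge0 ?exprn_ge0 // ltW.
  rewrite /px; move: hi; rewrite -/(well (plat X)); set W := well (plat X) => hi.
  set q := x' ^+ 4 + _ + _ + _ + _ in q4 *; set S := pdiag _ _ _ _.
  by clear -hi r5 wx q4 xx2' xy2' yy2' d0 dm; lra.
set S := pdiag d x' (plat X') (plat X) in S1 S2 S31 Q *.
set px0 := px _ _ _ _ _ in Q *.
rewrite subrr => E.
have e1 := he 0%N; have y1 := hy 0%N.
set E1 := X' (true, 1%N) - X (true, 1%N) in E e1 *.
have {}E : S * P = d * E1 - d * (X' (false, 1%N) - X (false, 1%N)) - (px0 - S) * h.
  by have := E; clear; lra.
set Y1 := X' (false, 1%N) - X (false, 1%N) in E y1.
have l1 : S * P >= 9 / 100 * h - d * (A / 25).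
  have a1 : - (d * (A / 50)) <= d * E1.
    by rewrite -mulrN ler_wpM2l ?(ltW d0) //; move: e1; rewrite ler_norml => /andP[].
  have a2 : d * Y1 <= d * (A / 50).
    by rewrite ler_wpM2l ?(ltW d0) //; move: y1; rewrite ler_norml => /andP[].
  have a3 : (px0 - S) * h <= - (9 / 100) * h by rewrite ler_wpM2r.
  by rewrite E; clear -a1 a2 a3; lra.
have -> : next_site X' - next_site X = P - E1 by rewrite /next_site /P /E1; ring.
(* P <= 0 turns out to be possible only for h = 0 and P = 0. *)
have [P0|P0] := leP P 0.
  have PA : A = - P + h by rewrite /A ler0_norm.
  have h5 : 0 <= (S - d) * (- P) by rewrite mulr_ge0 ?subr_ge0 // oppr_ge0.
  have h6 : d * h <= 1 / 1000 * h by apply: ler_wpM2r; [exact: h0|clear -dm d0; lra].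
  have h7 : 0 <= d * - P by rewrite mulr_ge0 ?(ltW d0) // oppr_ge0.
  rewrite PA in l1 e1; have hz : h <= 0 by clear -l1 h5 h6 h7; lra.
  have hz' : h = 0 by apply/eqP; rewrite eq_le hz h0.
  have PP : d * - P <= 0 by rewrite hz' in l1; clear -l1 h5 h7; lra.
  have PZ : P = 0.
    apply/eqP; rewrite eq_le P0 /= -oppr_le0.
    by rewrite -(pmulr_rle0 _ d0).
  move: e1; rewrite PZ hz' oppr0 addr0 mul0r normr_le0 => /eqP ->.
  by rewrite subr0.
have PA : A = P + h by rewrite /A gtr0_norm.
rewrite PA in l1 e1.
have h6 : d * h <= 1 / 1000 * h by apply: ler_wpM2r; [exact: h0|clear -dm d0; lra].
have h7 : S * P <= 31 * d * P by rewrite ler_wpM2r // ltW.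
have h8 : 100 * (100 * (d * P)) <= P by clear -dm d0 P0; nra.
have : 2 * h <= P by clear -l1 h6 h7 h8 h0 P0; lra.
move: e1; rewrite ler_norml -/h => /andP[_ e1]; clear -e1 h0 => h9; lra.
Qed.

(** 797/600 = 4/3 - 1/200. As d tends to 0 the row at x = 3 d becomes p^3 - 2 p + 1/3 = 0, with p
    about 1.32; at x = 4 d the constant is 1/4 and p about 1.35. The value 4/3 is therefore crossed
    in between, with margin 1/200 on either side. *)
Lemma next_site_3d d c X : front d c (3 * d) X -> next_site X <= 797 / 600.
Proof.
move=> F; have [d0 d1 _] := F; have dm := dmax_mul d1.
have cr := front_core F; have E := front_center F.
have [[x0 _ /andP[p1 _] _ _] _] := core_facts d0 d1 cr.
have := front_he F 0%N; have := front_hy F 0%N; rewrite !ler_norml => /andP[y1 y2] /andP[e1 e2].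
rewrite leNgt; apply/negP; rewrite /next_site => h.
have wp : 582 / 1000 <= well (plat X).
  rewrite /well; have : 1763 / 1000 <= plat X ^+ 2 by clear -h e1 dm d0; nra.
  by set Y := plat X ^+ 2; clear => ?; nra.
have wx : well (3 * d) <= 1 by apply: well_le1; clear -dm d0; lra.
have nb : 132 / 100 <= nbsum X by rewrite /nbsum; clear -h y1 dm d0; lra.
have : 3 * (well (plat X) - well (3 * d) - 2 * d) = - nbsum X.
  by apply: (mulfI (lt0r_neq0 d0)); rewrite mulrN -E; ring.
by clear -wp wx nb dm d0 => ?; lra.
Qed.

Lemma next_site_4d d c X : front d c (4 * d) X -> 803 / 600 <= next_site X.
Proof.
move=> F; have [d0 d1 _] := F; have dm := dmax_mul d1.
have cr := front_core F; have E := front_center F.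
have [[x0 _ /andP[p1 _] _ _] _] := core_facts d0 d1 cr.
have := front_he F 0%N; have := front_hy F 0%N; rewrite !ler_norml => /andP[y1 y2] /andP[e1 e2].
rewrite leNgt; apply/negP; rewrite /next_site => h.
have wp : well (plat X) <= 63 / 100.
  rewrite /well; have : plat X ^+ 2 <= 1792 / 1000 by clear -h e2 p1 dm d0; nra.
  by have : 1 <= plat X ^+ 2 by [clear -p1; nra]; set Y := plat X ^+ 2; clear => *; nra.
have wx : 99 / 100 <= well (4 * d).
  have x0' : 0 <= 4 * d by clear -d0; lra.
  have x1' : 4 * d <= 1 / 100 by clear -dm d0; lra.
  by have := well_lower x0' x1'; clear => *; lra.
have nb : nbsum X <= 134 / 100 by rewrite /nbsum; clear -h y2 dm d0; lra.
have : 4 * (well (plat X) - well (4 * d) - 2 * d) = - nbsum X.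
  by apply: (mulfI (lt0r_neq0 d0)); rewrite mulrN -E; ring.
by clear -wp wx nb dm d0 => ?; lra.
Qed.
End FrontCurve.

Definition cfg_succ (c : cfg) : cfg := if c is Some (k, L) then Some (k, L.+1) else None.

Definition cfg_ok (c : cfg) : bool := if c is Some (_, L) then (1 < L)%N else true.

Lemma dnb_succ c n : cfg_ok c -> (0 < n)%N -> dnb (cfg_succ c) n.+1 = (dnb c n).+1.
Proof. by case: c => [[k L]|] /=; lia. Qed.

Lemma upb_succ c n : cfg_ok c -> (0 < n)%N -> upb (cfg_succ c) n.+1 = (upb c n).+1.
Proof. by case: c => [[[] L]|] //= hL hn; rewrite ltnS; case: ifP => _ //; lia. Qed.

Lemma dnb1 c : cfg_ok c -> dnb c 1 = 0%N.
Proof. by case: c => [[k L]|] //=; lia. Qed.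

Lemma upb1 c : cfg_ok c -> upb c 1 = 2%N.
Proof. by case: c => [[k L]|] //= ->. Qed.

Lemma cfg_ok_succ c : cfg_ok c -> cfg_ok (cfg_succ c).
Proof. by case: c => [[k L]|] //=; lia. Qed.

Section Junction.
Variable R : realType.
Implicit Types (d x : R) (c : cfg) (X : cell -> R).

(* The same sequence, seen from its next site. *)
Definition shift_front X (i : cell) : R :=
  match i with
  | (true, n) => X (true, n.+1)
  | (false, 0%N) => next_site X
  | (false, n.+1) => X (false, n)
  end.

Lemma plat_shift_front X : plat (shift_front X) = plat X.
Proof. by rewrite {1}/plat /= /next_site addrC subrK. Qed.

(** Plateau, active and zero-side rows are the same lattice equation in different unknowns: row 1
    becomes the active row and the active row becomes a zero-side one. The new box bounds hold
    because x <= 4 d is far below 1/32 of the next site. *)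
Lemma front_shift d c x X : cfg_ok c -> front d (cfg_succ c) x X -> x <= 4 * d ->
  1 <= next_site X <= 34 / 25 -> front d c (next_site X) (shift_front X).
Proof.
move=> ok F x4 /andP[u1 u2]; have [d0 d1 [bX eX]] := F.
have dm := dmax_mul d1; have cr := front_core F.
have [[x0 _ /andP[p1 p2] _ _] _] := core_facts d0 d1 cr.
have xE := front_x F; have he := front_he F; have hy := front_hy F.
set u := next_site X in u1 u2 *.
have EL : u * (well (plat X) - well u - 2 * d) + d * (plat X - X (true, 2%N) + x) = 0.
  have ok' := cfg_ok_succ ok.
  have := eX (true, 1%N); rewrite /= dnb1 // upb1 //.
  have -> : X (true, 0%N) = plat X - x by rewrite /plat xE addrK.
  have -> : X (true, 1%N) = plat X - u by rewrite /u /next_site opprB addrC subrK.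
  move=> <-; rewrite /well /stiff; ring.
have EX : u * (well (plat X) - well u - 2 * d) = - (d * (plat X - X (true, 2%N) + x)).
  by apply/eqP; rewrite -addr_eq0 EL.
split=> //; split.
  split=> //.
  - rewrite plat_shift_front; split=> //.
      by apply/andP; split=> //; clear -u1 dm d0; lra.
    rewrite EX; have [_ P2] := front_nbsum F.
    have P3 : plat X <= 1415 / 1000 by clear -P2 p1; nra.
    have := he 1%N; rewrite ler_norml => /andP[e1 e2].
    have a1 : 1 / 2 <= plat X - X (true, 2%N) + x by clear -p1 e2 x0 dm d0; lra.
    have a2 : plat X - X (true, 2%N) + x <= 3 / 2 by clear -P3 e1 x4 dm d0; lra.
    have b1 := ler_wpM2l (ltW d0) a1; have b2 := ler_wpM2l (ltW d0) a2.
    by clear -b1 b2; apply/andP; split; lra.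
  - by move=> n; exact: he.
  - move=> [|n] /=; first by rewrite xE gtr0_norm //; clear -x4 u1 dm d0; lra.
    by apply: le_trans (hy n) _; clear -x4 u1 dm d0 x0; lra.
case=> [[] [|n]] /=; rewrite ?plat_shift_front -/u.
- by rewrite xE.
- by have := eX (true, n.+2); rewrite /= dnb_succ // upb_succ.
- by [].
- case: n => [|n] /=; last by have := eX (false, n.+1).
  have := eX (true, 0%N); rewrite /= -/u xE => E0.
  rewrite -[RHS]oppr0 -[in RHS]E0 /well /mu_of.
  have -> : X (true, 1%N) = plat X - u by rewrite /u /next_site opprB addrC subrK.
  ring.
Qed.

(* On the part of a loop parametrized below, [next_site] is at least 4/3 as long as
   the active site is below [4 d], and the active site itself stays below 4/3. *)
Lemma no_double_front d c c' x x' X X' n : reach c' 1 ->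
  front d c x X -> front d c' x' X' -> x < 4 / 3 ->
  (x' <= 4 * d -> 4 / 3 <= next_site X') ->
  plat X' = plat X -> (0 < n)%N -> X (false, n) = x' -> plat X' - X' (true, n) = x -> False.
Proof.
move=> rc F F' x43 hx' pE n0 yE eE.
have [d0 d1 _] := F; have dm := dmax_mul d1.
have cr := front_core F.
have [[x0 _ /andP[p1 p2] _ _] _] := core_facts d0 d1 cr.
have e1n : X' (true, n) <= X' (true, 1%N).
  case: n n0 {yE eE} => [//|[//|n]] _.
  have := front_e_lt F' rc (_ : (1 < n.+2)%N) => /(_ isT).
  by have := front_e_gt0 F' 1; clear => *; lra.
have u43 : next_site X' < 4 / 3.
  by apply: le_lt_trans x43; rewrite -eE /next_site lerD2l lerN2.
have x4 : 4 * d < x' by rewrite ltNge; apply/negP => /hx'; rewrite leNgt u43.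
have pu : plat X <= 13334 / 100 / 100.
  have := front_he F' 0%N; rewrite ler_norml => /andP[_ e2].
  rewrite -pE; move: u43; rewrite /next_site; clear -e2 dm d0 => h; lra.
have mu39 : 39 / 100 <= mu_of (plat X).
  have s1 : 1 <= plat X ^+ 2 by clear -p1; nra.
  have s2 : plat X ^+ 2 <= 178 / 100 by clear -p1 pu; nra.
  rewrite /mu_of -[_ ^+ 4]/(_ ^+ (2 * 2)) exprM; move: s1 s2; set Y := plat X ^+ 2.
  by clear => *; nra.
have yn : X (false, n) <= X (false, 1%N).
  case: n n0 {yE eE e1n} => [//|[//|n]] _.
  have := front_y_lt F (_ : (1 < n.+2)%N) => /(_ isT).
  by have := front_y_gt0 F 1; clear => *; lra.
have xE := front_x F.
have [_ _ [_ eX]] := F; have := eX (false, 1%N); rewrite /= xE.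
have y0 := front_y_gt0 F 1; have y2 := front_y_lt F (ltnSn 1).
have := front_hy F 0%N; rewrite (gtr0_norm y0) => yx.
move: yn y0 y2 yx; set y := X (false, 1%N); set z := X (false, 2%N) => yn y0 y2 yx E.
have c1 : 38 / 100 <= mu_of (plat X) + 2 * d - 2 * y ^+ 2 + y ^+ 4.
  have y4 : 0 <= y ^+ 4 by rewrite exprn_ge0 // ltW.
  have yy : y ^+ 2 <= 2 / 1000 by clear -y0 yx x43; nra.
  by clear -y4 yy mu39 d0; lra.
have E2 : y * (mu_of (plat X) + 2 * d - 2 * y ^+ 2 + y ^+ 4) = d * (x + z).
  by apply/eqP; rewrite -subr_eq0 E.
have E3 : y * (38 / 100) <= d * (x + z) by rewrite -E2 ler_wpM2l // ltW.
have E4 : d * (x + z) <= d * (15 / 10) by rewrite ler_wpM2l ?(ltW d0) //; clear -y2 yx x43; lra.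
by move: x4; rewrite -yE; clear -yn E3 E4 d0 => *; lra.
Qed.

Definition close_const d : R := 100 * (5 / d) / (d / 1000).

(** The folded front satisfies the rows of the infinite one up to index L, and beyond it both
    deviations are at most 6 3^(-L). So every weighted bound B on the difference improves to a tail
    term plus 3 B / 4. *)
Lemma front_close d k L x X Y : front d (Some (k, L.+1)) x X -> front d None x Y ->
  forall i, `|X i - Y i| <= close_const d * 3^-1 ^+ L.
Proof.
move=> FX FY.
have [d0 d1 [bX eX]] := FX; have [_ _ [bY eY]] := FY.
have d1000 : 0 < d / 1000 by clear -d0; lra.
have q34 : 0 <= (3 / 4 : R) < 1 by apply/andP; split; clear; lra.
have [[x0 _ _ _ [_ _ m1 _ _]] _] := core_facts d0 d1 (front_core FX).
have om_ok : x / mu_of (plat X) <= x / mu_of (plat X) <= 5 * (x / mu_of (plat X)).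
  have : 0 < x / mu_of (plat X) by rewrite divr_gt0 //; clear -m1 d0; lra.
  by clear => h; apply/andP; split; lra.
have [hw [dom _]] := front_dominated (dnb None) (upb None) d0 d1 (lexx x) bX bY om_ok.
set w := fweight d _ in hw dom.
have w0 i : 0 < w i by have /andP[h _] := hw i; apply: lt_le_trans h.
have t0 : 0 <= (3^-1 : R) ^+ L by rewrite exprn_ge0.
pose A := 12 * 3^-1 ^+ L / (d / 1000).
have A0 : 0 <= A by rewrite /A divr_ge0 ?(ltW d1000) // mulr_ge0.
have wX j : `|(X j - Y j) / w j| * w j = `|X j - Y j|.
  by rewrite normrM normfV (gtr0_norm (w0 j)) divfK // gt_eqF.
have bnd i : `|X i - Y i| <= 12.
  have a := in_box_bound i d0 d1 bX; have b := in_box_bound i d0 d1 bY.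
  by apply: le_trans (ler_normB _ _) _; clear -a b; lra.
have key : forall i, `|(X i - Y i) / w i| <= A / (1 - 3 / 4).
  apply: (@self_improving R _ _ A (3 / 4) (12 / (d / 1000))) => //.
    move=> i; rewrite normrM normfV (gtr0_norm (w0 i)) ler_pM ?invr_ge0 ?(ltW (w0 i)) //.
    by rewrite lef_pV2 ?posrE //; have /andP[] := hw i.
  move=> B B0 hB i.
  have hB' j : `|X j - Y j| <= B * w j by rewrite -wX ler_wpM2r ?(ltW (w0 j)).
  have [tail|head] : (exists2 n, i = (true, n) & (L < n)%N) \/
      front_eq (dnb None) (upb None) d X i = param x i.
    case: i => [[] [|n]].
    - by right; rewrite -(eX (true, 0%N)).
    - have [Ln|nL] := leqP L n; first by left; exists n.+1.
      right; rewrite -(eX (true, n.+1)).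
      have e1 : dnb (Some (k, L.+1)) n.+1 = dnb None n.+1 by rewrite /= minnSS (minn_idPl (ltnW nL)).
      have e2 : upb (Some (k, L.+1)) n.+1 = upb None n.+1 by rewrite /= ltnS ifT.
      by rewrite /front_eq e1 e2.
    - by right; rewrite -(eX (false, 0%N)).
    - by right; rewrite -(eX (false, n.+1)).
  - have [n -> Ln] := tail.
    have tX : `|X (true, n)| <= 6 * 3^-1 ^+ L.
      rewrite gtr0_norm ?(front_e_gt0 FX) //.
      have hr : reach (Some (k, L.+1)) L by exact: ltnSn.
      have h1 := front_e_lt FX hr Ln.
      have h2 := front_e_gt0 FX L.
      have h3 : X (true, L) <= 6 * 3^-1 ^+ L.
        by apply: (front_e_geom FX) => m mL /=; rewrite ltnS ltnW.
      by clear -h1 h2 h3; lra.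
    have tY : `|Y (true, n)| <= 6 * 3^-1 ^+ L.
      rewrite gtr0_norm ?(front_e_gt0 FY) //.
      have h1 := front_e_lt FY (n := L) isT Ln.
      have h2 := front_e_gt0 FY L.
      have h3 : Y (true, L) <= 6 * 3^-1 ^+ L by exact: (front_e_geom FY).
      by clear -h1 h2 h3; lra.
    have h : `|X (true, n) - Y (true, n)| <= 12 * 3^-1 ^+ L.
      by apply: le_trans (ler_normB _ _) _; clear -tX tY; lra.
    apply: le_trans (_ : A <= _); last by rewrite lerDl mulr_ge0 //; lra.
    rewrite normrM normfV (gtr0_norm (w0 _)) /A ler_pM ?invr_ge0 ?(ltW (w0 _)) //.
    by rewrite lef_pV2 ?posrE //; have /andP[] := hw (true, n).
  - have := front_eq_sub (dnb None) (upb None) d X Y i; rewrite head eY subrr /lrow.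
    move/esym/eqP; rewrite addr_eq0 => /eqP E.
    have [c1 c2] := dom i.
    have c0 : 0 < fdiag d i X Y by apply: lt_le_trans c1.
    have := sum_le_dominated (V := fun j => X j - Y j) (fnb (dnb None) (upb None)) (fun r i => foff d r i X Y) i B0 hB'.
    rewrite -normrN -E normrM (gtr0_norm c0) => h1.
    have h2 := le_trans h1 (ler_wpM2l B0 c2).
    apply: le_trans (_ : 3 / 4 * B <= _); last by rewrite lerDr.
    rewrite normrM normfV (gtr0_norm (w0 i)) ler_pdivrMr // -(ler_pM2l c0).
    by apply: le_trans h2 _; rewrite le_eqVlt; apply/orP; left; apply/eqP; ring.
move=> i.
have -> : close_const d * 3^-1 ^+ L = 100 * (3^-1 ^+ L * ((d / 1000)^-1 * (5 / d))).
  by rewrite /close_const; set a := _ ^+ L; set b := (d / 1000)^-1; set e := 5 / d; clear; ring.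
rewrite -wX.
have /andP[_ w5] := hw i.
apply: le_trans (ler_pM (normr_ge0 _) (ltW (w0 i)) (key i) w5) _.
have h5 : 0 <= 3^-1 ^+ L * ((d / 1000)^-1 * (5 / d)).
  apply: mulr_ge0; first exact: t0.
  by apply: mulr_ge0; [rewrite invr_ge0; exact: ltW|apply: divr_ge0; [exact: ler0n|exact: ltW]].
rewrite (_ : A / (1 - 3 / 4) * (5 / d) = 48 * (3^-1 ^+ L * ((d / 1000)^-1 * (5 / d)))); last first.
  rewrite /A; set a := _ ^+ L; set b := (d / 1000)^-1; set e := 5 / d; by clear; field.
by apply: ler_wpM2r; [exact: h5|clear; lra].
Qed.
End Junction.

(** * Parametrization of the loop *)

Lemma lipschitz_ivt (R : realType) (f : R -> R) (a b v C : R) : a <= b ->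
  (forall s t, a <= s <= b -> a <= t <= b -> `|f t - f s| <= C * `|t - s|) ->
  f a <= v <= f b -> exists2 c, a <= c <= b & f c = v.
Proof.
move=> ab hf hv.
have C1 : 0 < `|C| + 1 by rewrite ltr_wpDl.
have [||c] := @IVT R f a b v ab.
- apply/subspace_continuousP => x /=; rewrite in_itv /= => hx.
  apply/cvgrPdist_le => e e0; rewrite near_withinE.
  near=> y => /=; rewrite in_itv /= => hy.
  rewrite distrC; apply: le_trans (hf x y hx hy) _.
  apply: le_trans (_ : (`|C| + 1) * `|y - x| <= _).
    by rewrite ler_wpM2r //; apply: le_trans (ler_norm _) _; rewrite lerDl.
  rewrite mulrC -ler_pdivlMr //.
  rewrite distrC; near: y; apply: cvgr_dist_le; first exact: cvg_id.
  by rewrite divr_gt0.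
- by case/andP: hv => h1 h2; rewrite ge_min h1 le_max h2 orbT.
by rewrite in_itv => hc E; exists c.
Unshelve. all: by end_near. Qed.

Section Phase.
Variable R : realType.
Implicit Types (d x u : R) (c : cfg).

(** Hands over from the value of the next site to [ramp] on [4 d, 5 d]; [cut2] hands over from
    [ramp] to the active value on [13/10, 131/100]. *)
Definition cut1 d x : R := smooth_step ((x - 4 * d) / d).
Definition cut2 x : R := smooth_step ((x - 13 / 10) * 100).

(** Above u - 4/3, which is at most 0.082, and below 1 + (x - 4/3) for x >= 13/10, so that both
    blends go from a smaller to a larger function. *)
Definition ramp x : R := 1 / 4 + x / 4.

(* For small [x] the phase is the shifted value of the next site, for [x] close to
   4/3 it is 1 plus the shifted value of the active site: so the phases of a front
   seen from two consecutive active sites differ by 1. *)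
Definition phase d x u : R :=
  (u - 4 / 3) + cut1 d x * (ramp x - (u - 4 / 3)) + cut2 x * (1 + (x - 4 / 3) - ramp x).

Lemma cut1_0 d x : 0 < d -> x <= 4 * d -> cut1 d x = 0.
Proof. by move=> d0 x4; apply: smooth_step0; rewrite ler_pdivrMr // mul0r subr_le0. Qed.

Lemma cut1_1 d x : 0 < d -> 5 * d <= x -> cut1 d x = 1.
Proof. by move=> d0 x5; apply: smooth_step1; rewrite ler_pdivlMr //; lra. Qed.

Lemma cut2_0 x : x <= 13 / 10 -> cut2 x = 0.
Proof. by move=> x4; apply: smooth_step0; lra. Qed.

Lemma cut2_1 x : 131 / 100 <= x -> cut2 x = 1.
Proof. by move=> x4; apply: smooth_step1; lra. Qed.

Lemma phase_start d x u : 0 < d -> d <= dmax R -> x <= 4 * d -> phase d x u = u - 4 / 3.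
Proof.
move=> d0 /dmax_mul dm x4; rewrite /phase cut1_0 // cut2_0; last by lra.
by ring.
Qed.

Lemma phase_end d x u : 0 < d -> d <= dmax R -> 131 / 100 <= x -> phase d x u = 1 + (x - 4 / 3).
Proof.
move=> d0 /dmax_mul dm x4; rewrite /phase cut1_1 //; last by lra.
by rewrite cut2_1 //; ring.
Qed.

(** A blend of two functions growing at rate 1/4 keeps this rate if the weight moves towards the
    larger one. *)
Lemma mix_incr (a a' A A' B B' h : R) : 0 <= a -> a <= a' -> a' <= 1 ->
  h / 4 <= A' - A -> h / 4 <= B' - B -> (a' = 0 \/ A' <= B') ->
  h / 4 <= (A' + a' * (B' - A')) - (A + a * (B - A)).
Proof.
move=> a0 aa a1 hA hB hAB.
have e0 : 0 <= (a' - a) * (B' - A').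
  case: hAB => [E|?]; last by rewrite mulr_ge0 ?subr_ge0.
  by have -> : a' - a = 0 by [lra]; rewrite mul0r.
have e1 : (1 - a) * (h / 4) <= (1 - a) * (A' - A) by rewrite ler_wpM2l //; lra.
have e2 : a * (h / 4) <= a * (B' - B) by rewrite ler_wpM2l.
have -> : A' + a' * (B' - A') - (A + a * (B - A)) =
  (1 - a) * (A' - A) + a * (B' - B) + (a' - a) * (B' - A') by ring.
clear -e0 e1 e2; lra.
Qed.

Definition fronts d (X : cfg -> R -> cell -> R) : Prop :=
  forall c x, xdom d x -> front d c x (X c x).

Definition tau d X c x : R := phase d x (next_site (X c x)).

Lemma next_site_range d c x X : front d c x X -> next_site X <= 1415 / 1000.
Proof.
move=> F; have [_ P2] := front_nbsum F.
have [d0 d1 _] := F; have [[_ _ /andP[p1 _] _ _] _] := core_facts d0 d1 (front_core F).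
have e1 := front_e_gt0 F 1; rewrite /next_site.
have : plat X <= 1415 / 1000 by clear -P2 p1; nra.
by clear -e1 => h; lra.
Qed.

Section Tau.
Variables (d : R) (X : cfg -> R -> cell -> R).

Lemma tau_incr c x x' : 0 < d -> d <= dmax R -> fronts d X ->
  3 * d <= x -> x <= x' -> x' <= 34 / 25 ->
  1 / 4 * (x' - x) <= tau d X c x' - tau d X c x.
Proof.
move=> d0 d1 hX; have dm := dmax_mul d1.
have zone1 s t : 3 * d <= s -> s <= t -> t <= 5 * d -> 1 / 4 * (t - s) <= tau d X c t - tau d X c s.
  move=> s3 st t5.
  have Ds : xdom d s by apply/xdomP; clear -s3 st t5 dm d0; apply/andP; split; lra.
  have Dt : xdom d t by apply/xdomP; clear -s3 st t5 dm d0; apply/andP; split; lra.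
  have I := next_site_incr s3 st t5 (hX c s Ds) (hX c t Dt).
  have U := next_site_range (hX c t Dt).
  rewrite /tau /phase !cut2_0; [|clear -st t5 dm d0; lra|clear -st t5 dm d0; lra].
  rewrite !mul0r !addr0; have -> : 1 / 4 * (t - s) = (t - s) / 4 by clear; field.
  apply: mix_incr; [exact: smooth_step_ge0| |exact: smooth_step_le1| | |right].
  - by apply: smooth_step_homo; rewrite ler_pM2r ?invr_gt0 //; clear -st; lra.
  - by clear -I st; lra.
  - by rewrite /ramp; clear -st; lra.
  - by rewrite /ramp; clear -U st s3 d0; lra.
have zone2 s t : 5 * d <= s -> s <= t -> 1 / 4 * (t - s) <= tau d X c t - tau d X c s.
  move=> s5 st; rewrite /tau /phase !cut1_1 //; last by clear -st s5; lra.
  have -> : 1 / 4 * (t - s) = (t - s) / 4 by clear; field.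
  rewrite !mul1r ![_ - 4 / 3 + (_ - _)]addrC !subrK.
  apply: mix_incr; [exact: smooth_step_ge0| |exact: smooth_step_le1| | |].
  - by apply: smooth_step_homo; clear -st; lra.
  - by rewrite /ramp; clear -st; lra.
  - by clear -st; lra.
  - have [h|h] := leP t (13 / 10); first by left; exact: cut2_0.
    by right; rewrite /ramp; clear -h; lra.
move=> x3 xx x1; have [h|h] := leP x' (5 * d); first exact: zone1.
have [h'|h'] := leP (5 * d) x; first exact: zone2.
have z1 := zone1 x (5 * d) x3 (ltW h') (lexx _); have z2 := zone2 (5 * d) x' (lexx _) (ltW h).
by clear -z1 z2; lra.
Qed.

Lemma tau_3d c : 0 < d -> d <= dmax R -> fronts d X -> tau d X c (3 * d) <= - (1 / 200).
Proof.
move=> d0 d1 hX; have dm := dmax_mul d1.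
have D3 : xdom d (3 * d) by apply/xdomP; clear -dm d0; apply/andP; split; lra.
have := next_site_3d (hX c _ D3); rewrite /tau phase_start //; last by clear -d0; lra.
by clear => h; lra.
Qed.

Lemma tau_4d c : 0 < d -> d <= dmax R -> fronts d X -> 1 / 200 <= tau d X c (4 * d).
Proof.
move=> d0 d1 hX; have dm := dmax_mul d1.
have D3 : xdom d (4 * d) by apply/xdomP; clear -dm d0; apply/andP; split; lra.
have := next_site_4d (hX c _ D3); rewrite /tau phase_start //.
by clear => h; lra.
Qed.

Lemma uc_affine_step k (a b : R) :
  uc k (xdom d) (fun (_ : unit) x => smooth_step ((x - a) * b)).
Proof.
pose M0 := `|3 * d| + `|34 / 25 : R|.
have hM0 s : xdom d s -> `|s| <= M0.
  move=> /xdomP /andP[h1 h2]; rewrite ler_norml /M0.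
  have := ler_norm (34 / 25 : R); have := ler_norm (- (3 * d)); rewrite normrN.
  have := normr_ge0 (34 / 25 : R); have := normr_ge0 (3 * d).
  by move: h1 h2; clear => *; apply/andP; split; lra.
pose M := (M0 + `|a|) * `|b|.
have M0' : 0 <= M by rewrite mulr_ge0 // addr_ge0 // addr_ge0.
have aff : uc k (xdom d) (fun (_ : unit) x => (x - a) * b).
  apply: uc_mul; last exact: uc_cst.
  by apply: uc_sub; [exact: uc_id hM0|exact: uc_cst].
have ran (j : unit) s : xdom d s -> `[- M, M]%classic ((s - a) * b).
  move=> Ds /=; rewrite in_itv /= -ler_norml; apply: norm_mul_le => //.
  by apply: le_trans (ler_normB _ _) _; rewrite lerD2r; exact: hM0.
exact: (uc_reindex (fun u : unit => (u, u)) (uc_comp ran (smooth_step_uc k M0') aff)).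
Qed.

Lemma tau_uc k : 0 < d -> d <= dmax R -> fronts d X ->
  uc k (xdom d) (fun c x => tau d X c x).
Proof.
move=> d0 d1 hX.
have Xk : uc k (xdom d) (fun (ti : cfg * cell) x => X ti.1 x ti.2).
  by apply: (@front_uc R d cfg dnb upb) => // t x Dx; have [_ _] := hX t x Dx.
have xid : uc k (xdom d) (fun (_ : cfg) x => x).
  apply: (@uc_id _ _ _ _ 2) => s /xdomP /andP[h1 h2].
  by rewrite ler_norml; clear -h1 h2 d0; apply/andP; split; lra.
have nx : uc k (xdom d) (fun c x => next_site (X c x)).
  rewrite /next_site /plat.
  apply: uc_sub; last exact: (uc_reindex (fun c : cfg => (c, (true, 1%N))) Xk).
  by apply: uc_add; [exact: (uc_reindex (fun c : cfg => (c, (true, 0%N))) Xk)|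
    exact: (uc_reindex (fun c : cfg => (c, (false, 0%N))) Xk)].
have rm : uc k (xdom d) (fun (_ : cfg) x => ramp x).
  by rewrite /ramp; apply: uc_add; [exact: uc_cst|apply: uc_mul => //; exact: uc_cst].
rewrite /tau /phase; apply: uc_add; [apply: uc_add|].
- by apply: uc_sub => //; exact: uc_cst.
- apply: uc_mul; first exact: (uc_reindex (fun _ : cfg => tt) (uc_affine_step k (4 * d) d^-1)).
  by apply: uc_sub => //; apply: uc_sub => //; exact: uc_cst.
- apply: uc_mul; first exact: (uc_reindex (fun _ : cfg => tt) (uc_affine_step k (13 / 10) 100)).
  by apply: uc_sub => //; apply: uc_add; [exact: uc_cst|apply: uc_sub => //; exact: uc_cst].
Qed.

(** One turn is [0, 1]; the margins are the overlaps of consecutive pieces and match those of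
    [tau_3d] and [tau_4d]. *)
Definition sdom : set R := `[- (1 / 200), 1 + 1 / 200]%classic.

Lemma sdomP (s : R) : sdom s <-> - (1 / 200) <= s <= 1 + 1 / 200.
Proof. by rewrite /sdom /= in_itv. Qed.

(** [iot c] inverts the phase. On the overlaps a piece begins with x <= 4 d and ends with x = 4/3 +
    s, which is what identifies the end of one piece with the beginning of the next. *)
Lemma iota_exists : 0 < d -> d <= dmax R -> fronts d X ->
  exists iot : cfg -> R -> R,
    [/\ forall c s, sdom s -> xdom d (iot c s) /\ tau d X c (iot c s) = s,
        forall k c, uc k sdom (fun _ : unit => iot c),
        forall c s, `|s| <= 1 / 200 -> iot c s <= 4 * d &
        forall c s, `|s| <= 1 / 200 -> iot c (1 + s) = 4 / 3 + s].
Proof.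
move=> d0 d1 hX; have dm := dmax_mul d1.
have [K K0 [_ hK]] := tau_uc 0 d0 d1 hX.
have ab : 3 * d < 34 / 25 by clear -dm d0; lra.
have D1 : xdom d (34 / 25) by apply/xdomP; clear -ab; apply/andP; split; lra.
have ex (cs : cfg * R) : exists x, sdom cs.2 -> xdom d x /\ tau d X cs.1 x = cs.2.
  case: cs => c s /=; have [/sdomP /andP[s1 s2]|h] := pselect (sdom s); last by exists 0 => /h.
  have [||x hx E] := @lipschitz_ivt R (tau d X c) (3 * d) (34 / 25) s K (ltW ab).
  - by move=> u v hu hv; apply: hK; apply/xdomP.
  - apply/andP; split; first by apply: le_trans (tau_3d c d0 d1 hX) _.
    by rewrite /tau phase_end //; clear -s2; lra.
  by exists x => _; split=> //; apply/xdomP.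
have [io hio] := choice ex.
pose iot c s := io (c, s).
have hi c s : sdom s -> xdom d (iot c s) /\ tau d X c (iot c s) = s by exact: (hio (c, s)).
have inj c x x' : xdom d x -> xdom d x' -> tau d X c x = tau d X c x' -> x = x'.
  move=> /xdomP /andP[a1 a2] /xdomP /andP[b1 b2] E.
  apply/eqP; rewrite eq_le; apply/andP; split; rewrite leNgt; apply/negP => h.
    by have := tau_incr c d0 d1 hX b1 (ltW h) a2; rewrite E; clear -h => h2; lra.
  by have := tau_incr c d0 d1 hX a1 (ltW h) b2; rewrite E; clear -h => h2; lra.
exists iot; split=> //.
- move=> k c; apply: (@uc_inverse R sdom (3 * d) (34 / 25) (1 / 4) (tau d X c)) => //.
  + by move=> s t h1 h2 h3; exact: tau_incr.
  + by move=> s /(hi c)[/xdomP].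
  + move=> j; exact: (uc_reindex (fun _ : unit => c) (tau_uc j d0 d1 hX)).
- move=> c s; rewrite ler_norml => /andP[s1 s2].
  have [|/xdomP /andP[x1 x2] E] := hi c s; first by apply/sdomP; clear -s1 s2; apply/andP; split; lra.
  rewrite leNgt; apply/negP => h.
  have h4 := tau_4d c d0 d1 hX.
  have := tau_incr c d0 d1 hX (_ : 3 * d <= 4 * d) (ltW h) x2.
  rewrite E; clear -h4 s2 d0 h => h5.
  have h3 : 3 * d <= 4 * d by lra.
  by have := h5 h3; lra.
- move=> c s; rewrite ler_norml => /andP[s1 s2].
  have [|Dx E] := hi c (1 + s); first by apply/sdomP; clear -s1 s2; apply/andP; split; lra.
  apply: (inj c) => //; first by apply/xdomP; clear -s1 s2 dm d0; apply/andP; split; lra.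
  by rewrite E /tau phase_end //; clear -s1; lra.
Qed.
End Tau.
End Phase.

(** * Gluing fronts into one curve *)

Definition profile (R : realType) (X : cell -> R) (z : int) : R :=
  match z with Posz n => plat X - X (true, n) | Negz n => X (false, n.+1) end.

Lemma profile_shift (R : realType) (X : cell -> R) z :
  profile (shift_front X) z = profile X (z + 1).
Proof.
case: z => [n|[|n]].
- by rewrite (_ : Posz n + 1 = Posz n.+1) /= ?plat_shift_front // -addn1 PoszD.
- by rewrite /= /plat addrAC subrr add0r.
- by rewrite (_ : Negz n.+1 + 1 = Negz n) //= !NegzE -[n.+2]addn1 PoszD opprD subrK.
Qed.

(* [None] stands for heteroclinic orbits, [Some k] for symmetric homoclinic ones. *)
Notation mode := (option site).

Definition cfm (m : mode) (L : int) : cfg := if m is Some k then Some (k, absz L) else None.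

(** From L = 2 on, site 1 has the unfolded neighbours 0 and 2, as the change of the active site
    requires. *)
Definition valid (m : mode) (L : int) : bool := if m is Some _ then 2 <= L else true.

(** In the symmetric modes -1 is the last independent position; positions from 0 on are mirror
    images. *)
Definition fold (m : mode) (pos : int) : int :=
  if m is Some k then if pos < 0 then pos else site_center k - 1 - pos else pos.

Lemma cfm_succ m L : valid m L -> cfm m (L + 1) = cfg_succ (cfm m L).
Proof.
case: m => [k|] //= L2; congr (Some (_, _)).
by case: L L2 => [n|//] _; rewrite (_ : Posz n + 1 = Posz n.+1) // -addn1 PoszD.
Qed.

Lemma cfm_ok m L : valid m L -> cfg_ok (cfm m L).
Proof. by case: m => [k|] //=; case: L. Qed.

Lemma valid_le m L L' : valid m L -> L <= L' -> valid m L'.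
Proof. by case: m => //= k; exact: le_trans. Qed.

Section Pieces.
Variable R : realType.
Implicit Types (d : R) (X : cfg -> R -> cell -> R) (iot : cfg -> R -> R) (m : mode) (L : int).

Definition charts d X iot : Prop :=
  [/\ 0 < d, d <= dmax R, fronts d X &
    [/\ forall c s, sdom s -> xdom d (iot c s) /\ tau d X c (iot c s) = s,
        forall k c, uc k (@sdom R) (fun _ : unit => iot c),
        forall c s, `|s| <= 1 / 200 -> iot c s <= 4 * d &
        forall c s, `|s| <= 1 / 200 -> iot c (1 + s) = 4 / 3 + s]].

Lemma charts_exist d : 0 < d -> d <= dmax R -> exists X iot, charts d X iot.
Proof.
move=> d0 d1.
have ex (cx : cfg * R) : exists Z : cell -> R, xdom d cx.2 -> front d cx.1 cx.2 Z.
  case: cx => c x /=; have [/xdomP hx|h] := pselect (xdom d x); last by exists (fun=> 0) => /h.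
  by have [Z fZ] := front_exists (dnb c) (upb c) d0 d1 hx; exists Z.
have [Y hY] := choice ex.
pose X c x := Y (c, x).
have hX : fronts d X by move=> c x Dx; exact: (hY (c, x)).
by have [iot [h1 h2 h3 h4]] := iota_exists d0 d1 hX; exists X, iot; split.
Qed.

Definition state X iot m L s : cell -> R := X (cfm m L) (iot (cfm m L) s).

(* The index [None] stands for the parameter mu; the active site sits at -1 - L. *)
Definition piece X iot m L (j : option int) s : R :=
  let Y := state X iot m L s in
  if j is Some pos then profile Y (fold m pos + 1 + L) else mu_of (plat Y).

Lemma state_front d X iot m L s : charts d X iot -> sdom s ->
  front d (cfm m L) (iot (cfm m L) s) (state X iot m L s).
Proof. by move=> [d0 d1 hX [h _ _ _]] Ds; apply: hX; have [] := h (cfm m L) s Ds. Qed.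

Lemma small_sdom (s : R) : `|s| <= 1 / 200 -> sdom s /\ sdom (1 + s).
Proof. by rewrite ler_norml => /andP[h1 h2]; split; apply/sdomP; apply/andP; split; lra. Qed.

(** Seen from its next site, the front of length L + 1 at phase s is a front of length L with active
    value 4/3 + s; by uniqueness it is the one at phase 1 + s. *)
Lemma piece_junction d X iot m L j s : charts d X iot -> valid m L -> `|s| <= 1 / 200 ->
  piece X iot m L j (1 + s) = piece X iot m (L + 1) j s.
Proof.
move=> ch vL hs; have [d0 d1 hX [h1 _ h3 h4]] := ch; have [Ds Ds1] := small_sdom hs.
have F := state_front m L ch Ds1; have F' := state_front m (L + 1) ch Ds.
have x4 := h3 (cfm m (L + 1)) s hs; have [D1 E1] := h1 (cfm m (L + 1)) s Ds.
have nE : next_site (state X iot m (L + 1) s) = 4 / 3 + s.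
  move: E1; rewrite /tau phase_start // -/(state X iot m (L + 1) s).
  by move/eqP; rewrite subr_eq => /eqP ->; exact: addrC.
have F2 : front d (cfm m L) (4 / 3 + s) (shift_front (state X iot m (L + 1) s)).
  rewrite -nE; apply: (front_shift (cfm_ok vL) _ x4); first by rewrite -cfm_succ.
  by rewrite nE; move: hs; rewrite ler_norml; clear => /andP[s1 s2]; apply/andP; split; lra.
have E : state X iot m L (1 + s) = shift_front (state X iot m (L + 1) s).
  move: F; rewrite h4 // => F.
  have [_ _ f1] := F; have [_ _ f2] := F2.
  exact: front_unique d0 d1 f1 f2.
rewrite /piece E; case: j => [pos|]; last by rewrite plat_shift_front.
by rewrite profile_shift -addrA.
Qed.

Lemma profile_uc k (D : set R) (F : cell -> R -> R) : uc k D F ->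
  uc k D (fun z s => profile (fun i => F i s) z).
Proof.
move=> hF.
have hp : uc k D (fun (n : nat) s => plat (fun i => F i s) - F (true, n) s).
  apply: uc_sub; last exact: (uc_reindex (fun n => (true, n)) hF).
  by apply: uc_add; [exact: (uc_reindex (fun=> (true, 0%N)) hF)|exact: (uc_reindex (fun=> (false, 0%N)) hF)].
have hn : uc k D (fun (n : nat) s => F (false, n.+1) s) by exact: (uc_reindex (fun n => (false, n.+1)) hF).
have g := uc_if (fun z : int => if z is Posz _ then true else false)
  (uc_reindex (fun z : int => if z is Posz n then n else 0%N) hp)
  (uc_reindex (fun z : int => if z is Negz n then n else 0%N) hn).
by apply: uc_ext g => // -[n|n] s _.
Qed.

Lemma piece_uc d X iot m L k : charts d X iot -> uc k (@sdom R) (piece X iot m L).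
Proof.
move=> [d0 d1 hX [h1 h2 _ _]].
have Xk : uc k (xdom d) (fun (ti : cfg * cell) x => X ti.1 x ti.2).
  by apply: (@front_uc R d cfg dnb upb) => // t x Dx; have [_ _] := hX t x Dx.
have Sk : uc k (@sdom R) (fun i s => state X iot m L s i).
  have ran (u : unit) s : sdom s -> xdom d (iot (cfm m L) s) by move=> /(h1 (cfm m L))[].
  exact: (uc_reindex (fun i : cell => ((cfm m L, i), tt)) (uc_comp ran Xk (h2 k (cfm m L)))).
have pk : uc k (@sdom R) (fun (_ : option int) s => plat (state X iot m L s)).
  by apply: uc_add; [exact: (uc_reindex (fun=> (true, 0%N)) Sk)|exact: (uc_reindex (fun=> (false, 0%N)) Sk)].
have mk : uc k (@sdom R) (fun (_ : option int) s => mu_of (plat (state X iot m L s))).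
  rewrite /mu_of; apply: uc_sub; last exact: uc_exp.
  by apply: uc_mul; [exact: uc_cst|exact: uc_exp].
have g := uc_if (fun j : option int => isSome j)
  (uc_reindex (fun j : option int => if j is Some pos then fold m pos + 1 + L else 0) (profile_uc Sk)) mk.
by apply: uc_ext g => // -[pos|] s _.
Qed.

(** The integer part of s is the distance from the active site to position -1, the fractional part
    the phase. In the symmetric modes each unit of s lengthens the plateau by one site in each
    half. *)
Definition curve X iot m (j : option int) (s : R) : R :=
  piece X iot m (Num.floor s) j (s - (Num.floor s)%:~R).

Lemma curve_piece d X iot m L j s : charts d X iot -> valid m (L - 1) ->
  sdom (s - L%:~R) -> curve X iot m j s = piece X iot m L j (s - L%:~R).
Proof.
move=> ch vL /sdomP /andP[s1 s2]; rewrite /curve.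
have [sL|sL] := ltP s L%:~R.
  have -> : Num.floor s = L - 1.
    by apply/floor_def; rewrite intrB subrK sL andbT; clear -s1; lra.
  have -> : s - (L - 1)%:~R = 1 + (s - L%:~R) by rewrite intrB mulr1z; ring.
  rewrite (piece_junction j ch vL); first by rewrite subrK.
  by rewrite ler_norml; clear -s1 sL; apply/andP; split; lra.
have [sL1|sL1] := ltP s (L + 1)%:~R.
  by have -> : Num.floor s = L by apply/floor_def; rewrite sL sL1.
have -> : Num.floor s = L + 1.
  apply/floor_def; rewrite sL1 /= !intrD; rewrite intrD in sL1.
  by clear -s2; lra.
have vL' : valid m L by apply: valid_le vL _; rewrite gerBl.
rewrite intrD in sL1 *; rewrite -(piece_junction j ch vL'); first by congr (piece _ _ _ _ _ _); rewrite mulr1z; ring.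
by rewrite ler_norml; clear -s2 sL1; apply/andP; split; lra.
Qed.

(** Small enough for the curve to be a single piece there, also when s0 is an integer. *)
Definition near_pt (s0 : R) : set R := ball s0 (1 / 200).

Lemma near_floor (s0 s : R) : near_pt s0 s -> sdom (s - (Num.floor s0)%:~R).
Proof.
rewrite /near_pt /ball /= ltr_norml => /andP[h1 h2].
have /andP[f1 f2] := floor_itv s0; rewrite intrD in f2.
by apply/sdomP; apply/andP; split; lra.
Qed.

Lemma curve_uc d X iot m s0 k : charts d X iot -> valid m (Num.floor s0 - 1) ->
  uc k (near_pt s0) (curve X iot m).
Proof.
move=> ch v; have pk := piece_uc m (Num.floor s0) k ch.
have sub : uc k (near_pt s0) (fun (_ : unit) s => s - (Num.floor s0)%:~R).
  apply: uc_sub; last exact: uc_cst.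
  apply: (@uc_id _ _ _ _ (`|s0| + 1)) => s; rewrite /near_pt /ball /= => h.
  have := ler_normB s0 (s0 - s); rewrite opprB addrC subrK => h2.
  by apply: le_trans h2 _; rewrite lerD2l; clear -h; lra.
have ran (u : unit) s : near_pt s0 s -> sdom (s - (Num.floor s0)%:~R) by exact: near_floor.
apply: uc_ext (uc_reindex (fun j => (j, tt)) (uc_comp ran pk sub)) => // j s hs /=.
by rewrite (curve_piece j ch v) //; exact: near_floor.
Qed.
End Pieces.

(** * Fronts as solutions of the lattice equation *)

Section Profile.
Variable R : realType.
Implicit Types (d x : R) (c : cfg) (Y : cell -> R) (k : site) (L : nat).

Lemma uplus_mu_of (p : R) : 1 <= p -> p ^+ 2 - 1 <= 1 -> Uplus (mu_of p) = p.
Proof.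
move=> p1 n1; rewrite /Uplus.
have -> : 1 - mu_of p = (p ^+ 2 - 1) ^+ 2 by rewrite /mu_of; ring.
have n0 : 0 <= p ^+ 2 - 1 by clear -p1; nra.
by rewrite sqrtr_sqr (ger0_norm n0) addrC subrK sqrtr_sqr ger0_norm //; clear -p1; lra.
Qed.

Lemma mu_of_uplus (mu : R) : 0 <= mu <= 1 ->
  mu_of (Uplus mu) = mu /\ 1 <= Uplus mu /\ Uplus mu ^+ 2 - 1 = Num.sqrt (1 - mu).
Proof.
move=> /andP[m0 m1]; have s0 := sqrtr_ge0 (1 - mu).
have U2 : Uplus mu ^+ 2 = 1 + Num.sqrt (1 - mu) by rewrite sqr_sqrtr //; clear -s0; lra.
have s2 : Num.sqrt (1 - mu) ^+ 2 = 1 - mu by rewrite sqr_sqrtr //; clear -m1; lra.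
have U0 : 0 <= Uplus mu by exact: sqrtr_ge0.
split; last split.
- by rewrite /mu_of -[_ ^+ 4]/(_ ^+ (2 * 2)) exprM U2 sqrrD s2; ring.
- rewrite leNgt; apply/negP => h; clear -h U2 U0 s0; nra.
- by rewrite U2 addrC addKr.
Qed.

Definition lattice_eq d mu (u l r : R) : R := d * (r + l - 2 * u) - mu * u + 2 * u ^+ 3 - u ^+ 5.

Lemma profile_pred Y n : profile Y (Posz n.+1 - 1) = plat Y - Y (true, n).
Proof. by rewrite (_ : Posz n.+1 - 1 = Posz n) // -[n.+1]addn1 PoszD addrK. Qed.

Lemma profile_succ Y n : profile Y (Posz n + 1) = plat Y - Y (true, n.+1).
Proof. by rewrite (_ : Posz n + 1 = Posz n.+1) // -[n.+1]addn1 PoszD. Qed.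

Lemma profile0 Y : profile Y 0 = Y (false, 0%N).
Proof. by rewrite /= /plat addrAC subrr add0r. Qed.

Lemma profile_neg Y n : profile Y (- n%:Z) = Y (false, n).
Proof. by case: n => [|n]; [rewrite oppr0 profile0|rewrite -NegzE]. Qed.

Lemma profile_eq_neg d c x Y n : front d c x Y ->
  lattice_eq d (mu_of (plat Y)) (Y (false, n.+1)) (Y (false, n.+2)) (Y (false, n)) = 0.
Proof.
move=> [_ _ [_ eY]]; have := eY (false, n.+1); rewrite /= => E.
by rewrite -[RHS]oppr0 -[in RHS]E /lattice_eq; ring.
Qed.

Lemma profile_eq0 d c x Y : front d c x Y ->
  lattice_eq d (mu_of (plat Y)) (Y (false, 0%N)) (Y (false, 1%N)) (plat Y - Y (true, 1%N)) = 0.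
Proof.
move=> [_ _ [_ eY]]; have := eY (true, 0%N); rewrite /= => E.
by rewrite -[in RHS]E /lattice_eq /well /mu_of; ring.
Qed.

Lemma profile_eq_pos d c x Y n : front d c x Y ->
  lattice_eq d (mu_of (plat Y)) (plat Y - Y (true, n.+1)) (plat Y - Y (true, dnb c n.+1))
    (plat Y - Y (true, upb c n.+1)) = 0.
Proof.
move=> [_ _ [_ eY]]; have := eY (true, n.+1); rewrite /= => E.
by rewrite -[in RHS]E /lattice_eq /stiff /mu_of; ring.
Qed.

Lemma profile_eq d c x Y (z : int) : front d c x Y ->
  (if c is Some (_, L) then z < L%:Z else true) ->
  lattice_eq d (mu_of (plat Y)) (profile Y z) (profile Y (z - 1)) (profile Y (z + 1)) = 0.
Proof.
move=> F; case: z => [[|n]|n] hz.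
- have := profile_eq0 F; rewrite profile0 profile_succ.
  by rewrite (_ : Posz 0 - 1 = - 1%:Z) // profile_neg.
- have := profile_eq_pos n F; rewrite profile_pred profile_succ /=.
  suff [-> ->] : dnb c n.+1 = n /\ upb c n.+1 = n.+2 by [].
  case: c hz F => [[k L]|] //=; rewrite ltz_nat => hz _.
  by rewrite hz (minn_idPl (ltnW hz)).
- have := profile_eq_neg n F; rewrite NegzE profile_neg.
  rewrite (_ : - n.+1%:Z - 1 = - n.+2%:Z); last by rewrite -[n.+2]addn1 PoszD opprD.
  rewrite (_ : - n.+1%:Z + 1 = - n%:Z); last by rewrite -[n.+1]addn1 PoszD opprD subrK.
  by rewrite !profile_neg.
Qed.

Lemma profile_eq_end d k L x Y : front d (Some (k, L.+1)) x Y ->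
  lattice_eq d (mu_of (plat Y)) (profile Y L.+1) (profile Y L)
    (profile Y (if k is OnSite then L.+1 else L)) = 0.
Proof.
move=> F; have := profile_eq_pos L F; rewrite /= ltnn minnn /=.
by case: k F.
Qed.

Lemma front_mu d c x Y : front d c x Y -> d <= mu_of (plat Y) <= 1 - d / 4 /\
  Uplus (mu_of (plat Y)) = plat Y /\ 1 < plat Y.
Proof.
move=> F; have [d0 d1 _] := F.
have [[_ /andP[n0 n1] /andP[p1 _] _ [_ _ m1 _ _]] nu] := core_facts d0 d1 (front_core F).
split; last by rewrite uplus_mu_of //; clear -p1 n1; lra.
have mE : mu_of (plat Y) = 1 - (plat Y ^+ 2 - 1) ^+ 2 by rewrite /mu_of; ring.
by apply/andP; split; [clear -m1 d0; lra|rewrite mE; clear -nu; lra].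
Qed.

Lemma profile_bound d c x Y z : front d c x Y -> `|profile Y z| <= 10.
Proof.
move=> F; have [d0 d1 [bY _]] := F.
have b i := in_box_bound i d0 d1 bY.
have [[_ _ /andP[p1 p2] _ _] _] := core_facts d0 d1 (front_core F).
case: z => [n|n] /=; last by apply: le_trans (b _) _; clear; lra.
have p0 : 0 < plat Y by clear -p1; lra.
apply: le_trans (ler_normB _ _) _; have := b (true, n).
by rewrite (gtr0_norm p0); clear -p1 p2 => *; lra.
Qed.

Lemma profile_lt d c x Y (z : int) : front d c x Y ->
  (if c is Some (_, L) then z < L%:Z else true) -> profile Y z < profile Y (z + 1).
Proof.
move=> F; case: z => [n|n] hz.
  rewrite profile_succ /= ltrD2l ltrN2.
  have rn : reach c n by case: c hz F => [[k L]|].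
  have := front_e_lt F rn (ltnSn n); have := front_e_gt0 F n; clear => *; lra.
rewrite NegzE (_ : - n.+1%:Z + 1 = - n%:Z); last by rewrite -[n.+1]addn1 PoszD opprD subrK.
rewrite !profile_neg.
have := front_y_lt F (ltnSn n); have := front_y_gt0 F n; clear => *; lra.
Qed.

Lemma front_y_geom d c x Y n : front d c x Y -> Y (false, n) <= 6 * 3^-1 ^+ n.
Proof.
move=> F; have [d0 d1 [bY _]] := F.
elim: n => [|n IH].
  by have := in_box_bound (false, 0%N) d0 d1 bY; rewrite expr0 mulr1; apply: le_trans; exact: ler_norm.
have := front_y_lt F (ltnSn n); rewrite exprS; move: IH; set z := _ ^+ n; clear => *; lra.
Qed.
End Profile.

Section Fold.
Variables (R : realType).
Implicit Types (m : mode) (pos L : int) (Y : cell -> R).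

Definition mir (k : site) (pos : int) : int := site_center k - 1 - pos.

Lemma fold_mir k pos : fold (Some k) (mir k pos) = fold (Some k) pos.
Proof. by rewrite /fold /mir; case: k => /=; do 2?[case: ifP]; lia. Qed.

Lemma fold_neg m pos : pos < 0 -> fold m pos = pos.
Proof. by rewrite /fold; case: m => [k|] // ->. Qed.

Lemma fold_cases k pos : pos < 0 \/ mir k pos < 0.
Proof. by rewrite /mir; case: k => /=; lia. Qed.

(** By symmetry only positions pos < 0 matter; there only pos = -1 has a folded neighbour, and its
    row is the last one of the folded front. *)
Lemma fold_eq d m L x Y pos : front d (cfm m L) x Y -> valid m L ->
  lattice_eq d (mu_of (plat Y)) (profile Y (fold m pos + 1 + L))
    (profile Y (fold m (pos - 1) + 1 + L)) (profile Y (fold m (pos + 1) + 1 + L)) = 0.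
Proof.
move=> F vL; case: m F vL => [k|] /= F vL; last first.
  have := @profile_eq R d None x Y (pos + 1 + L) F isT.
  have -> : pos + 1 + L - 1 = pos - 1 + 1 + L by clear; lia.
  by have -> : pos + 1 + L + 1 = pos + 1 + 1 + L by clear; lia.
case: L vL F => [[|[|L]]|//] // _ /= F.
have main p : p < 0 -> lattice_eq d (mu_of (plat Y)) (profile Y (fold (Some k) p + 1 + L.+2))
    (profile Y (fold (Some k) (p - 1) + 1 + L.+2)) (profile Y (fold (Some k) (p + 1) + 1 + L.+2)) = 0.
  move=> p0; have pm : p - 1 < 0 by clear -p0; lia.
  rewrite (fold_neg _ p0) (fold_neg _ pm).
  have [p1|p1] := ltP p (-1).
    have pp : p + 1 < 0 by clear -p1; lia.
    rewrite (fold_neg _ pp).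
    have := @profile_eq R d _ x Y (p + 1 + L.+2) F.
    have -> : p + 1 + L.+2 - 1 = p - 1 + 1 + L.+2 by clear; lia.
    have -> : p + 1 + L.+2 + 1 = p + 1 + 1 + L.+2 by clear; lia.
    by apply; clear -p1; lia.
  have -> : p = -1 by clear -p0 p1; lia.
  have := profile_eq_end F.
  have -> : (-1 : int) + 1 + L.+2 = L.+2 by clear; lia.
  have -> : (-1 : int) - 1 + 1 + L.+2 = L.+1 by clear; lia.
  suff -> : fold (Some k) (-1 + 1) + 1 + L.+2 = (if k is OnSite then L.+2 else L.+1) by case: (k).
  by rewrite /fold; case: (k) => /=; clear; lia.
have [p0|p0] := fold_cases k pos; first exact: main.
have := main _ p0; rewrite fold_mir.
have -> : mir k pos - 1 = mir k (pos + 1) by rewrite /mir; clear; lia.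
have -> : mir k pos + 1 = mir k (pos - 1) by rewrite /mir; clear; lia.
by rewrite !fold_mir /lattice_eq [X in _ * (X - _)]addrC.
Qed.
End Fold.

(** * Recognition of fronts *)

Definition in_range (m : mode) (L z : int) : bool := if m is Some _ then z <= L else true.

(** Clipping the index at |L| fills the dummy cells with copies of the last site. *)
Definition front_of (R : realType) (m : mode) (L : int) (mu : R) (U : int -> R) (i : cell) : R :=
  if i.1 then
    Uplus mu - U (-1 - L + (if m is Some _ then minn i.2 `|L|%N else i.2)%:Z)
  else U (-1 - L - i.2%:Z).

Lemma front_of_plat (R : realType) m L (mu : R) U : plat (front_of m L mu U) = Uplus mu.
Proof. by rewrite /plat /front_of /= subr0; case: m => [k|] /=; rewrite ?min0n addr0 subrK. Qed.

Lemma front_of_y (R : realType) m L (mu : R) U n :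
  front_of m L mu U (false, n) = U (-1 - L - n%:Z).
Proof. by []. Qed.

Lemma front_of_e (R : realType) m L (mu : R) U (n : nat) : valid m L -> in_range m L n%:Z ->
  front_of m L mu U (true, n) = Uplus mu - U (-1 - L + n%:Z).
Proof.
rewrite /front_of; case: m => [k|] //= L2 nL; congr (_ - U (_ + _%:Z)).
by case: L L2 nL => [L|//] _; rewrite lez_nat => /minn_idPl.
Qed.

Lemma front_of_clip (R : realType) m L (mu : R) U n : valid m L ->
  exists2 n' : nat, in_range m L n'.+1%:Z &
    front_of m L mu U (true, n.+1) = front_of m L mu U (true, n'.+1).
Proof.
case: m => [k|] vL; last by exists n.
case: L vL => [[//|L]|//] vL; exists (minn n L); first by rewrite /= lez_nat ltnS geq_minr.
by rewrite /front_of /= -!minnSS -minnA minnn.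
Qed.

Lemma fold_sym (R : realType) m (U : int -> R) pos :
  (forall k, m = Some k -> forall p, U (mir k p) = U p) -> U (fold m pos) = U pos.
Proof.
case: m => [k|] sU //=; case: ifP => // _.
by rewrite -[RHS](sU k erefl).
Qed.

Lemma in_range_fold m L pos : in_range m L (fold m pos + 1 + L).
Proof. by case: m => [k|] //=; case: ifP; case: k => /=; clear; lia. Qed.

Lemma front_of_nb (R : realType) m L (mu : R) U n : valid m L ->
  (forall k, m = Some k -> forall pos, U (mir k pos) = U pos) ->
  exists q : int, [/\ front_of m L mu U (true, n.+1) = Uplus mu - U q,
        front_of m L mu U (true, dnb (cfm m L) n.+1) = Uplus mu - U (q - 1) &
        front_of m L mu U (true, upb (cfm m L) n.+1) = Uplus mu - U (q + 1)].
Proof.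
case: m => [k|] vL sU; last first.
  by exists (-1 - L + n.+1%:Z); split; rewrite /front_of /=; congr (_ - U _); clear; lia.
case: L vL => [[|[|L]]|] //= _.
exists (-1 - L.+2%:Z + (minn n.+1 L.+2)%:Z); split; rewrite /front_of /=.
- by [].
- by congr (_ - U _); case: ltnP => nL; clear -nL; lia.
- case: ltnP => nL; first by congr (_ - U _); clear -nL; lia.
  have -> : -1 - L.+2%:Z + L.+2%:Z + 1 = 0 by clear; lia.
  by rewrite -(sU k erefl 0) /mir; case: (k) => /=; congr (_ - U _); clear -nL; lia.
Qed.

(** The converse of the construction. The bound on the two neighbours of the active site yields the
    core inequality through the lattice equation; the remaining bounds are those of the box. *)
Lemma recognize (R : realType) (d : R) m L (mu : R) (U : int -> R) :
  0 < d -> d <= dmax R -> valid m L -> 0 < mu < 1 ->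
  (forall pos, lattice_eq d mu (U pos) (U (pos - 1)) (U (pos + 1)) = 0) ->
  (forall k, m = Some k -> forall pos, U (mir k pos) = U pos) ->
  3 * d <= U (-1 - L) <= 34 / 25 ->
  (forall n, in_range m L n.+1%:Z -> `|Uplus mu - U (-1 - L + n.+1%:Z)| <= 12 * d) ->
  (forall n, `|U (-1 - L - n.+1%:Z)| <= U (-1 - L) / 32) ->
  1 / 2 <= U (- L) + U (-2 - L) <= 3 / 2 ->
  [/\ front d (cfm m L) (U (-1 - L)) (front_of m L mu U),
      forall pos, profile (front_of m L mu U) (fold m pos + 1 + L) = U pos &
      mu_of (plat (front_of m L mu U)) = mu].
Proof.
move=> d0 d1 vL /andP[mu0 mu1] eU sU hx he hy /andP[c1 c2].
have mu01 : 0 <= mu <= 1 by rewrite !ltW.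
have [mE [p1 nE]] := mu_of_uplus mu01.
set Y := front_of m L mu U.
have pE : plat Y = Uplus mu by exact: front_of_plat.
have x0E : Y (false, 0%N) = U (-1 - L) by rewrite /Y front_of_y subr0.
have y1E : Y (false, 1%N) = U (-2 - L) by rewrite /Y front_of_y; congr U; clear; lia.
have r1 : in_range m L 1%:Z.
  by case: m vL {sU he Y pE x0E y1E} => //= k; apply: le_trans.
have e1E : Y (true, 1%N) = Uplus mu - U (- L).
  by rewrite /Y front_of_e //; congr (_ - U _); clear; lia.
have pgt1 : 1 < plat Y.
  rewrite pE lt_neqAle p1 andbT; apply/eqP => E.
  have : 0 < Num.sqrt (1 - mu) by rewrite sqrtr_gt0 subr_gt0.
  by rewrite -nE -E expr1n subrr ltxx.
have E0 : U (-1 - L) * (well (plat Y) - well (U (-1 - L)) - 2 * d) =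
    - (d * (U (- L) + U (-2 - L))).
  have := eU (-1 - L); have -> : -1 - L - 1 = -2 - L by clear; lia.
  have -> : -1 - L + 1 = - L by clear; lia.
  rewrite /lattice_eq -{1}mE -pE /well /mu_of => E.
  by apply/eqP; rewrite -subr_eq0 -E; apply/eqP; ring.
have hcore : core d (U (-1 - L)) (plat Y).
  split=> //; rewrite E0.
  have b1 := ler_wpM2l (ltW d0) c1; have b2 := ler_wpM2l (ltW d0) c2.
  by clear -b1 b2; apply/andP; split; lra.
have box : in_box d (U (-1 - L)) Y.
  split=> //.
  move=> n.
  have [n' r' E] := front_of_clip mu U n vL.
  by rewrite /Y E front_of_e //; exact: he.
split; last by rewrite pE.
- split=> //; split=> //.
  case=> [[] [|n]] /=; rewrite ?pE.
  + by rewrite x0E e1E y1E -pE E0 pE; ring.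
  + have [q [q1 q2 q3]] := front_of_nb mu n vL sU.
    rewrite -/Y in q1 q2 q3.
    have := eU q; rewrite /lattice_eq -{1}mE q2 q3 /stiff /mu_of.
    have -> : U q = Uplus mu - Y (true, n.+1) by rewrite q1; clear; ring.
    by move=> E; rewrite -[RHS]E; clear; ring.
  + by rewrite x0E.
  + have := eU (-1 - L - n.+1%:Z); rewrite /lattice_eq -{1}mE.
    have -> : -1 - L - n.+1%:Z - 1 = -1 - L - n.+2%:Z by clear; lia.
    have -> : -1 - L - n.+1%:Z + 1 = -1 - L - n%:Z by clear; lia.
    rewrite /Y !front_of_y => E; apply: (@oppr_inj R); rewrite oppr0 -[RHS]E; clear; ring.
- move=> pos.
  rewrite -(fold_sym pos sU); have fr := in_range_fold m L pos.
  case E : (fold m pos + 1 + L) fr => [n|n] fr /=.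
    rewrite -/Y pE /Y front_of_e // opprB addrC subrK; congr U.
    by clear -E; lia.
  by rewrite /Y /front_of /=; congr U; clear -E; lia.
Qed.

(** Row 1 gives e1 (p^2 - 1) <= d (e0 + e2), and e0 <= 6 (p^2 - 1). The gap between 7 d and the 12 d
    of the box is the room for recognizing nearby solutions; likewise x / 800 and x / 32 in
    [front_y_small]. *)
Lemma front_e_small (R : realType) (d x : R) c Y n : front d c x Y ->
  reach c 0 -> reach c 1 -> cfg_ok c -> `|Y (true, n.+1)| <= 7 * d.
Proof.
move=> F r0 r1 ok; have [d0 d1 [bY eY]] := F.
have g i := front_e_gt0 F i; rewrite gtr0_norm //.
apply: le_trans (_ : Y (true, 1%N) <= _).
  case: n => [//|n]; have := front_e_lt F r1 (isT : (1 < n.+2)%N).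
  have := g 1%N; clear => *; lra.
have h0 : Y (true, 0%N) <= 6 * (plat Y ^+ 2 - 1).
  by have := in_box_e 0 d0 d1 bY; rewrite gtr0_norm.
have h2 := front_e_lt F r1 (ltnSn 1); have h1 := front_e_lt F r0 (ltnSn 0).
have st := stiff_lower 0 d0 d1 bY.
have [[_ /andP[n0 _] _ _ _] _] := core_facts d0 d1 (front_core F).
have := eY (true, 1%N); rewrite /= dnb1 // upb1 // => E.
have E' : Y (true, 1%N) * (stiff (plat Y) (Y (true, 1%N)) + 2 * d) =
    d * (Y (true, 0%N) + Y (true, 2%N)) by apply/eqP; rewrite -subr_eq0 -E; apply/eqP; ring.
have b1 : Y (true, 1%N) * (plat Y ^+ 2 - 1) <= d * (7 * (plat Y ^+ 2 - 1)).
  apply: le_trans (_ : Y (true, 1%N) * (stiff (plat Y) (Y (true, 1%N)) + 2 * d) <= _).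
    by rewrite ler_pM2l //; clear -st d0; lra.
  by rewrite E' ler_pM2l //; clear -h0 h1 h2 n0; lra.
by move: b1; rewrite mulrA ler_pM2r // [d * _]mulrC.
Qed.

Lemma front_y_small (R : realType) (d x : R) c Y n : front d c x Y ->
  `|Y (false, n.+1)| <= x / 800.
Proof.
move=> F; have g i := front_y_gt0 F i; rewrite gtr0_norm //.
apply: le_trans (_ : Y (false, 1%N) <= _).
  case: n => [//|n]; have := front_y_lt F (isT : (1 < n.+2)%N).
  have := g 1%N; clear => *; lra.
have [a a9 E] := front_y_ratio F 0; rewrite (front_x F) in E.
have h2 := front_y_lt F (ltnSn 1); have g1 := g 1%N.
have : 900 * Y (false, 1%N) <= a * Y (false, 1%N) by rewrite ler_pM2r.
rewrite E; clear -h2 g1 => *; lra.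
Qed.

(** [Uplus] has a square-root singularity at mu = 1, but |mu - mu_of p| is |Uplus mu - p| times a
    factor that is at least d once p^2 - 1 >= d. *)
Lemma uplus_close (R : realType) (d mu p e : R) : 0 < d -> d <= p ^+ 2 - 1 -> 1 < p ->
  0 < mu < 1 -> `|mu - mu_of p| <= d * e -> `|Uplus mu - p| <= e.
Proof.
move=> d0 n0 p1 /andP[m0 m1] h.
have mu01 : 0 <= mu <= 1 by rewrite !ltW.
have [mE [P1 nE]] := mu_of_uplus mu01; set P := Uplus mu in mE P1 nE *.
have N0 : 0 <= P ^+ 2 - 1 by clear -P1; nra.
have E : mu - mu_of p = - ((P - p) * ((P + p) * (P ^+ 2 - 1 + (p ^+ 2 - 1)))).
  by rewrite -mE /mu_of; ring.
have q : d <= (P + p) * (P ^+ 2 - 1 + (p ^+ 2 - 1)).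
  rewrite -[leLHS]mul1r; apply: ler_pM => //; first by rewrite ltW.
    by clear -P1 p1; lra.
  by clear -n0 N0; lra.
have q0 : 0 < (P + p) * (P ^+ 2 - 1 + (p ^+ 2 - 1)) by apply: lt_le_trans q.
move: h; rewrite E normrN normrM (gtr0_norm q0) => h.
rewrite -(ler_pM2l d0); apply: le_trans h; rewrite mulrC ler_wpM2l //.
Qed.

Lemma phase_close_u (R : realType) (d x u u' : R) : `|phase d x u - phase d x u'| <= `|u - u'|.
Proof.
have -> : phase d x u - phase d x u' = (1 - cut1 d x) * (u - u') by rewrite /phase; ring.
rewrite normrM -[leRHS]mul1r ler_wpM2r // ger0_norm; last by rewrite subr_ge0 smooth_step_le1.
by rewrite gerBl smooth_step_ge0.
Qed.

Lemma tau_inj (R : realType) (d : R) X c x x' : 0 < d -> d <= dmax R -> fronts d X ->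
  xdom d x -> xdom d x' -> tau d X c x = tau d X c x' -> x = x'.
Proof.
move=> d0 d1 hX; wlog xx : x x' / x <= x'.
  by move=> h D D' E; have [xx|/ltW xx] := leP x x'; [|apply/esym]; apply: h.
move=> /xdomP/andP[h1 _] /xdomP/andP[_ h2] E.
have := tau_incr c d0 d1 hX h1 xx h2; rewrite E subrr => h.
by apply: le_anti; rewrite xx /=; clear -h; lra.
Qed.

(** True fronts satisfy the box estimates with room to spare, so a solution close to a heteroclinic
    one is recognized as a front of mode m. Its phase differs from th by at most 1/400 and so stays
    within the overlap margins. *)
Lemma near_front_on_curve (R : realType) (d : R) X iot m : charts d X iot -> exists2 e : R, 0 < e &
  forall L th mu (U : int -> R), valid m (L - 1) -> 0 <= th <= 1 ->
  let Y := state X iot None 0 th in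
  (forall pos, lattice_eq d mu (U pos) (U (pos - 1)) (U (pos + 1)) = 0) ->
  (forall k, m = Some k -> forall pos, U (mir k pos) = U pos) ->
  `|mu - mu_of (plat Y)| <= e ->
  (forall z, in_range m L z -> `|U (-1 - L + z) - profile Y z| <= e) ->
  exists s, [/\ L%:~R - 1 / 200 <= s <= L%:~R + 1 + 1 / 200,
    forall pos, U pos = curve X iot m (Some pos) s & mu = curve X iot m None s].
Proof.
move=> ch; have [d0 d1 hX [hi _ h3 h4]] := ch.
have [K1 K10 [_ K1l]] := uc_ulip (tau_uc 0 d0 d1 hX).
have Xk : uc 0 (xdom d) (fun (ti : cfg * cell) x => X ti.1 x ti.2).
  by apply: (@front_uc R d cfg dnb upb) => // t x Dx; have [_ _] := hX t x Dx.
have [K2 K20 [_ K2l]] := uc_ulip Xk.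
have dm := dmax_mul d1.
(* The first bound preserves the box estimates, one factor d being lost in passing from mu to p; the
   second keeps the phase within 1/400, [K1] and [K2] being Lipschitz constants of phase and
   fronts. *)
pose e := Num.min (d * d / 10) (1 / 400 / (1 + K1 + 3 * K2)).
have W0 : 0 < 1 + K1 + 3 * K2 by clear -K10 K20; lra.
have e0 : 0 < e.
  rewrite lt_min; apply/andP; split; [apply: divr_gt0; [exact: mulr_gt0|by []]|].
  by apply: divr_gt0 W0; clear; lra.
have e1 : e <= d * d / 10 by rewrite ge_min lexx.
have e2 : e * (1 + K1 + 3 * K2) <= 1 / 400 by rewrite -ler_pdivlMr // ge_min lexx orbT.
have e3 : e <= d * (d / 10) by rewrite mulrA.
have e4 : e <= d / 100.
  apply: le_trans e3 _; have : d <= 1 / 100 by clear -dm d0; lra.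
  by move=> h; rewrite ler_pM2l //; clear -h d0; lra.
have ecl : e * K1 <= 1 / 400 /\ e + e * (3 * K2) + e * K1 <= 1 / 400.
  have eK1 : 0 <= e * K1 by rewrite mulr_ge0 // ltW.
  have eK2 : 0 <= e * K2 by rewrite mulr_ge0 // ltW.
  by clear -e2 eK1 eK2 e0; split; lra.
exists e => // L th mu U vL /andP[t0 t1] Y eU sU hmu hU.
have Dth : sdom th by apply/sdomP; clear -t0 t1; lra.
have [Dq tq] := hi None th Dth; set xq := iot None th in Dq tq.
have F : front d None xq Y := state_front None 0 ch Dth.
have /xdomP/andP[q1 q2] := Dq.
have D3 : xdom d (3 * d) by apply/xdomP; clear -dm d0; lra.
(* Phase th >= 0 keeps the active value away from 3 d, where the phase is at most -1/200. *)
have q1' : 3 * d + e <= xq.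
  have := tau_3d None d0 d1 hX; have := K1l None _ _ D3 Dq; rewrite tq => l1 l2.
  have : 1 / 200 <= K1 * (xq - 3 * d).
    move: l1; rewrite [`|xq - _|]ger0_norm ?subr_ge0 // ler_norml.
    by clear -l2 t0 => /andP[_ h]; lra.
  move=> l3; rewrite leNgt; apply/negP => h.
  have : K1 * (xq - 3 * d) <= K1 * e by rewrite ler_wpM2l //; clear -h; lra.
  by case: ecl; clear -l3 => *; lra.
have q2' : xq <= 4 / 3.
  have [D1 E1] : xdom d (iot None 1) /\ tau d X None (iot None 1) = 1.
    by apply: hi; apply/sdomP; clear; lra.
  have I1 : iot None 1 = 4 / 3.
    by have := h4 None 0; rewrite normr0 !addr0; apply; clear; lra.
  rewrite leNgt; apply/negP => h.
  have := tau_incr None d0 d1 hX _ (ltW h) q2; rewrite -I1 E1 -/xq tq.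
  move/xdomP/andP: D1 => [D1 _] /(_ D1); rewrite I1; clear -h t1 => ?; lra.
have U0 : `|U (-1 - L) - xq| <= e.
  have := hU 0; rewrite addr0 profile0 (front_x F); apply.
  by case: m vL {sU hU} => //= k; clear; lia.
have r1 : in_range m L 1 by case: m vL {sU hU} => //= k; clear; lia.
have U1 : `|U (- L) - next_site Y| <= e.
  by have := hU 1 r1; rewrite (_ : -1 - L + 1 = - L) //; clear; lia.
have Um : `|U (-2 - L) - Y (false, 1%N)| <= e.
  have := hU (-1); rewrite (_ : -1 - L + -1 = -2 - L); last by clear; lia.
  by apply; case: m vL {sU hU r1} => //= k; clear; lia.
have [/andP[m1 m2] [_ p1]] := front_mu F.
have hm : 0 < mu < 1.
  move: hmu; rewrite ler_norml => /andP[a1 a2].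
  by clear -a1 a2 m1 m2 e4 d0; apply/andP; split; lra.
have [[_ _ _ nu _] _] := core_facts d0 d1 (front_core F).
have nud : d <= plat Y ^+ 2 - 1 by clear -nu d0; lra.
have pc := uplus_close d0 nud p1 hm (le_trans hmu e3).
have [/andP[n1 n2] _] := front_nbsum F.
have Fe n := @front_e_small _ _ _ _ _ n F isT isT isT.
have Fy n := @front_y_small _ _ _ _ _ n F.
have vL' : valid m L by apply: valid_le vL _; rewrite gerBl.
move: (U0); rewrite ler_norml => /andP[x1 x2].
have hx : 3 * d <= U (-1 - L) <= 34 / 25 by clear -x1 x2 q1' q2' e4 dm d0; apply/andP; split; lra.
have [FY PY mY] : [/\ front d (cfm m L) (U (-1 - L)) (front_of m L mu U),
      forall pos, profile (front_of m L mu U) (fold m pos + 1 + L) = U pos &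
      mu_of (plat (front_of m L mu U)) = mu].
  apply: recognize => //.
  - move=> n rn; have := hU _ rn; rewrite /= => h; have := Fe n.
    move: pc h; rewrite !ler_norml => /andP[b1 b2] /andP[b3 b4] /andP[b5 b6].
    by clear -b1 b2 b3 b4 b5 b6 e4 d0; apply/andP; split; lra.
  - move=> n; have := hU (Negz n); rewrite NegzE => h; have := Fy n.
    have {}h : `|U (-1 - L - n.+1%:Z) - Y (false, n.+1)| <= e.
      by apply: h; case: m vL {sU hU r1 vL'} => //= k; clear; lia.
    move: h; rewrite !ler_norml => /andP[b3 b4] /andP[b5 b6].
    by clear -b3 b4 b5 b6 e4 d0 x1 x2 q1; apply/andP; split; lra.
  - move: U1 Um; rewrite !ler_norml /next_site => /andP[b1 b2] /andP[b3 b4].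
    by clear -b1 b2 b3 b4 n1 n2 e4 d0 dm; rewrite /nbsum in n1 n2; apply/andP; split; lra.
set x := U (-1 - L) in x1 x2 U0 hx FY; set Z := front_of m L mu U in FY PY mY.
have Dx : xdom d x by apply/xdomP.
have XE : X (cfm m L) x = Z.
  have [_ _ f1] := hX (cfm m L) x Dx; have [_ _ f2] := FY.
  exact: front_unique d0 d1 f1 f2.
have nZ : next_site Z = U (- L).
  rewrite /next_site /Z front_of_plat front_of_e // opprB addrC subrK; congr U; clear; lia.
have YE : Y = X None xq by [].
pose N := X None x.
have cl : `|next_site N - next_site Y| <= e * (3 * K2).
  have b i : `|N i - Y i| <= K2 * e.
    by apply: le_trans (K2l (None, i) _ _ Dq Dx) _; rewrite ler_wpM2l.
  have := b (true, 0%N); have := b (false, 0%N); have := b (true, 1%N).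
  rewrite /next_site /plat !ler_norml => /andP[b1 b2] /andP[b3 b4] /andP[b5 b6].
  by clear -b1 b2 b3 b4 b5 b6; apply/andP; split; lra.
set t := tau d X (cfm m L) x.
have tc : `|t - th| <= 1 / 400.
  have l1 : `|tau d X None x - th| <= e * K1.
    by rewrite -tq mulrC; apply: le_trans (K1l None _ _ Dq Dx) _; rewrite ler_wpM2l.
  have := phase_close_u d x (next_site Z) (next_site N).
  rewrite -[phase d x (next_site N)]/(tau d X None x).
  have -> : phase d x (next_site Z) = t by rewrite /t /tau XE.
  have l2 : `|next_site Z - next_site N| <= e + e * (3 * K2).
    rewrite nZ; move: U1 cl; rewrite !ler_norml => /andP[b1 b2] /andP[b3 b4].
    by clear -b1 b2 b3 b4; apply/andP; split; lra.
  move=> /le_trans /(_ l2); move: l1; case: ecl => _ ec.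
  rewrite !ler_norml => /andP[b1 b2] /andP[b3 b4].
  by clear -b1 b2 b3 b4 ec; apply/andP; split; lra.
have Dt : sdom t.
  by move: tc; rewrite ler_norml => /andP[b1 b2]; apply/sdomP; clear -b1 b2 t0 t1; apply/andP; split; lra.
have It : iot (cfm m L) t = x.
  have [D' E'] := hi (cfm m L) t Dt.
  exact: (@tau_inj _ d X (cfm m L) _ _ d0 d1 hX D' Dx E').
have SE : state X iot m L t = Z by rewrite /state It XE.
have cE j : curve X iot m j (L%:~R + t) = piece X iot m L j t.
  by have := @curve_piece _ d X iot m L j (L%:~R + t) ch vL; rewrite [L%:~R + t]addrC addrK; apply.
exists (L%:~R + t); split.
- by move/sdomP: Dt; clear => /andP[b1 b2]; apply/andP; split; lra.
- by move=> pos; rewrite cE /piece SE PY.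
- by rewrite cE /piece SE mY.
Qed.

(** * Curves of sequences *)

Section SeqparTopology.
Variables (R : realType) (V : normedModType R).
Implicit Types (p q : seqpar R V) (P : set (seqpar R V)).

Lemma seqpar_nbhs p P : nbhs p P <-> exists2 e : R, 0 < e &
  forall q, (forall n, `|q.1 n - p.1 n| < e) -> `|q.2 - p.2| < e -> P q.
Proof.
split.
  move=> [[P1 P2] /= [/uniform_nbhs [E [entE sE]] hP2] sP].
  move: entE; rewrite -entourage_ballE => -[e1 /= e10 sE1].
  have /nbhs_ballP[e2 /= e20 sB] := hP2.
  exists (Num.min e1 e2); first by rewrite lt_min e10.
  move=> q h1 h2; apply: sP; split => /=.
    apply: sE => n _; apply: sE1; rewrite /= -ball_normE /= distrC.
    by apply: lt_le_trans (h1 n) _; rewrite ge_min lexx.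
  apply: sB; rewrite -ball_normE /= distrC; apply: lt_le_trans h2 _.
  by rewrite ge_min lexx orbT.
move=> [e e0 h].
exists ([set w | forall n, ball (p.1 n) e (w n)], ball p.2 e) => /=.
  split; last exact: nbhsx_ballx.
  apply/uniform_nbhs; exists [set xy | ball xy.1 e xy.2]; split.
    exact: (entourage_ball V (PosNum e0)).
  by move=> w /= hw n; exact: hw.
move=> q [/= h1 h2]; apply: h; last by move: h2; rewrite -ball_normE /= distrC.
by move=> n; have := h1 n; rewrite -ball_normE /= distrC.
Qed.

Lemma seqpar_cvg (T : Type) (F : set_system T) (f : T -> seqpar R V) p : Filter F ->
  (forall e : R, 0 < e -> \forall t \near F,
     (forall n, `|(f t).1 n - p.1 n| < e) /\ `|(f t).2 - p.2| < e) ->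
  f @ F --> p.
Proof.
move=> FF h P /seqpar_nbhs[e e0 sP].
by apply: filterS (h e e0) => t [h1 h2]; exact: sP.
Qed.

(** A uniform neighbourhood of G meets H only in G. Hence, for a connected C inside H through p, the
    part of C in G is open and closed in C, so it is all of C. *)
Lemma connected_component_isolated (H G : set (seqpar R V)) p (e : R) : 0 < e -> G p ->
  G `<=` H -> connected G ->
  (forall g q, G g -> H q -> (forall n, `|q.1 n - g.1 n| < e) -> `|q.2 - g.2| < e -> G q) ->
  G = connected_component H p.
Proof.
move=> e0 Gp GH cG iso; apply/seteqP; split; first exact: connected_component_max.
move=> q [C [Cp CH cC] Cq].
suff E : C `&` G = C by move: Cq; rewrite -E => -[].
apply: cC; first by exists p.
  exists (interior (~` H `|` G)); first exact: open_interior.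
  apply/seteqP; split=> r [Cr hr]; split=> //.
    apply/seqpar_nbhs; exists e => // s h1 h2.
    by have [Hs|] := pselect (H s); [right; exact: (iso r)|left].
  by have [nH|//] := interior_subset hr; case: nH; exact: CH.
exists (closure G); first exact: closed_closure.
apply/seteqP; split=> r [Cr hr]; split=> //; first exact: subset_closure.
have /hr [g [Gg [g1 g2]]] : nbhs r [set g : seqpar R V |
    (forall n, `|r.1 n - g.1 n| < e) /\ `|r.2 - g.2| < e].
  by apply/seqpar_nbhs; exists e => // s h1 h2; split=> [n|]; rewrite distrC.
by apply: (iso g) => //; exact: CH.
Qed.
End SeqparTopology.

Section Jets.
Variables (R : realType) (V : normedModType R) (read : (int -> R) -> int -> V).

(** [read] is the identity for lattice states and [orbit_of] for orbits of the map. It may neither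
    enlarge the error of a difference quotient nor lose a nonzero velocity. *)
Definition faithful : Prop :=
  (forall (a B : R) u u' u'', (forall n, `|a * (u n - u' n) - u'' n| <= B) ->
     forall n, `|a *: (read u n - read u' n) - read u'' n| <= B) /\
  (forall u, (forall n, read u n = 0) -> forall n, u n = 0).

Definition jet (c : option int -> R -> R) (j : nat) (s : R) : seqpar R V :=
  (read (fun n => derive1n j (c (Some n)) s), derive1n j (c None) s).

Definition smooth_near (c : option int -> R -> R) (s : R) : Prop :=
  exists D, [/\ open D, D s & forall k, uc k D c].

(** The Taylor remainder is quadratic uniformly in the site, which is differentiability in l^oo. *)
Lemma jet_diff c j s (A : set R) : faithful -> smooth_near c s ->
  difference_quotient (jet c j) s @ within A s^' --> jet c j.+1 s.
Proof.
move=> [rd _] [D [oD Ds ucD]].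
have [_ [C C0 hC]] := uc_derive1 oD (uc_derive1n (k := 1) (n := j) oD (ucD _)).
apply: seqpar_cvg => e e0.
have Ce : 0 < e / (C + 1) by rewrite divr_gt0 //; clear -C0; lra.
have key t : D t -> t != s -> `|t - s| < e / (C + 1) -> forall i,
    `|(t - s)^-1 * (derive1n j (c i) t - derive1n j (c i) s) - derive1n j.+1 (c i) s| <= C * (e / (C + 1)).
  move=> Dt ts tse i; rewrite derive1nS.
  have -> : (t - s)^-1 * (derive1n j (c i) t - derive1n j (c i) s) - derive1 (derive1n j (c i)) s =
     (t - s)^-1 * (derive1n j (c i) t - derive1n j (c i) s - (t - s) * derive1 (derive1n j (c i)) s).
    by rewrite [in RHS]mulrBr mulrA mulVf ?subr_eq0 // mul1r.
  have ts0 : 0 < `|t - s| by rewrite normr_gt0 subr_eq0.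
  rewrite normrM normfV mulrC ler_pdivrMr //; apply: le_trans (hC i s t Ds Dt) _.
  by rewrite expr2 mulrA ler_wpM2r ?normr_ge0 // ler_wpM2l // ltW.
have lt_e : C * (e / (C + 1)) < e.
  have C1 : 0 < C + 1 by clear -C0; lra.
  rewrite mulrA ltr_pdivrMr // mulrC ltr_pM2l //; clear; lra.
rewrite near_withinE; near=> t => At.
have Dt : D t by near: t; apply: nbhs_dnbhs; apply: open_nbhs_nbhs.
have ts : t != s by near: t; exact: nbhs_dnbhs_neq.
have tse : `|t - s| < e / (C + 1).
  near: t; apply: nbhs_dnbhs; rewrite -/(nbhs s _).
  by apply/nbhs_ballP; exists (e / (C + 1)) => //= t; rewrite /ball /= distrC.
have k := key t Dt ts tse; split=> [n|] /=; last exact: le_lt_trans (k None) lt_e.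
by apply: le_lt_trans (rd _ _ _ _ _ _ n) lt_e => i; exact: (k (Some i)).
Unshelve. all: by end_near.
Qed.

Lemma jet_continuous c s : faithful -> smooth_near c s -> {for s, continuous (jet c 0)}.
Proof.
move=> [rd _] [D [oD Ds ucD]]; have [C C0 [_ hC]] := uc_ulip (ucD 0%N).
apply: seqpar_cvg => e e0.
have C1 : 0 < C + 1 by clear -C0; lra.
have Ce : 0 < e / (C + 1) by rewrite divr_gt0.
near=> t.
have Dt : D t by near: t; exact: (open_nbhs_nbhs (conj oD Ds)).
have tse : `|t - s| < e / (C + 1).
  by near: t; apply/nbhs_ballP; exists (e / (C + 1)) => //= t; rewrite /ball /= distrC.
have key i : `|c i t - c i s| <= C * (e / (C + 1)).
  by apply: le_trans (hC i s t Ds Dt) _; rewrite ler_wpM2l // ltW.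
have lt_e : C * (e / (C + 1)) < e by rewrite mulrA ltr_pdivrMr // mulrC ltr_pM2l //; clear; lra.
split=> [n|] /=; last exact: le_lt_trans (key None) lt_e.
have := rd 1 (C * (e / (C + 1))) (fun n => c (Some n) t) (fun n => c (Some n) s) (fun=> 0) .
have z : read (fun=> 0) n = 0.
  have h0 (m : int) : `|0 * (0 - 0) - 0| <= 0 :> R.
    by rewrite mul0r subrr normr0.
  have := rd 0 0 (fun=> 0) (fun=> 0) (fun=> 0) h0 n.
  by rewrite scale0r sub0r normrN normr_le0 => /eqP.
rewrite /= => /(_ _ n); rewrite scale1r z subr0 => h; apply: le_lt_trans (h _) lt_e => i.
by rewrite mul1r subr0.
Unshelve. all: by end_near.
Qed.

Lemma jet_neq0 c s n : faithful -> derive1 (c (Some n)) s != 0 -> jet c 1 s <> ((fun=> 0), 0).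
Proof.
move=> [_ rd] /eqP h [E _]; apply: h.
rewrite -derive1n1; apply: (rd (fun n => derive1n 1 (c (Some n)) s)) => m.
by move/(congr1 (@^~ m)): E.
Qed.

Lemma jet_smooth_curve c (A : set R) : faithful -> (forall s, A s -> smooth_near c s) ->
  (forall s, A s -> exists n, derive1 (c (Some n)) s != 0) -> smooth_curve A (jet c).
Proof.
move=> fr sm nz; split=> [j s As|s As]; first exact: jet_diff fr (sm s As).
by have [n hn] := nz s As; exact: jet_neq0 fr hn.
Qed.
End Jets.

Lemma orbit_of_faithful (R : realType) : faithful (@orbit_of R).
Proof.
split=> [a B u u' u'' h n|u h n].
  by rewrite /orbit_of /= prod_normE /= ge_max; apply/andP; split; exact: h.
by have [] := h n.
Qed.

Lemma id_faithful (R : realType) : @faithful R R^o id.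
Proof. by split. Qed.

(** A vanishing derivative would make f t - f s quadratic in t - s, against the linear lower
    bound. *)
Lemma derive1_neq0 (R : realType) (f : R -> R) (D : set R) s K : open D -> D s ->
  uc 1 D (fun _ : unit => f) -> (forall t, D t -> `|t - s| <= K * `|f t - f s|) ->
  derive1 f s != 0.
Proof.
move=> oD Ds ucD hK; apply/eqP => f0.
have [_ [C C0 hC]] := uc_derive1 oD ucD.
have /(nbhs_ballP s D) [r /= r0 hr] : nbhs s D by exact: open_nbhs_nbhs.
have W : 0 < 1 + `|K| * C by have := mulr_ge0 (normr_ge0 K) C0; clear => *; lra.
pose h := Num.min (r / 2) ((1 / 2) / (1 + `|K| * C)).
have h0 : 0 < h by rewrite lt_min divr_gt0 //= divr_gt0 //; clear; lra.
have hr2 : h <= r / 2 by rewrite ge_min lexx.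
have hW : h * (1 + `|K| * C) <= 1 / 2 by rewrite -ler_pdivlMr // ge_min lexx orbT.
have Dt : D (s + h).
  by apply: hr; rewrite /ball /= opprD addrA subrr sub0r normrN gtr0_norm //; clear -hr2 r0; lra.
have := hC tt s (s + h) Ds Dt; rewrite f0 mulr0 subr0 [s + h]addrC addrK => h1.
have := hK (s + h) Dt; rewrite [s + h]addrC addrK (gtr0_norm h0) => h2.
have h3 : h <= `|K| * (C * h ^+ 2).
  apply: le_trans h2 _; apply: le_trans (_ : `|K| * `|f (h + s) - f s| <= _).
    by rewrite ler_wpM2r // ler_norm.
  by move: h1; rewrite (gtr0_norm h0) => h1; exact: ler_wpM2l.
have h4 : `|K| * (C * h ^+ 2) = h * (h * (1 + `|K| * C) - h) by ring.
rewrite h4 in h3; have : h * (h * (1 + `|K| * C) - h) <= h * (1 / 2).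
  by rewrite ler_pM2l //; clear -hW h0; lra.
clear -h0 h3; lra.
Qed.

Lemma derive1n_translate (R : realType) (f : R -> R) (a : R) j s :
  derive1n j (fun t => f (t + a)) s = derive1n j f (s + a).
Proof.
elim: j s => [|j IH] s; first by rewrite !derive1n0.
rewrite !derive1nS /derive1 (funext IH).
have -> : (fun h : R => h^-1 *: (derive1n j f (h + s + a) - derive1n j f (s + a))) =
  (fun h : R => h^-1 *: (derive1n j f (h + (s + a)) - derive1n j f (s + a))) by apply/funext => h; rewrite addrA.
by [].
Qed.

(** * The loop and the homoclinic curves *)

Section CurveFacts.
Variable R : realType.
Implicit Types (d s t a e : R) (X : cfg -> R -> cell -> R) (iot : cfg -> R -> R) (m : mode) (L : int).

Lemma near_pt_open s : open (near_pt s).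
Proof. exact: ball_open. Qed.

Lemma near_pt_self s : near_pt s s.
Proof. by apply: ballxx; clear; lra. Qed.

Lemma curve_smooth d X iot m s a : charts d X iot -> valid m (Num.floor (s + a) - 1) ->
  smooth_near (fun j t => curve X iot m j (t + a)) s.
Proof.
move=> ch v; exists (near_pt s); split; [exact: near_pt_open|exact: near_pt_self|] => k.
have ck := curve_uc k ch v.
have tr : uc k (near_pt s) (fun (_ : unit) t => t + a).
  apply: uc_add; last exact: uc_cst.
  apply: (@uc_id _ _ _ _ (`|s| + 1)) => t; rewrite /near_pt /ball /= => h.
  have := ler_normB s (s - t); rewrite opprB addrC subrK => h2.
  by apply: le_trans h2 _; rewrite lerD2l; clear -h; lra.
have ran (u : unit) t : near_pt s t -> near_pt (s + a) (t + a).
  by rewrite /near_pt /ball /= [t + a]addrC opprD addrA addrK.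
by apply: uc_ext (uc_reindex (fun j => (j, tt)) (uc_comp ran ck tr)).
Qed.

Lemma floor_sdom s : sdom (s - (Num.floor s)%:~R) /\ 0 <= s - (Num.floor s)%:~R < 1.
Proof.
split; first by apply: near_floor; exact: near_pt_self.
by have /andP[f1 f2] := floor_itv s; rewrite intrD in f2; clear -f1 f2; apply/andP; split; lra.
Qed.

Definition active_site m L : int := -1 - L.

Lemma fold_active m L : valid m L -> fold m (active_site m L) + 1 + L = 0.
Proof.
move=> vL; have -> : fold m (active_site m L) = -1 - L; last by clear; lia.
by case: m vL => [k|] //= L2; rewrite /active_site ifT //; clear -L2; lia.
Qed.

Lemma curve_active d X iot m L s : charts d X iot -> valid m (L - 1) -> sdom (s - L%:~R) ->
  curve X iot m (Some (active_site m L)) s = iot (cfm m L) (s - L%:~R).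
Proof.
move=> ch vL Ds; have vL' : valid m L by apply: valid_le vL _; rewrite gerBl.
rewrite (curve_piece _ ch vL Ds) /piece fold_active // profile0.
exact: front_x (state_front m L ch Ds).
Qed.

(** The phase is a Lipschitz function of the active value, so the active value moves at nonzero
    speed. *)
Lemma curve_speed d X iot m s a : charts d X iot -> valid m (Num.floor (s + a) - 1) ->
  exists n, derive1 (fun t => curve X iot m (Some n) (t + a)) s != 0.
Proof.
move=> ch v; have [d0 d1 hX [hi _ _ _]] := ch; exists (active_site m (Num.floor (s + a))).
have [D [oD Ds ucD]] := curve_smooth ch v.
have [K K0 [_ Kl]] := uc_ulip (tau_uc 0 d0 d1 hX).
pose E := D `&` near_pt s.
have oE : open E by apply: openI => //; exact: near_pt_open.
apply: (@derive1_neq0 _ _ E _ K oE).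
- by split=> //; exact: near_pt_self.
- apply: uc_ext (uc_reindex (fun _ : unit => Some (active_site m (Num.floor (s + a)))) (ucD 1%N)) => // t [] //.
- move=> t [_ nt].
  have D1 : sdom (t + a - (Num.floor (s + a))%:~R).
    by apply: near_floor; move: nt; rewrite /near_pt /ball /= [t + a]addrC opprD addrA addrK.
  have [D2 _] := floor_sdom (s + a).
  rewrite (curve_active ch v D1) (curve_active ch v D2).
  have [x1 t1] := hi (cfm m (Num.floor (s + a))) _ D1; have [x2 t2] := hi (cfm m (Num.floor (s + a))) _ D2.
  by have := Kl (cfm m (Num.floor (s + a))) _ _ x2 x1; rewrite t1 t2 opprB addrA subrK opprD addrACA subrr addr0.
Qed.

Lemma curve_front d X iot m s : charts d X iot ->
  exists2 x, front d (cfm m (Num.floor s)) x (state X iot m (Num.floor s) (s - (Num.floor s)%:~R)) &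
  x = iot (cfm m (Num.floor s)) (s - (Num.floor s)%:~R).
Proof. by move=> ch; have [Ds _] := floor_sdom s; eexists; [exact: state_front|]. Qed.

Lemma curve_lattice d X iot m s pos : charts d X iot -> valid m (Num.floor s) ->
  lattice_eq d (curve X iot m None s) (curve X iot m (Some pos) s)
    (curve X iot m (Some (pos - 1)) s) (curve X iot m (Some (pos + 1)) s) = 0.
Proof. by move=> ch v; have [x F _] := curve_front m s ch; exact: fold_eq F v. Qed.

Lemma curve_mir X iot k s pos :
  curve X iot (Some k) (Some (mir k pos)) s = curve X iot (Some k) (Some pos) s.
Proof. by rewrite /curve /piece fold_mir. Qed.

Lemma curve_bound d X iot m s pos : charts d X iot -> `|curve X iot m (Some pos) s| <= 10.
Proof. by move=> ch; have [x F _] := curve_front m s ch; exact: profile_bound F. Qed.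

Lemma curve_mu d X iot m s : charts d X iot -> d <= curve X iot m None s <= 1 - d / 4.
Proof. by move=> ch; have [x F _] := curve_front m s ch; have [] := front_mu F. Qed.

Lemma curve_uplus d X iot m s : charts d X iot ->
  Uplus (curve X iot m None s) = plat (state X iot m (Num.floor s) (s - (Num.floor s)%:~R)).
Proof. by move=> ch; have [x F _] := curve_front m s ch; have [_ []] := front_mu F. Qed.

Lemma geom_small (e : R) : 0 < e -> exists N : nat, forall n, (N <= n)%N -> 6 * 3^-1 ^+ n < e.
Proof.
move=> e0; have c : (fun n : nat => 6 * 3^-1 ^+ n : R) @ \oo --> (6 * 0 : R).
  by apply: cvgZr; apply: cvg_expr; rewrite ger0_norm //; clear; lra.
rewrite mulr0 in c; have /cvgrPdist_lt /(_ e e0) [N _ hN] := c.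
exists N => n Nn; have := hN n Nn; rewrite /= sub0r normrN; apply: le_lt_trans; exact: ler_norm.
Qed.

Lemma profile_left e : 0 < e -> exists Z : int, forall z, z <= Z ->
  forall d c x Y, front d c x Y -> `|profile Y z| < e.
Proof.
move=> e0; have [N hN] := geom_small e0; exists (- N%:Z) => z zN d c x Y F.
have [n zn nN] : exists2 n : nat, z = - n%:Z & (N <= n)%N.
  by exists (absz z); move: zN; clear; lia.
rewrite zn profile_neg gtr0_norm; last exact: front_y_gt0 F n.
exact: le_lt_trans (front_y_geom n F) (hN n nN).
Qed.

Lemma profile_right e : 0 < e -> exists2 Z : nat, (0 < Z)%N &
  forall d c x Y (z : int), front d c x Y -> Z%:Z <= z ->
  (forall n : nat, n%:Z < z -> reach c n) -> `|profile Y z - plat Y| < e.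
Proof.
move=> e0; have [N hN] := geom_small e0; exists N.+1 => // d c x Y z F.
case: z => [n|//] zN rc /=; rewrite addrAC subrr add0r normrN gtr0_norm; last exact: front_e_gt0 F n.
apply: le_lt_trans (front_e_geom F _) (hN n _); last by move: zN; clear; lia.
by move=> p pn; apply: rc; rewrite ltz_nat.
Qed.

Lemma curve_left d X iot m s e : charts d X iot -> 0 < e ->
  exists Z : int, forall z, z <= Z -> `|curve X iot m (Some z) s| < e.
Proof.
move=> ch e0; have [Z hZ] := profile_left e0; have [x F _] := curve_front m s ch.
exists (Num.min (-1) (Z - 1 - Num.floor s)) => z; rewrite le_min => /andP[z1 z2].
rewrite /curve /piece fold_neg; last by clear -z1; lia.
by apply: hZ F; clear -z2; lia.
Qed.

Lemma curve_right d X iot s e : charts d X iot -> 0 < e ->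
  exists Z : int, forall z, Z <= z ->
  `|curve X iot None (Some z) s - Uplus (curve X iot None None s)| < e.
Proof.
move=> ch e0; have [N _ hN] := profile_right e0; have [x F _] := curve_front None s ch.
exists (N%:Z - 1 - Num.floor s) => z zN; rewrite (curve_uplus _ _ ch).
by apply: hN F _ _ => //; rewrite /fold; clear -zN; lia.
Qed.

Lemma iot_lt d X iot c s : charts d X iot -> 0 <= s < 1 -> iot c s < 4 / 3.
Proof.
move=> ch /andP[s0 s1]; have [d0 d1 hX [hi _ _ h4]] := ch.
have Ds : sdom s by apply/sdomP; clear -s0 s1; apply/andP; split; lra.
have D1 : sdom (1 : R) by apply/sdomP; clear; apply/andP; split; lra.
have [/xdomP/andP[x1 x2] xt] := hi c s Ds; have [/xdomP/andP[y1 y2] yt] := hi c 1 D1.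
have I1 : iot c 1 = 4 / 3.
  by have := h4 c 0; rewrite normr0 !addr0; apply; clear; lra.
rewrite ltNge; apply/negP => h; rewrite -I1 in h.
have := tau_incr c d0 d1 hX y1 h x2; rewrite xt yt; clear -s1 h => ?; lra.
Qed.

Lemma iot_next d X iot m L s : charts d X iot -> 0 <= s < 1 -> iot (cfm m L) s <= 4 * d ->
  4 / 3 <= next_site (state X iot m L s).
Proof.
move=> ch /andP[s0 s1] h; have [d0 d1 hX [hi _ _ _]] := ch.
have Ds : sdom s by apply/sdomP; clear -s0 s1; apply/andP; split; lra.
have [_] := hi (cfm m L) s Ds; rewrite /tau phase_start // => E.
by rewrite -subr_ge0 /state E.
Qed.

(** For equal integer parts the active value determines the phase; for different ones the same
    sequence would have two active sites, which [no_double_front] excludes. *)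
Lemma curve_inj d X iot m s t : charts d X iot -> valid m (Num.floor s) -> valid m (Num.floor t) ->
  (forall j, curve X iot m j s = curve X iot m j t) -> s = t.
Proof.
move=> ch; have [d0 d1 hX [hi _ _ _]] := ch.
wlog st : s t / Num.floor s <= Num.floor t.
  move=> W vs vt E; have [h|/ltW h] := leP (Num.floor s) (Num.floor t); first exact: W.
  by apply/esym; apply: W.
move=> vs vt E; have [Ds s1] := floor_sdom s; have [Dt t1] := floor_sdom t.
move: st; rewrite le_eqVlt => /orP[/eqP st|st].
  have := E (Some (active_site m (Num.floor s))); rewrite -st in Dt.
  rewrite /curve /piece -st fold_active // !profile0.
  rewrite (front_x (state_front m _ ch Ds)) (front_x (state_front m _ ch Dt)).
  move/(congr1 (tau d X (cfm m (Num.floor s)))).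
  by have [_ ->] := hi (cfm m (Num.floor s)) _ Ds; have [_ ->] := hi (cfm m (Num.floor s)) _ Dt => /addIr.
have [x F xE] := curve_front m s ch; have [y G yE] := curve_front m t ch.
have [n nE n0] : exists2 n : nat, Num.floor t = Num.floor s + n%:Z & (0 < n)%N.
  by exists (absz (Num.floor t - Num.floor s)); move: st; clear; lia.
exfalso; apply: (@no_double_front _ _ _ _ _ _ _ _ n _ F G).
- by case: m vt {vs E F xE G yE Ds Dt} => //= k; clear; lia.
- by rewrite xE (iot_lt _ ch).
- by rewrite yE; exact: iot_next ch t1.
- by rewrite -!(curve_uplus _ _ ch) E.
- exact: n0.
- rewrite -(front_x G) -profile_neg -profile0.
  have <- : fold m (active_site m (Num.floor t)) + 1 + Num.floor s = - n%:Z.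
    by have := fold_active vt; rewrite nE; clear; lia.
  by have := E (Some (active_site m (Num.floor t))); rewrite /curve /piece => ->; rewrite fold_active.
- rewrite -(front_x F) -profile0.
  have := E (Some (active_site m (Num.floor s))); rewrite /curve /piece (fold_active vs) => ->.
  have -> : fold m (active_site m (Num.floor s)) + 1 + Num.floor t = n%:Z.
    by have := fold_active vs; rewrite nE; clear; lia.
  by [].
Qed.
End CurveFacts.

(** * Lattice steady states and orbits of the map *)

Section Orbits.
Variable R : realType.
Implicit Types (d mu e : R) (U : int -> R) (w : int -> R * R).

Definition steady d mu U := forall n, lattice_eq d mu (U n) (U (n - 1)) (U (n + 1)) = 0.

Lemma steady_orbit d mu U : 0 < d -> steady d mu U -> is_orbit d mu (orbit_of U).
Proof.
move=> d0 eU n; have d1 : d != 0 by rewrite gt_eqF.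
rewrite /orbit_of /map_F /= addrK; congr (_, _).
by have := eU n; rewrite /lattice_eq => E; apply: (mulfI d1); rewrite mulrDr mulVKf //; clear -E; lra.
Qed.

Lemma orbit_steady d mu w : 0 < d -> is_orbit d mu w ->
  w = orbit_of (fun n => (w n).2) /\ steady d mu (fun n => (w n).2).
Proof.
move=> d0 ow; have d1 : d != 0 by rewrite gt_eqF.
have e n : (w n).1 = (w (n - 1)).2 by have := ow (n - 1); rewrite subrK => ->.
split; first by apply/funext => n; rewrite /orbit_of -e; case: (w n).
move=> n; rewrite /lattice_eq -e ow /map_F /=; field.
exact: d1.
Qed.

Definition lim_left U (l : R) := forall e, 0 < e -> exists Z : int, forall z, z <= Z -> `|U z - l| < e.
Definition lim_right U (l : R) := forall e, 0 < e -> exists Z : int, forall z, Z <= z -> `|U z - l| < e.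

Lemma tends_minus U (l : R) : lim_left U l -> tends_at_minus_infinity (orbit_of U) (l, l).
Proof.
move=> h.
have c k : (fun n : nat => U (- n%:Z + k)) @ \oo --> l.
  apply/cvgrPdist_lt => e e0; have [Z hZ] := h e e0.
  near=> n; rewrite distrC; apply: hZ.
  have : (absz Z + absz k <= n)%N by near: n; exact: nbhs_infty_ge.
  by clear; lia.
have c0 : (fun n : nat => U (- n%:Z)) @ \oo --> l.
  by have := c 0; under eq_fun do rewrite addr0.
exact: (cvg_pair (c (-1)) c0).
Unshelve. all: by end_near.
Qed.

Lemma tends_plus U (l : R) : lim_right U l -> tends_at_plus_infinity (orbit_of U) (l, l).
Proof.
move=> h.
have c k : (fun n : nat => U (n%:Z + k)) @ \oo --> l.
  apply/cvgrPdist_lt => e e0; have [Z hZ] := h e e0.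
  near=> n; rewrite distrC; apply: hZ.
  have : (absz Z + absz k <= n)%N by near: n; exact: nbhs_infty_ge.
  by clear; lia.
have c0 : (fun n : nat => U (n%:Z)) @ \oo --> l.
  by have := c 0; under eq_fun do rewrite addr0.
exact: (cvg_pair (c (-1)) c0).
Unshelve. all: by end_near.
Qed.

Lemma orbit_bounded U (M : R) : (forall n, `|U n| <= M) -> bounded_fun (orbit_of U).
Proof.
move=> h; exists M; split; first exact: num_real.
move=> B MB n _; apply: le_trans (ltW MB).
by rewrite prod_normE /= ge_max !h.
Qed.
End Orbits.

Definition curve_from (R : realType) X iot m (a : R) (j : option int) (t : R) :=
  curve X iot m j (t + a).

Arguments curve {R} X iot m j s : simpl never.
Arguments curve_from {R} X iot m a j t : simpl never.

(** * The 1-loop of heteroclinic orbits *)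

Section Heteroclinic.
Variable R : realType.
Implicit Types (d s t e : R) (X : cfg -> R -> cell -> R) (iot : cfg -> R -> R) (m : mode).

(** All turns are included: the component is a line in l^oo that closes up only modulo shifts. *)
Definition loop X iot : set (seqpar R (R * R)%type) :=
  range (jet (@orbit_of R) (curve_from X iot None 0) 0).

(** Without a centre the front does not depend on L, so z further turns only translate the
    sequence. *)
Lemma curve_translate X iot (z : int) j s : curve X iot None j (s + z%:~R) =
  curve X iot None (if j is Some pos then Some (pos + z) else None) s.
Proof.
have F : Num.floor (s + z%:~R) = Num.floor s + z.
  have /andP[f1 f2] := floor_itv s; rewrite intrD in f2.
  by apply/floor_def; rewrite !intrD; clear -f1 f2; apply/andP; split; lra.
rewrite /curve F intrD [s + _]addrC [_%:~R + z%:~R]addrC opprD addrACA subrr add0r /piece /state /=.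
by case: j => [pos|] //=; congr (profile _ _); clear; lia.
Qed.

Lemma loop_shift X iot z s : shift_seq z (jet (@orbit_of R) (curve_from X iot None 0) 0 s) =
  jet (@orbit_of R) (curve_from X iot None 0) 0 (s + z%:~R).
Proof.
have E j : curve_from X iot None 0 j (s + z%:~R) =
    curve_from X iot None 0 (if j is Some pos then Some (pos + z) else None) s.
  by rewrite /curve_from addrAC curve_translate.
rewrite /shift_seq /jet /= E; congr (_, _); apply/funext => n.
rewrite /orbit_of /= !E; congr (_, _).
by congr curve_from; congr Some; clear; lia.
Qed.

Lemma loop_heteroclinic d X iot : charts d X iot ->
  loop X iot `<=` heteroclinics d `[d, 1 - d / 8]%classic.
Proof.
move=> ch _ [s _ <-]; have [d0 d1 _ _] := ch.
rewrite /jet /curve_from /=; set r := s + 0.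
have /andP[mu1 mu2] := curve_mu None r ch; split=> /=.
- by rewrite in_itv /= mu1 /=; clear -mu2 d0; lra.
- by apply: (@orbit_bounded _ _ 10) => n; exact: curve_bound ch.
- by apply: steady_orbit => // n; exact: curve_lattice ch _.
- apply: tends_minus => e e0; have [Z hZ] := curve_left None r ch e0.
  by exists Z => z zZ; rewrite subr0; exact: hZ.
- by apply: tends_plus => e e0; exact: curve_right ch e0.
Qed.

Lemma loop_connected d X iot : charts d X iot -> connected (loop X iot).
Proof.
move=> ch; apply: connected_continuous_connected.
  by apply/connected_intervalP.
apply: continuous_subspaceT => s; apply: jet_continuous; first exact: orbit_of_faithful.
exact: curve_smooth ch _.
Qed.

Lemma near_loop d X iot m : charts d X iot -> exists2 e : R, 0 < e &
  forall L s mu U, valid m (L - 1) -> steady d mu U ->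
  (forall k, m = Some k -> forall pos, U (mir k pos) = U pos) ->
  `|mu - curve X iot None None s| <= e ->
  (forall z, in_range m L z -> `|U (-1 - L + z) - curve X iot None (Some (-1 - Num.floor s + z)) s| <= e) ->
  exists t, [/\ L%:~R - 1 / 200 <= t <= L%:~R + 1 + 1 / 200,
    U = (fun pos => curve X iot m (Some pos) t) & mu = curve X iot m None t].
Proof.
move=> ch; have [e e0 hp] := near_front_on_curve m ch; exists e => // L s mu U vL eU sU h1 h2.
have [_ /andP[s0 s1]] := floor_sdom s; have th : 0 <= s - (Num.floor s)%:~R <= 1 by rewrite s0 ltW.
have [||t [t1 t2 t3]] := hp L _ mu U vL th eU sU.
- exact: h1.
- move=> z rz; have := h2 z rz; rewrite /curve /piece /=.
  by have -> : -1 - Num.floor s + z + 1 + Num.floor s = z by clear; lia.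
- by exists t; split=> //; apply/funext.
Qed.

(** The loop is connected as the image of the line and isolated by recognition: heteroclinic orbits
    uniformly close to it lie on it. *)
Lemma loop_component d X iot : charts d X iot -> exists2 p,
  heteroclinics d `[d, 1 - d / 8]%classic p &
  loop X iot = connected_component (heteroclinics d `[d, 1 - d / 8]%classic) p.
Proof.
move=> ch; have [d0 _ _ _] := ch; have [e e0 hn] := near_loop None ch.
set p := jet (@orbit_of R) (curve_from X iot None 0) 0 0.
have lp : loop X iot p by exists 0.
exists p; first exact: loop_heteroclinic ch _ lp.
apply: (connected_component_isolated e0) => //.
- exact: loop_heteroclinic ch.
- exact: loop_connected ch.
- move=> _ [w mu] [s _ <-] [_ _ ow _ _]; rewrite /jet /curve_from /= => h1 h2.
  have [wE sw] := orbit_steady d0 ow; rewrite /= in wE sw.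
  have [|||||t [_ t2 t3]] := hn (Num.floor (s + 0)) (s + 0) mu (fun n => (w n).2).
  + by [].
  + exact: sw.
  + by [].
  + exact: ltW.
  + move=> z _; apply: ltW; apply: le_lt_trans (h1 (-1 - Num.floor (s + 0) + z)).
    by rewrite prod_normE /= le_max lexx orbT.
  exists t => //; rewrite /jet /curve_from /= addr0 -t3; congr (_, _).
  by rewrite wE t2.
Qed.

Lemma loop_one_loop d X iot : charts d X iot -> one_loop d `[d, 1 - d / 8] (loop X iot).
Proof.
move=> ch; split; first exact: loop_component ch.
(* [shift_seq z] advances s by z, so S^(-1) takes s = 1 to s = 0. Translation of s commutes with
   derivatives, which closes the loop to every order. *)
exists (jet (@orbit_of R) (curve_from X iot None 0)), (-1); split.
- apply: jet_smooth_curve; first exact: orbit_of_faithful.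
    by move=> s _; exact: curve_smooth ch _.
  by move=> s _; exact: curve_speed ch _.
- by move=> _ [s _ <-]; exists s.
- move=> _ [s _ <-]; have [_ /andP[s0 s1]] := floor_sdom s.
  exists (s - (Num.floor s)%:~R); first by rewrite /= in_itv /= s0 ltW.
  by exists (Num.floor s); rewrite loop_shift subrK.
- move=> s t z; rewrite /= !in_itv /= => /andP[s0 s1] /andP[t0 t1].
  rewrite loop_shift /jet /curve_from /= => -[E1 E2].
  have E j : curve X iot None j (s + 0) = curve X iot None j (t + z%:~R + 0).
    by case: j => [n|//]; have [] := congr1 (@^~ n) E1.
  have := curve_inj ch (isT : valid None _) (isT : valid None _) E; rewrite !addr0 => st.
  suff z0 : z = 0 by rewrite st z0 addr0.
  have z1 : z < 1 by rewrite -(ltr_int R); clear -s1 t0 st; lra.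
  have z2 : -1 < z by rewrite -(ltr_int R); clear -s0 t1 st; lra.
  by clear -z1 z2; lia.
- split=> // j.
  have T i : derive1n j (curve_from X iot None 0 i) 1 =
      derive1n j (curve_from X iot None 0 (if i is Some pos then Some (pos + 1) else None)) 0.
    rewrite -{1}[1]add0r -derive1n_translate; congr (derive1n j _ 0); apply/funext => t.
    by rewrite /curve_from addrAC -[t + 0 + 1]/(t + 0 + 1%:~R) curve_translate.
  rewrite /shift_seq /jet /= T; congr (_, _); apply/funext => n.
  rewrite /orbit_of !T.
  by congr (derive1n j (curve_from _ _ _ _ (Some _)) 0, derive1n j (curve_from _ _ _ _ (Some _)) 0);
    clear; lia.
Qed.
End Heteroclinic.

(** * Symmetric homoclinic orbits *)

Section Homoclinic.
Variable R : realType.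
Implicit Types (d s t e mu delta : R) (X : cfg -> R -> cell -> R) (iot : cfg -> R -> R).
Implicit Types (k : site) (U : int -> R).

Lemma pair_norm_lt (a b e : R) : (`|(a, b) : R * R| < e) = (`|a| < e) && (`|b| < e).
Proof. by rewrite prod_normE /= gt_max. Qed.

Lemma mirror_right k U : (forall pos, U (mir k pos) = U pos) -> lim_left U 0 -> lim_right U 0.
Proof.
move=> sU h e e0; have [Z hZ] := h e e0.
exists (- Z) => z zZ; rewrite -sU; apply: hZ; rewrite /mir; case: (k) => /=; clear -zZ; lia.
Qed.

Lemma mirror_reverser k U : (forall pos, U (mir k pos) = U pos) ->
  forall n, reverser (orbit_of U n) = orbit_of U (site_center k - n).
Proof.
move=> sU n; rewrite /reverser /orbit_of /=.
rewrite -(sU n) -(sU (n - 1)) /mir; congr (U _, U _); clear; lia.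
Qed.

Lemma reverser_mirror k U : (forall n, reverser (orbit_of U n) = orbit_of U (site_center k - n)) ->
  forall pos, U (mir k pos) = U pos.
Proof.
move=> h pos; have [E _] := h pos; rewrite E /mir; congr U; clear; lia.
Qed.

Lemma reverser_symmetric k (w : int -> R * R) :
  (forall n, reverser (w n) = w (site_center k - n)) -> symmetric_orbit w.
Proof.
move=> h; apply/seteqP; split=> [_ [_ [n _ <-] <-]|_ [n _ <-]].
  by rewrite h; exists (site_center k - n).
exists (w (site_center k - n)); first by exists (site_center k - n).
by rewrite h; congr w; clear; lia.
Qed.

Lemma curve_site_type d X iot k s : charts d X iot -> valid (Some k) (Num.floor s) ->
  site_type k (orbit_of (fun n => curve X iot (Some k) (Some n) s)).
Proof.
move=> ch v; set U := fun n => _.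
have sU pos : U (mir k pos) = U pos by exact: curve_mir.
case: k v @U sU => v U sU /=.
  by exists 0; rewrite (mirror_reverser sU); congr orbit_of.
move=> [n]; rewrite /reverser /orbit_of /= => -[E _].
have [x F _] := curve_front (Some OffSite) s ch.
have lt p : p < 0 -> U (p - 1) < U p.
  move=> p0; have p1 : p - 1 < 0 by clear -p0; lia.
  rewrite /U /curve /piece (fold_neg _ p0) (fold_neg _ p1).
  have := @profile_lt _ _ _ _ _ (p - 1 + 1 + Num.floor s) F.
  have -> : p - 1 + 1 + Num.floor s + 1 = p + 1 + Num.floor s by clear; lia.
  by apply; rewrite /=; move: v p0; rewrite /=; clear; lia.
have [n0|n0] := ltP n 0; first by have := lt n n0; rewrite E ltxx.
have m0 : mir OffSite (n - 1) < 0 by rewrite /mir /=; clear -n0; lia.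
have := lt _ m0; rewrite sU.
have -> : mir OffSite (n - 1) - 1 = mir OffSite n by rewrite /mir /=; clear; lia.
by rewrite sU E ltxx.
Qed.

Lemma curve_homoclinic d X iot k s : charts d X iot -> valid (Some k) (Num.floor s) ->
  symmetric_homoclinics d `[d, 1 - d / 8]%classic k
    (orbit_of (fun n => curve X iot (Some k) (Some n) s), curve X iot (Some k) None s).
Proof.
move=> ch v; have [d0 d1 _ _] := ch.
have sU pos := curve_mir X iot k s pos.
have lU : lim_left (fun n => curve X iot (Some k) (Some n) s) 0.
  move=> e e0; have [Z hZ] := curve_left (Some k) s ch e0.
  by exists Z => z zZ; rewrite subr0; exact: hZ.
have /andP[mu1 mu2] := curve_mu (Some k) s ch; split=> /=.
- by rewrite in_itv /= mu1 /=; clear -mu2 d0; lra.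
- by apply: (@orbit_bounded _ _ 10) => n; exact: curve_bound ch.
- by apply: steady_orbit => // n; exact: curve_lattice ch _.
- by split; [exact: tends_minus|apply: tends_plus; exact: (mirror_right sU)].
- split; last exact: (mirror_reverser sU).
    by apply: (@reverser_symmetric k); exact: (mirror_reverser sU).
  exact: curve_site_type ch v.
Qed.

Lemma fold_ge (a n : int) k : a <= n -> n <= site_center k - 1 - a -> a <= fold (Some k) n.
Proof. by rewrite /fold; case: k => /= *; case: ifP; lia. Qed.

Lemma curve_plateau d X iot k e : charts d X iot -> 0 < e ->
  exists2 Z : nat, (0 < Z)%N & forall s (n : int),
    Z%:Z - 1 - Num.floor s <= fold (Some k) n ->
    `|curve X iot (Some k) (Some n) s - Uplus (curve X iot (Some k) None s)| < e.
Proof.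
move=> ch e0; have [Z Z0 hZ] := profile_right e0; exists Z => // s n zn.
have [x F _] := curve_front (Some k) s ch; rewrite (curve_uplus _ _ ch).
apply: hZ F _ _; first by clear -zn; lia.
move=> q; move: (in_range_fold (Some k) (Num.floor s) n) zn; rewrite /in_range.
by move: (fold _ _) (Num.floor s) => f L; rewrite /=; clear -Z0; lia.
Qed.

Lemma mu_of_close (p p' : R) : 1 < p < 3 / 2 -> 1 < p' < 3 / 2 ->
  `|mu_of p - mu_of p'| <= 15 * `|p - p'|.
Proof.
move=> /andP[a1 a2] /andP[b1 b2].
have -> : mu_of p - mu_of p' = (p + p') * (2 - p ^+ 2 - p' ^+ 2) * (p - p') by rewrite /mu_of; ring.
rewrite normrM ler_wpM2r // normrM (_ : 15 = 3 * 5); last by ring.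
apply: ler_pM => //; first by rewrite ger0_norm; clear -a1 a2 b1 b2; lra.
have h1 : 1 <= p ^+ 2 <= 9 / 4 by apply/andP; split; clear -a1 a2; nra.
have h2 : 1 <= p' ^+ 2 <= 9 / 4 by apply/andP; split; clear -b1 b2; nra.
by rewrite ler_norml; clear -h1 h2; lra.
Qed.

(* The witness [q] is the heteroclinic front with the same active value. *)
Lemma curve_shadow d X iot k e : charts d X iot -> 0 < e ->
  exists L0 : nat, forall s, L0%:R <= s -> exists q,
    [/\ -1 <= q, `|curve X iot (Some k) None s - curve X iot None None q| < e,
    `|Uplus (curve X iot (Some k) None s) - Uplus (curve X iot None None q)| < e &
    forall pos, pos < 0 -> `|curve X iot (Some k) (Some pos) s -
      curve X iot None (Some (pos + Num.floor s)) q| < e].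
Proof.
move=> ch e0; have [d0 d1 hX [hi _ _ _]] := ch.
have C0 : 0 < close_const d.
  have a1 : 0 < 5 / d by apply: divr_gt0; [clear; lra|exact: d0].
  have a2 : 0 < d / 1000 by clear -d0; lra.
  by apply: divr_gt0 a2; apply: mulr_gt0 a1; clear; lra.
(* Values at a site differ by at most 3 eta, so 1/800 keeps the phase of the witness within the
   margin 1/200. *)
pose eta := Num.min (1 / 800) (e / 100).
have eta0 : 0 < eta by rewrite lt_min; apply/andP; split; clear -e0; lra.
have [N hN] := geom_small (divr_gt0 eta0 C0).
exists N.+3 => s sN.
have LN : N.+3%:Z <= Num.floor s by rewrite floor_ge_int.
set L := Num.floor s in LN.
have [n Ln nN] : exists2 n : nat, L = n.+1%:Z & (N.+2 <= n)%N.
  by exists (absz L).-1; move: LN; clear; lia.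
have v : valid (Some k) L by rewrite /= Ln; move: nN; clear; lia.
have [Ds s1] := floor_sdom s; rewrite -/L in Ds s1.
set th := s - L%:~R in Ds s1.
pose x := iot (cfm (Some k) L) th; have [Dx tx] := hi (cfm (Some k) L) th Ds; rewrite -/x in Dx tx.
have F := state_front (Some k) L ch Ds; rewrite -/x in F.
set Y := state X iot (Some k) L th in F.
have F0 : front d None x (X None x) by exact: hX.
set Y0 := X None x in F0.
have cl i : `|Y i - Y0 i| <= eta.
  have F' : front d (Some (k, n.+1)) x Y by move: F; rewrite /cfm Ln.
  apply: le_trans (front_close F' F0 i) _.
  rewrite -ler_pdivlMl // mulrC; apply: le_trans (ltW (hN n _)); last by move: nN; clear; lia.
  by rewrite -[leLHS]mul1r ler_wpM2r ?exprn_ge0 //; clear; lra.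
have eta1 : eta <= 1 / 800 by rewrite ge_min lexx.
have eta2 : eta <= e / 100 by rewrite ge_min lexx orbT.
have pl : `|plat Y - plat Y0| <= 2 * eta.
  have := cl (true, 0%N); have := cl (false, 0%N); rewrite /plat !ler_norml => /andP[b1 b2] /andP[b3 b4].
  by clear -b1 b2 b3 b4; apply/andP; split; lra.
have pr z : `|profile Y z - profile Y0 z| <= 3 * eta.
  case: z => [q|q] /=; last by apply: le_trans (cl _) _; clear -eta0; lra.
  have := cl (true, q); move: pl; rewrite !ler_norml => /andP[b1 b2] /andP[b3 b4].
  by clear -b1 b2 b3 b4; apply/andP; split; lra.
pose q := tau d X None x.
have qth : `|q - th| <= 1 / 200.
  rewrite /q -tx /tau; apply: le_trans (phase_close_u _ _ _ _) _.
  have := pr 1; rewrite -/(state X iot (Some k) L th) -/Y -/Y0 distrC => /le_trans; apply.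
  by clear -eta1; lra.
have Dq : sdom q.
  move: qth s1; rewrite ler_norml => /andP[b1 b2] /andP[b3 b4].
  by apply/sdomP; clear -b1 b2 b3 b4; apply/andP; split; lra.
have Iq : iot None q = x.
  have [Dq' Eq'] := hi None q Dq; exact: (@tau_inj _ d X None _ _ d0 d1 hX Dq' Dx Eq').
have cE j : curve X iot None j q = piece X iot None 0 j q.
  have := @curve_piece _ d X iot None 0 j q ch isT; rewrite subr0; exact.
have q2 : -1 <= q by move/sdomP: Dq; clear => /andP[b _]; lra.
have [_ [pE _]] := front_mu F; have [_ [pE0 _]] := front_mu F0.
have mE : curve X iot None None q = mu_of (plat Y0) by rewrite cE /piece /state /= Iq.
exists q; split=> //; rewrite ?mE.
- have [[_ _ p1 _ _] _] := core_facts d0 d1 (front_core F).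
  have [[_ _ p2 _ _] _] := core_facts d0 d1 (front_core F0).
  by apply: le_lt_trans (mu_of_close p1 p2) _; clear -pl eta2 eta0; lra.
- by rewrite -[curve _ _ _ _ _]/(mu_of (plat Y)) pE pE0; apply: le_lt_trans pl _; clear -eta2 eta0; lra.
- move=> pos p0; rewrite cE -[curve _ _ _ _ _]/(profile Y (fold (Some k) pos + 1 + L)).
  rewrite fold_neg // /piece /state /= Iq -/Y0.
  have -> : pos + L + 1 + 0 = pos + 1 + L by clear; lia.
  by apply: le_lt_trans (pr _) _; clear -eta2 eta0; lra.
Qed.

Lemma curve_long d X iot k delta N : charts d X iot -> 0 < delta ->
  exists L0 : nat, forall s, L0%:R <= s ->
    long_plateau d `[d, 1 - d / 8]%classic (loop X iot) k delta N
      (orbit_of (fun n => curve X iot (Some k) (Some n) s), curve X iot (Some k) None s).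
Proof.
move=> ch e0; have e4 : 0 < delta / 4 by clear -e0; lra.
have [Z Z0 hZ] := curve_plateau k ch e4.
have [Z' hZ'] : exists Z' : nat, forall s (n : int), Z'%:Z - 1 - Num.floor s <= n ->
    `|curve X iot None (Some n) s - Uplus (curve X iot None None s)| < delta / 4.
  have [Z' _ hZ'] := profile_right e4; exists Z' => s n sn.
  have [x F _] := curve_front None s ch; rewrite (curve_uplus _ _ ch).
  by apply: hZ' F _ _ => //; rewrite /fold; clear -sn; lia.
have [L1 hL1] := curve_shadow k ch e4.
exists (L1 + Z + Z' + N + 5)%N => s sL.
have sL1 : L1%:R <= s by apply: le_trans sL; rewrite ler_nat -!addnA leq_addr.
have Lf : (L1 + Z + Z' + N + 5)%:Z <= Num.floor s by rewrite floor_ge_int.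
set L := Num.floor s in Lf.
have v : valid (Some k) L by rewrite /=; move: Lf; clear; lia.
have sU := curve_mir X iot k s.
split; first exact: curve_homoclinic ch v.
have [q [q0 q1 qU q2]] := hL1 s sL1.
set U := fun n => curve X iot (Some k) (Some n) s in sU *; set mu := curve X iot (Some k) None s in q1 *.
(* The plateau starts Z + 1 sites to the right of the active site -1 - L; the extra site is needed
   because w_n also reads U at n - 1. *)
exists (Z%:Z - L), (site_center k - (Z%:Z - L)); split.
- by rewrite addrC subrK.
- by move: Lf; clear; case: k => /=; lia.
- move=> n /andP[na nb]; rewrite /orbit_of /plateau_state /= pair_norm_lt /=.
  have dd : delta / 4 < delta by clear -e0; lra.
  apply/andP; split; apply: lt_trans dd; apply: hZ; rewrite -/L; apply: fold_ge.
  + by clear -na; lia.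
  + by clear -nb; lia.
  + by clear -na; lia.
  + by clear -nb; lia.
- exists (jet (@orbit_of R) (curve_from X iot None 0) 0 q), L; split.
  + by exists q.
  + by rewrite /jet /curve_from /= addr0; apply: lt_trans q1 _; clear -e0; lra.
  have main n : n *+ 2 <= site_center k -> `|U n - curve X iot None (Some (n + L)) q| < delta.
    move=> nc; have [n0|n0] := ltP n 0.
      by apply: lt_trans (q2 n n0) _; clear -e0; lra.
    (* Only with an on-site centre does the left half contain position 0. It mirrors -1, and there
       both orbits are compared through their plateau values. *)
    have k0 : site_center k = 0 /\ n = 0 by move: nc n0; clear; case: k => /=; lia.
    have fq : -1 <= Num.floor q by rewrite floor_ge_int.
    case: k0 => k0 ->; rewrite add0r.
    have a1 : `|U (-1) - Uplus mu| < delta / 4.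
      by apply: hZ; rewrite -/L fold_neg //; move: Lf; clear; lia.
    have a2 : `|curve X iot None (Some L) q - Uplus (curve X iot None None q)| < delta / 4.
      by apply: hZ'; move: Lf fq; clear; lia.
    have -> : U 0 = U (-1) by rewrite /U -(sU (-1)) /mir k0.
    move: a1 a2 qU; rewrite -/mu !ltr_norml => /andP[b1 b2] /andP[b3 b4] /andP[b5 b6].
    by clear -b1 b2 b3 b4 b5 b6; apply/andP; split; lra.
  move=> n nab; rewrite addrC subrK in nab.
  rewrite /jet /curve_from /= /orbit_of pair_norm_lt /=; apply/andP; split.
    have := main (n - 1); rewrite addr0 [n - 1 + L]addrAC; apply; move: nab; clear; lia.
  by have := main n; rewrite addr0; exact.
Qed.
End Homoclinic.

(** * The l^2 norm *)

Section EsumInt.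
Variable R : realType.

Lemma esum_int (a : int -> \bar R) : (forall n, 0 <= a n)%E ->
  (\esum_(n in [set: int]) a n = \sum_(i <oo) a (Posz i) + \sum_(i <oo) a (Negz i))%E.
Proof.
move=> a0; have inP : set_inj [set: nat] Posz by move=> i j _ _ [].
have inN : set_inj [set: nat] Negz by move=> i j _ _ [].
rewrite (esumID (Posz @` [set: nat])) //; congr (_ + _)%E.
  by rewrite setTI esum_image // nneseries_esumT.
have -> : [set: int] `&` ~` (Posz @` [set: nat]) = Negz @` [set: nat].
  apply/seteqP; split=> [[n|n] [_ h]|_ [n _ <-]]; [by case: h; exists n|by exists n|].
  by split=> // -[].
by rewrite esum_image // nneseries_esumT.
Qed.

Lemma nneseries_geometric (a : nat -> R) (C q : R) : 0 <= C -> 0 < q < 1 ->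
  (forall i, 0 <= a i <= C * q ^+ i) -> (\sum_(i <oo) (a i)%:E <= (C / (1 - q))%:E)%E.
Proof.
move=> C0 /andP[q0 q1] h; apply: lime_le.
  by apply: is_cvg_nneseries => n _ _; rewrite lee_fin; have /andP[] := h n.
near=> n; rewrite sumEFin lee_fin.
have qn : `|q| < 1 by rewrite gtr0_norm.
apply: le_trans (geometric_le_lim n C0 q0 qn).
by rewrite /series /=; apply: ler_sum => i _; have /andP[] := h i.
Unshelve. all: by end_near.
Qed.

Lemma l2_norm_finite (U : int -> R) (C : R) :
  (forall i : nat, `|U (Posz i)| <= C * 3^-1 ^+ i) -> (forall i : nat, `|U (Negz i)| <= C * 3^-1 ^+ i) ->
  (l2_norm U < +oo)%E.
Proof.
move=> h1 h2; apply: poweR_lty; rewrite esum_int; last by move=> n; rewrite lee_fin sqr_ge0.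
have C0 : 0 <= C by have := le_trans (normr_ge0 _) (h1 0%N); rewrite expr0 mulr1.
have b (u : R) i : `|u| <= C * 3^-1 ^+ i -> 0 <= u ^+ 2 <= C ^+ 2 * (3^-1 ^+ 2) ^+ i.
  move=> hu; rewrite sqr_ge0 /= exprAC -exprMn -real_normK ?num_real //.
  by rewrite lerXn2r ?nnegrE ?normr_ge0 //; exact: le_trans (normr_ge0 u) hu.
have q : 0 < (3^-1 : R) ^+ 2 < 1 by apply/andP; split; rewrite expr2; clear; lra.
have f (u : nat -> R) : (forall i, `|u i| <= C * 3^-1 ^+ i) -> (\sum_(i <oo) (u i ^+ 2)%:E < +oo)%E.
  move=> hu; apply: le_lt_trans (nneseries_geometric (sqr_ge0 C) q _) (ltry _) => i; exact: b.
by apply: lte_add_pinfty; exact: f.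
Qed.

(** 4 K^2 sites with values at least 1/2 contribute K^2 to the sum of squares. *)
Lemma l2_norm_ge (U : int -> R) (K : nat) :
  (forall i : nat, (i < 4 * K ^ 2)%N -> 1 / 2 <= U (Negz i)) -> (K%:R%:E <= l2_norm U)%E.
Proof.
move=> h; have a0 (n : int) : (0 <= (U n ^+ 2)%:E)%E by rewrite lee_fin sqr_ge0.
have S0 : (0 <= \esum_(n in [set: int]) (U n ^+ 2)%:E)%E by apply: esum_ge0.
have S1 : ((K%:R ^+ 2)%:E <= \esum_(n in [set: int]) (U n ^+ 2)%:E)%E.
  rewrite esum_int //; apply: le_trans (_ : \sum_(i <oo) (U (Negz i) ^+ 2)%:E <= _)%E; last first.
    by rewrite leeDr //; apply: nneseries_ge0 => n _ _.
  apply: le_trans (_ : \sum_(0 <= i < 4 * K ^ 2) (U (Negz i) ^+ 2)%:E <= _)%E; last exact: nneseries_lim_ge.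
  rewrite sumEFin lee_fin; apply: le_trans (_ : \sum_(0 <= i < 4 * K ^ 2) (1 / 4 : R) <= _).
    rewrite sumr_const_nat subn0 -[(1 / 4) *+ _]mulr_natr natrM natrX; clear; lra.
  apply: ler_sum_nat => i /andP[_ iK]; have := h i iK; clear => hi; nra.
rewrite /l2_norm; apply: le_trans (_ : (K%:R ^+ 2)%:E `^ 2^-1 <= _)%E.
  rewrite poweR_EFin lee_fin powR12_sqrt ?sqr_ge0 // sqrtr_sqr; exact: ler_norm.
apply: gt0_ler_poweR => //.
- by rewrite in_itv /= lee_fin sqr_ge0 leey.
- by rewrite in_itv /= S0 leey.
Qed.
End EsumInt.

(** * Long orbits lie on the curve; snaking *)

Section Snaking.
Variable R : realType.
Implicit Types (d s t e mu delta : R) (X : cfg -> R -> cell -> R) (iot : cfg -> R -> R).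
Implicit Types (k : site) (U : int -> R).

Lemma Uplus_ge1 mu : 0 <= mu <= 1 -> 1 <= Uplus mu.
Proof. by move=> h; have [_ []] := mu_of_uplus h. Qed.

(** In the coordinates of U the shadowing heteroclinic orbit has its active site at -1 - L, and its
    zero side cannot reach into the plateau. So L is at least about half the plateau length, and
    recognition applies. *)
Lemma long_on_curve d X iot k : charts d X iot -> exists2 delta0 : R, 0 < delta0 &
  forall delta (L0 N' : nat) p, delta <= delta0 -> (3 <= L0)%N -> (2 * L0 + 6 <= N')%N ->
    long_plateau d `[d, 1 - d / 8]%classic (loop X iot) k delta N' p ->
  exists2 t, L0%:R <= t &
    p = (orbit_of (fun n => curve X iot (Some k) (Some n) t), curve X iot (Some k) None t).
Proof.
move=> ch; have [d0 d1 _ _] := ch; have [e e0 hn] := near_loop (Some k) ch.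
exists (Num.min e (1 / 4)); first by rewrite lt_min e0; clear; lra.
move=> delta L0 N' [w mu]; rewrite le_min => /andP[de d4] L3 NL.
move=> [[/= Jmu _ ow _ [_ _ rw]] [a [b [abc Nab hp [_ [j [[s _ <-] hq1 hq2]]]]]]].
have [wE sw] := orbit_steady d0 ow; set U := fun n => (w n).2 in wE sw.
have sU : forall pos, U (mir k pos) = U pos.
  by apply: reverser_mirror => n; rewrite -wE.
move: hq1 hq2; rewrite /jet /curve_from /= addr0 => hq1 hq2.
have mu1 : 1 <= Uplus mu.
  move: Jmu; rewrite /= in_itv /= => /andP[m1 m2].
  by apply: Uplus_ge1; clear -m1 m2 d0; apply/andP; split; lra.
have cl n : n < 0 -> `|U n - curve X iot None (Some (n + j)) s| < delta.
  move=> n0; have hn2 : n *+ 2 <= a + b by rewrite abc; move: n0; clear; case: k => /=; lia.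
  by have := hq2 n hn2; rewrite wE /orbit_of pair_norm_lt => /andP[_].
set L := j + Num.floor s.
have a0 : a < 0 /\ 2 * a <= - N'%:Z by move: abc Nab; clear -NL; case: k => /=; lia.
case: a0 => a0 aN.
(* Otherwise site a lies on the zero side of the shadowing orbit, where values are at most x / 800,
   and yet U is within delta of a plateau value >= 1. *)
have La : 0 <= a + 1 + L.
  rewrite leNgt; apply/negP => aL.
  have := cl a a0; have ab : a <= a <= b by rewrite lexx /=; clear -Nab; lia.
  have := hp a ab; rewrite wE /orbit_of /plateau_state pair_norm_lt /= => /andP[_ h1].
  have [x F xE] := curve_front None s ch.
  have [n nE] : exists n : nat, a + j + 1 + Num.floor s = Negz n.
    by exists (absz (a + 1 + L)).-1; rewrite NegzE; move: aL; rewrite /L; clear; lia.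
  have cE : curve X iot None (Some (a + j)) s =
      state X iot None (Num.floor s) (s - (Num.floor s)%:~R) (false, n.+1).
    by rewrite /curve /piece /fold nE.
  rewrite cE; have := front_y_small n F; have := iot_lt (cfm None (Num.floor s)) ch (floor_sdom s).2.
  rewrite -xE; move: h1; rewrite !ltr_norml ler_norml => /andP[b1 b2] x4 /andP[b3 b4] /andP[b5 b6].
  clear -b1 b2 b3 b4 b5 b6 x4 mu1 d4; lra.
(* One more than L0, because the parameter found by recognition may lie 1/200 below L. *)
have LL0 : L0.+1%:Z <= L by clear -La aN NL; lia.
have vL : valid (Some k) (L - 1) by rewrite /=; clear -LL0 L3; lia.
have [k' [<-]|||t [/andP[t1 _] t2 t3]] := hn L s mu U vL sw.
- exact: sU.
- by apply: le_trans (ltW hq1) _.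
- move=> z; rewrite /in_range => zL.
  have n0 : -1 - L + z < 0 by clear -zL; lia.
  apply: le_trans de; have := cl _ n0.
  have -> : -1 - L + z + j = -1 - Num.floor s + z by rewrite /L; clear; lia.
  exact: ltW.
- exists t; last by rewrite wE t2 t3.
  have : L0.+1%:R <= L%:~R :> R by rewrite -[_.+1%:R]/(L0.+1%:~R) ler_int.
  by rewrite -[L0.+1]addn1 natrD; clear -t1 => h; lra.
Qed.

Lemma shifted_floor (L0 : nat) k t : (3 <= L0)%N -> 0 <= t -> valid (Some k) (Num.floor (t + L0%:R) - 1).
Proof.
move=> L3 t0; rewrite /=.
have : L0%:Z <= Num.floor (t + L0%:R) by rewrite floor_ge_int; have : L0%:Z%:~R = L0%:R :> R by []; move=> ->; clear -t0; lra.
by clear -L3; lia.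
Qed.

Lemma half_line_injective d X iot k (L0 : nat) s t : charts d X iot -> (3 <= L0)%N -> 0 <= s -> 0 <= t ->
  (forall j, curve_from X iot (Some k) L0%:R j s = curve_from X iot (Some k) L0%:R j t) -> s = t.
Proof.
move=> ch L3 s0 t0 E.
have v (r : R) : 0 <= r -> valid (Some k) (Num.floor (r + L0%:R)).
  by move=> r0; apply: valid_le (shifted_floor k L3 r0) _; rewrite gerBl.
exact: addIr (curve_inj ch (v s s0) (v t t0) E).
Qed.

Lemma half_line_smooth (V : normedModType R) (read : (int -> R) -> int -> V) d X iot k (L0 : nat) :
  faithful read -> charts d X iot -> (3 <= L0)%N ->
  smooth_curve `[0, +oo[ (jet read (curve_from X iot (Some k) L0%:R)).
Proof.
move=> fr ch L3; apply: jet_smooth_curve => // s; rewrite /= in_itv /= andbT => s0.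
  by apply: curve_smooth ch _; exact: shifted_floor.
by apply: curve_speed ch _; exact: shifted_floor.
Qed.

Lemma orbit_of_inj (U U' : int -> R) : orbit_of U = orbit_of U' -> U = U'.
Proof. by move=> E; apply/funext => n; have [] := congr1 (@^~ n) E. Qed.

(** The curve is the half-line of parameters from L0 on: L0 is large enough for its orbits to have
    plateaus longer than N, and N' is large enough for every orbit with plateau N' to have its
    parameter beyond L0. *)
Lemma charts_single_curve d X iot k : charts d X iot ->
  single_bifurcation_curve d `[d, 1 - d / 8]%classic (loop X iot) k.
Proof.
move=> ch; have [delta0 dl0 hQ] := long_on_curve k ch; exists delta0 => // delta /andP[dl dle] N.
have [L1 hP] := curve_long k N ch dl; pose L0 := (L1 + 3)%N.
have L3 : (3 <= L0)%N by rewrite /L0 leq_addl.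
have P t : 0 <= t -> L1%:R <= t + L0%:R by move=> t0; rewrite natrD; have := ler0n R 3; clear -t0; lra.
exists (N + (2 * L0 + 6))%N; first exact: leq_addr.
exists (jet (@orbit_of R) (curve_from X iot (Some k) L0%:R)); split.
- exact: half_line_smooth (orbit_of_faithful R) ch L3.
- move=> s t; rewrite !in_itv /= !andbT => s0 t0 [E1 E2]; apply: (half_line_injective ch L3 s0 t0).
  case=> [n|]; [|exact: E2]; by have := congr1 (@^~ n) (orbit_of_inj E1).
- move=> _ [t + <-]; rewrite /= in_itv /= andbT => t0.
  exact: hP (P t t0).
- move=> p /(hQ _ L0 _ _ dle L3 (leq_addl _ _)) [t t0 ->].
  exists (t - L0%:R); first by rewrite /= in_itv /= andbT subr_ge0.
  by rewrite /jet /curve_from /= subrK.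
Qed.

Lemma curve_l2_finite d X iot k s : charts d X iot -> valid (Some k) (Num.floor s) ->
  (l2_norm (fun n => curve X iot (Some k) (Some n) s) < +oo)%E.
Proof.
move=> ch v; have [x F xE] := curve_front (Some k) s ch.
set U := fun n => _; pose L := absz (Num.floor s).
(* Decay starts only at the active site, L sites before the last one; the factor 3^L accounts for
   the plateau. *)
have b i : `|U (Negz i)| <= 10 * 3 ^+ L * 3^-1 ^+ i.
  have [iL|iL] := leqP i L.
    apply: le_trans (curve_bound (Some k) s _ ch) _; rewrite -[leLHS]mulr1 -mulrA ler_pM2l; last by clear; lra.
    by rewrite exprVn -(subnK iL) exprD mulfK ?expf_neq0 ?pnatr_eq0 // exprn_ege1 //; clear; lra.
  rewrite /U /curve /piece fold_neg //.
  have -> : Negz i + 1 + Num.floor s = - (i - L)%N%:Z.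
    by rewrite NegzE; move: v iL; rewrite /L /=; clear; lia.
  rewrite profile_neg gtr0_norm; last exact: front_y_gt0 F _.
  apply: le_trans (front_y_geom _ F) _.
  have E : 3 ^+ L * 3^-1 ^+ i = 3^-1 ^+ (i - L) :> R.
    by rewrite -{1}(subnK (ltnW iL)) exprD mulrCA -exprMn mulfV ?pnatr_eq0 // expr1n mulr1.
  by rewrite -mulrA E; apply: ler_wpM2r; [apply: exprn_ge0|]; clear; lra.
apply: (l2_norm_finite (C := 10 * 3 ^+ L)) => // i.
have -> : U (Posz i) = U (Negz (if k is OnSite then i else i.+1)).
  rewrite /U -(curve_mir X iot k s); congr curve; congr Some; rewrite /mir NegzE.
  by case: (k) => /=; clear; lia.
apply: le_trans (b _) _; case: (k) => //; rewrite ler_pM2l; last first.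
  by apply: mulr_gt0; [clear; lra|apply: exprn_gt0; clear; lra].
by rewrite exprS ler_piMl ?exprn_ge0 //; clear; lra.
Qed.

Lemma charts_snakes d X iot k : charts d X iot ->
  snakes d `[d, 1 - d / 8]%classic (loop X iot) k.
Proof.
move=> ch; have [delta0 dl0 hQ] := long_on_curve k ch; exists delta0 => // delta /andP[dl dle] N.
have [d0 _ _ _] := ch.
have [L1 hP] := curve_long k N ch dl; pose L0 := (L1 + 3)%N.
have L3 : (3 <= L0)%N by rewrite /L0 leq_addl.
have P t : 0 <= t -> L1%:R <= t + L0%:R by move=> t0; rewrite natrD; have := ler0n R 3; clear -t0; lra.
have v (t : R) : 0 <= t -> valid (Some k) (Num.floor (t + L0%:R)).
  by move=> t0; apply: valid_le (shifted_floor k L3 t0) _; rewrite gerBl.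
have loc M t : 0 <= t -> long_plateau d `[d, 1 - d / 8]%classic (loop X iot) k delta M
      (orbit_of (fun n => curve X iot (Some k) (Some n) (t + L0%:R)), curve X iot (Some k) None (t + L0%:R)) ->
    localized_steady_states d `[d, 1 - d / 8]%classic (loop X iot) k delta M
      (jet (@id (int -> R) : (int -> R) -> int -> R^o) (curve_from X iot (Some k) L0%:R) 0 t).
  move=> t0 h; split; last exact: h.
  by move=> n; exact: (curve_lattice n ch (v t t0)).
exists (N + (2 * L0 + 6))%N; first exact: leq_addr.
exists (jet (@id (int -> R) : (int -> R) -> int -> R^o) (curve_from X iot (Some k) L0%:R)); split.
- split.
  + exact: half_line_smooth (id_faithful R) ch L3.
  + move=> s t; rewrite !in_itv /= !andbT => s0 t0 [E1 E2]; apply: (half_line_injective ch L3 s0 t0).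
    case=> [n|]; [|exact: E2]; by have := congr1 (@^~ n) E1.
  + move=> _ [t + <-]; rewrite /= in_itv /= andbT => t0.
    by apply: loc => //; exact: hP (P t t0).
  + move=> [U mu] [_ /(hQ _ L0 _ _ dle L3 (leq_addl _ _)) [t t0 [/orbit_of_inj -> ->]]].
    exists (t - L0%:R); first by rewrite /= in_itv /= andbT subr_ge0.
    by rewrite /jet /curve_from /= subrK.
- move=> M; have [L2 hM] := curve_long k M ch dl.
  near=> t; have t0 : 0 <= t by near: t; apply: nbhs_pinfty_ge; exact: num_real.
  apply: loc => //; apply: hM; apply: le_trans (_ : t <= _); last by rewrite lerDl.
  by near: t; apply: nbhs_pinfty_ge; exact: num_real.
- by move=> t t0; exact: curve_l2_finite ch (v t t0).
- have e0 : 0 < 1 / 2 :> R by clear; lra.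
  have [Z Z0 hZ] := curve_plateau k ch e0.
  apply/cvgeyPge => A; pose K := absz (Num.ceil A).
  near=> t; have t0 : 0 <= t by near: t; apply: nbhs_pinfty_ge; exact: num_real.
  have tK : (Z + 4 * K ^ 2)%:R <= t by near: t; apply: nbhs_pinfty_ge; exact: num_real.
  apply: le_trans (_ : K%:R%:E <= _)%E.
    rewrite lee_fin; apply: le_trans (ceil_ge A) _.
    rewrite /K -[`|_|%:R]/((Posz `|Num.ceil A|)%:~R) ler_int; move: (Num.ceil A) => c; clear; lia.
  apply: l2_norm_ge => i iK; rewrite /jet /= /curve_from.
  have Lf : (Z + 4 * K ^ 2)%:Z <= Num.floor (t + L0%:R).
    by rewrite floor_ge_int; apply: le_trans tK _; rewrite lerDl.
  have := hZ (t + L0%:R) (Negz i); rewrite fold_neg // => /(_ _).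
  have /andP[m1 m2] := curve_mu (Some k) (t + L0%:R) ch.
  have := @Uplus_ge1 (curve X iot (Some k) None (t + L0%:R)).
  move=> u1 h; have {}u1 : 1 <= Uplus (curve X iot (Some k) None (t + L0%:R)).
    by apply: u1; clear -m1 m2 d0; apply/andP; split; lra.
  have : `|curve X iot (Some k) (Some (Negz i)) (t + L0%:R) - Uplus (curve X iot (Some k) None (t + L0%:R))| < 1 / 2.
    by apply: h; rewrite NegzE; move: Lf iK; clear; lia.
  by rewrite ltr_norml => /andP[h1 _]; clear -h1 u1; lra.
Unshelve. all: by end_near.
Qed.
End Snaking.

Theorem corollary5p2 (R : realType) :
  exists2 dstar : R, 0 < dstar &
    forall d : R, 0 < d <= dstar ->
      exists (a b : R) (Gamma : set (seqpar R (R * R)%type)),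
        [/\ 0 < a < b /\ b < 1,
            one_loop d `[a, b] Gamma,
            single_bifurcation_curve d `[a, b] Gamma OnSite,
            single_bifurcation_curve d `[a, b] Gamma OffSite &
            snakes d `[a, b] Gamma OnSite /\ snakes d `[a, b] Gamma OffSite].
Proof.
exists (dmax R); first by rewrite /dmax exprn_gt0 // invr_gt0 ltr0n.
move=> d /andP[d0 d1]; have [X [iot ch]] := charts_exist d0 d1.
(* Along all fronts d <= mu <= 1 - d / 4, so this interval contains the whole range of mu, folds
   included. *)
exists d, (1 - d / 8), (loop X iot); have dm := dmax_mul d1; split.
- by clear -d0 dm; split; [apply/andP; split|]; lra.
- exact: loop_one_loop.
- exact: charts_single_curve.
- exact: charts_single_curve.
- by split; exact: charts_snakes.
Qed.
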